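(* Let $G$ be a discrete free Fuchsian group of rank two acting on the unit disc $\Delta$, without parabolic elements, whose generators have intersecting axes, and let $A,B$ be stopping generators of $G$, with $p=Ax_A\cap Ax_B$ and $p_A,p_B\in\Delta$ the points such that $A=E_pE_{p_A}$, $B=E_pE_{p_B}$. Let $R_0$ be reflection in $Ax_{[B^{-1},A^{-1}]}$, let $p'=R_0(p)$, $p_A'=R_0(p_A)$, $p_B'=R_0(p_B)$, and let $\Gamma=\langle A,B,A',B'\rangle$ with $A'=R_0AR_0$, $B'=R_0BR_0$, so that $\Delta/\Gamma$ is the Nielsen double $S_K$ of $G$. Then $E_p$ induces a conformal involution of $S_K=\Delta/\Gamma$ which is the hyperelliptic involution, and the Weierstrass points of $S_K$ are the projections of the six points $p,p_A,p_B,p',p_A',p_B'$ under $\Delta\to\Delta/\Gamma$.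
   Context: $\Delta=\{|z|<1\}$ with hyperbolic metric $\rho_\Delta$. $[X,Y]=XYX^{-1}Y^{-1}$. $Ax_W$ is the geodesic in $\Delta$ joining the fixed points of the hyperbolic element $W$. $E_x$ is the elliptic element of order two preserving $\Delta$ and fixing $x\in\Delta$. Stopping generators (intersecting axes): the pair $A,B$ is stopping if the distances between $p,p_A,p_B$ are minimal among all Nielsen equivalent pairs of generators, i.e. $\rho_\Delta(p,p_A)\le\rho_\Delta(p,p_B)\le\rho_\Delta(p_A,p_B)$ and the traces of $A,B$ (in absolute value) are minimal among all pairs of generators of $G$. The Nielsen region $K(G)\subset\Delta$ is the hyperbolic convex hull in $\Delta$ of the limit set of $G$; the Nielsen double $S_K$ is the conformal double of the Nielsen kernel $K(G)/G$ (two mirror-image copies glued along the boundary by the identity) with its hyperbolic metric; it has genus two and is uniformized by the Fuchsian group $\Gamma$. The Weierstrass points of a compact Riemann surface of genus two are the six fixed points of its hyperelliptic involution (the unique conformal involution with six fixed points). *)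

(* Defs.v *)
(* Stdlib real numbers and Coquelicot complex numbers. *)
From Stdlib Require Import Reals Lra Psatz List.
From Coquelicot Require Import Coquelicot.
Import ListNotations.
Local Open Scope R_scope.

(** * The disc and its conformal automorphisms *)

Definition Disc : Type := {z : C | Cmod z < 1}.
Definition dval (z : Disc) : C := proj1_sig z.
Coercion dval : Disc >-> C.

(* The matrix [[a, b], [conj b, conj a]] of SU(1,1). Elements of PSU(1,1) are
   these matrices up to sign, see [same]. *)
Record aut : Type := Aut {
  ca : C;
  cb : C;
  aut_det : Cmod ca ^ 2 - Cmod cb ^ 2 = 1
}.

(* Used on the closed disc, where the denominator does not vanish. *)
Definition moebius (g : aut) (z : C) : C :=
  ((ca g * z + cb g) / (Cconj (cb g) * z + Cconj (ca g)))%C.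

Lemma aut_gap (g : aut) (z : C) :
  Cmod (Cconj (cb g) * z + Cconj (ca g))%C ^ 2 - Cmod (ca g * z + cb g)%C ^ 2
  = 1 - Cmod z ^ 2.
Proof.
pose proof (aut_det g) as h.
destruct (ca g) as [a1 a2], (cb g) as [b1 b2], z as [x y].
rewrite !Cmod2_alt in h |- *.
unfold Re, Im, Cplus, Cmult, Cconj in h |- *; cbn [fst snd] in h |- *.
transitivity (((a1 ^ 2 + a2 ^ 2) - (b1 ^ 2 + b2 ^ 2)) * (1 - (x ^ 2 + y ^ 2)));
  [ring |].
rewrite h, Cmod2_alt; unfold Re, Im; cbn [fst snd]; ring.
Qed.

Lemma moebius_disc (g : aut) (z : C) : Cmod z < 1 -> Cmod (moebius g z) < 1.
Proof.
intros hz; unfold moebius.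
pose proof (aut_gap g z) as hg.
set (d := (Cconj (cb g) * z + Cconj (ca g))%C) in *.
set (n := (ca g * z + cb g)%C) in *.
pose proof (Cmod_ge_0 z); pose proof (Cmod_ge_0 d); pose proof (Cmod_ge_0 n).
assert (hlt : Cmod n < Cmod d) by nra.
assert (hd : 0 < Cmod d) by lra.
rewrite Cmod_div.
- apply (Rmult_lt_reg_r (Cmod d)); [exact hd|].
  unfold Rdiv; rewrite Rmult_assoc, Rinv_l; lra.
- apply Cmod_gt_0; exact hd.
Qed.

Definition act (g : aut) (z : Disc) : Disc :=
  exist _ (moebius g z) (moebius_disc g z (proj2_sig z)).

Definition same (g h : aut) : Prop := forall z : Disc, act g z = act h z.

Lemma one_det : Cmod 1 ^ 2 - Cmod 0 ^ 2 = 1.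
Proof. rewrite Cmod_1, Cmod_0; ring. Qed.

Definition one : aut := Aut 1 0 one_det.

Lemma mul_det (g h : aut) :
  Cmod (ca g * ca h + cb g * Cconj (cb h))%C ^ 2
  - Cmod (ca g * cb h + cb g * Cconj (ca h))%C ^ 2 = 1.
Proof.
pose proof (aut_det g) as hg; pose proof (aut_det h) as hh.
destruct (ca g) as [a1 a2], (cb g) as [b1 b2], (ca h) as [c1 c2],
  (cb h) as [d1 d2].
rewrite !Cmod2_alt in hg, hh |- *.
unfold Re, Im, Cplus, Cmult, Cconj in hg, hh |- *; cbn [fst snd] in hg, hh |- *.
transitivity (((a1 ^ 2 + a2 ^ 2) - (b1 ^ 2 + b2 ^ 2))
              * ((c1 ^ 2 + c2 ^ 2) - (d1 ^ 2 + d2 ^ 2))); [ring|].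
rewrite hg, hh; ring.
Qed.

(* Matrix product; it acts as the composition [act g] after [act h]. *)
Definition mul (g h : aut) : aut := Aut _ _ (mul_det g h).

Lemma inv_det (g : aut) : Cmod (Cconj (ca g)) ^ 2 - Cmod (- cb g)%C ^ 2 = 1.
Proof. rewrite Cmod_conj, Cmod_opp; apply aut_det. Qed.

Definition inv (g : aut) : aut := Aut _ _ (inv_det g).

Definition commutator (g h : aut) : aut := mul (mul g h) (mul (inv g) (inv h)).

(* Trace of the matrix, well defined on PSU(1,1) up to sign. *)
Definition abs_trace (g : aut) : R := Rabs (2 * Re (ca g)).

Definition hyperbolic (g : aut) : Prop := 2 < abs_trace g.
Definition parabolic (g : aut) : Prop := abs_trace g = 2 /\ ~ same g one.

Lemma half_turn_det (x : Disc) :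
  Cmod (Ci * RtoC ((1 + Cmod x ^ 2) / (1 - Cmod x ^ 2)))%C ^ 2
  - Cmod (Ci * RtoC (- 2 / (1 - Cmod x ^ 2)) * x)%C ^ 2 = 1.
Proof.
destruct x as [x hx]; simpl dval; pose proof (Cmod_ge_0 x).
assert (0 < 1 - Cmod x ^ 2) by nra.
rewrite !Cmod_mult, Cmod_Ci, !Cmod_R, !Rpow_mult_distr, <- !Rsqr_pow2.
rewrite <- !Rsqr_abs; unfold Rsqr; field; lra.
Qed.

(* The elliptic element E_x of order two with fixed point x:
   z |-> ((1 + |x|^2) z - 2 x) / (2 conj(x) z - (1 + |x|^2)). *)
Definition half_turn (x : Disc) : aut := Aut _ _ (half_turn_det x).

(** * Hyperbolic geometry *)

(* Hyperbolic distance for the metric 2 |dz| / (1 - |z|^2). *)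
Definition rho (z w : Disc) : R :=
  let n := Cmod (z - w)%C in
  let d := Cmod (1 - Cconj w * z)%C in
  ln ((d + n) / (d - n)).

(* The geodesic with endpoints xi, eta on the unit circle: the image of the
   diameter (-1, 1) under an automorphism taking -1 to xi and 1 to eta. *)
Definition geodesic (xi eta : C) (z : Disc) : Prop :=
  exists (g : aut) (t : Disc),
    moebius g (- 1)%C = xi /\ moebius g 1%C = eta /\
    Im t = 0 /\ z = act g t.

Definition axis (g : aut) (z : Disc) : Prop :=
  exists xi eta : C,
    Cmod xi = 1 /\ Cmod eta = 1 /\ xi <> eta /\
    moebius g xi = xi /\ moebius g eta = eta /\ geodesic xi eta z.

Lemma conj_disc (z : C) : Cmod z < 1 -> Cmod (Cconj z) < 1.
Proof. rewrite Cmod_conj; trivial. Qed.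

Definition conjD (z : Disc) : Disc :=
  exist _ (Cconj z) (conj_disc z (proj2_sig z)).

(* Every anticonformal automorphism of the disc is complex conjugation followed
   by an element of PSU(1,1). *)
Definition is_reflection_in (L : Disc -> Prop) (r : Disc -> Disc) : Prop :=
  (exists s : aut, forall z, r z = act s (conjD z)) /\
  (forall z, L z -> r z = z).

(* Closed under hyperbolic segments. *)
Definition hyp_convex (K : Disc -> Prop) : Prop :=
  forall z w u, K z -> K w -> rho z u + rho u w = rho z w -> K u.

(** * Fuchsian groups *)

(* A subgroup of PSU(1,1), as a set of matrices closed under [same]. *)
Definition is_subgroup (G : aut -> Prop) : Prop :=
  G one /\ (forall g h, G g -> G h -> G (mul g h)) /\
  (forall g, G g -> G (inv g)) /\ (forall g h, same g h -> G g -> G h).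

Definition is_discrete (G : aut -> Prop) : Prop :=
  exists eps : R, 0 < eps /\
    forall g, G g -> Cmod (ca g - 1)%C < eps -> Cmod (cb g) < eps -> same g one.

Definition is_fuchsian (G : aut -> Prop) : Prop :=
  is_subgroup G /\ is_discrete G.

Definition acts_freely (G : aut -> Prop) : Prop :=
  forall g z, G g -> act g z = z -> same g one.

Inductive generated (l : list aut) : aut -> Prop :=
| gen_in g : In g l -> generated l g
| gen_one : generated l one
| gen_mul g h : generated l g -> generated l h -> generated l (mul g h)
| gen_inv g : generated l g -> generated l (inv g)
| gen_same g h : same g h -> generated l g -> generated l h.

Definition generates (l : list aut) (G : aut -> Prop) : Prop :=
  forall g, G g <-> generated l g.

(* In a letter (x, s), x selects the generator and s = true marks an inverse. *)
Definition letter (X Y : aut) (c : bool * bool) : aut :=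
  let g := if fst c then Y else X in if snd c then inv g else g.

Definition word_eval (X Y : aut) (w : list (bool * bool)) : aut :=
  fold_right (fun c g => mul (letter X Y c) g) one w.

Definition reduced (w : list (bool * bool)) : Prop :=
  forall u v x s, w <> u ++ (x, s) :: (x, negb s) :: v.

Definition is_free_of_rank_two (G : aut -> Prop) : Prop :=
  exists X Y, generates [X; Y] G /\
    forall w, reduced w -> w <> [] -> ~ same (word_eval X Y w) one.

Inductive nielsen_equivalent (X Y : aut) : aut -> aut -> Prop :=
| nielsen_same X' Y' : same X X' -> same Y Y' -> nielsen_equivalent X Y X' Y'
| nielsen_swap X' Y' :
    nielsen_equivalent X Y X' Y' -> nielsen_equivalent X Y Y' X'
| nielsen_inv X' Y' :
    nielsen_equivalent X Y X' Y' -> nielsen_equivalent X Y (inv X') Y'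
| nielsen_mul X' Y' :
    nielsen_equivalent X Y X' Y' -> nielsen_equivalent X Y (mul X' Y') Y'.

(** * Stopping generators *)

(* X, Y are hyperbolic, their axes meet exactly in q, and X = E_q E_x,
   Y = E_q E_y. *)
Definition intersecting_pair (X Y : aut) (q x y : Disc) : Prop :=
  hyperbolic X /\ hyperbolic Y /\
  (forall z, (axis X z /\ axis Y z) <-> z = q) /\
  same X (mul (half_turn q) (half_turn x)) /\
  same Y (mul (half_turn q) (half_turn y)).

Definition ordered_triple (q x y : Disc) : Prop :=
  rho q x <= rho q y /\ rho q y <= rho x y.

(* Minimality is componentwise for the distances and the traces listed in
   nondecreasing order. Restricting to ordered competitors loses nothing:
   permuting q, x, y, resp. X, Y, gives a Nielsen equivalent pair. *)
Definition stopping (G : aut -> Prop) (A B : aut) (p pA pB : Disc) : Prop :=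
  generates [A; B] G /\
  ordered_triple p pA pB /\
  (forall X Y q x y,
     nielsen_equivalent A B X Y -> intersecting_pair X Y q x y ->
     ordered_triple q x y ->
     rho p pA <= rho q x /\ rho p pB <= rho q y /\ rho pA pB <= rho x y) /\
  (forall X Y,
     generates [X; Y] G -> abs_trace X <= abs_trace Y ->
     abs_trace A <= abs_trace X /\ abs_trace B <= abs_trace Y).

(** * The quotient surface *)

Definition orbit (G : aut -> Prop) (z w : Disc) : Prop :=
  exists g, G g /\ w = act g z.

Definition surface (G : aut -> Prop) : Type :=
  {X : Disc -> Prop | exists z, X = orbit G z}.

Definition proj (G : aut -> Prop) (z : Disc) : surface G :=
  exist _ (orbit G z) (ex_intro _ z eq_refl).

(* Holomorphy in the charts given by the local inverses of the projection:
   f has a holomorphic lift near every point of the disc. *)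
Definition holomorphic {G : aut -> Prop} (f : surface G -> surface G) : Prop :=
  forall z : Disc, exists (r : R) (phi : C -> C), 0 < r /\
    forall w : Disc, Cmod (w - z)%C < r ->
      @ex_derive C_AbsRing (AbsRing_NormedModule C_AbsRing) phi (dval w) /\
      exists v : Disc, phi w = v /\ f (proj G w) = proj G v.

Definition conformal_involution {G : aut -> Prop}
    (J : surface G -> surface G) : Prop :=
  holomorphic J /\ (forall x, J (J x) = x) /\ (exists x, J x <> x).

(* In genus two: the conformal involution with exactly six fixed points. *)
Definition hyperelliptic_involution {G : aut -> Prop}
    (J : surface G -> surface G) : Prop :=
  conformal_involution J /\
  exists l : list (surface G),
    NoDup l /\ length l = 6%nat /\ forall x, In x l <-> J x = x.

(* W is the set of Weierstrass points of a surface of genus two. *)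
Definition weierstrass_points {G : aut -> Prop} (W : surface G -> Prop) : Prop :=
  exists J : surface G -> surface G,
    hyperelliptic_involution J /\ forall x, W x <-> J x = x.

(** * The Nielsen double *)

Definition limit_point (G : aut -> Prop) (xi : C) : Prop :=
  Cmod xi = 1 /\
  exists z : Disc, forall eps, 0 < eps ->
    exists g, G g /\ Cmod (act g z - xi)%C < eps.

(* Smallest hyperbolically convex set containing the geodesics that join
   limit points. *)
Definition nielsen_region (G : aut -> Prop) (z : Disc) : Prop :=
  forall K : Disc -> Prop,
    hyp_convex K ->
    (forall xi eta u, limit_point G xi -> limit_point G eta -> xi <> eta ->
       geodesic xi eta u -> K u) ->
    K z.

Definition boundary_of (K : Disc -> Prop) (z : Disc) : Prop :=
  forall r, 0 < r ->
    (exists w : Disc, Cmod (w - z)%C < r /\ K w) /\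
    (exists w : Disc, Cmod (w - z)%C < r /\ ~ K w).

(* (b, z) is the point over z in the first (b = false) or second (b = true) copy
   of K(G)/G. Two of them are the same point of the double iff z and w agree in
   K(G)/G and either the copies agree or the point lies on the boundary. *)
Definition double_eq (G : aut -> Prop) (s t : bool * Disc) : Prop :=
  proj G (snd s) = proj G (snd t) /\
  (fst s = fst t \/ boundary_of (nielsen_region G) (snd s)).

Definition double_map (Gam : aut -> Prop) (r : Disc -> Disc)
    (s : bool * Disc) : surface Gam :=
  proj Gam (if fst s then r (snd s) else snd s).

(* Disc / Gam is the conformal double of K(G)/G: the first copy embeds by the
   identity of the disc (conformally), the mirror image by the reflection r
   (anticonformally), and the resulting map from the double is bijective. *)
Definition is_nielsen_double (G Gam : aut -> Prop) (r : Disc -> Disc) : Prop :=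
  is_fuchsian Gam /\ acts_freely Gam /\
  (forall x : surface Gam,
     exists s, nielsen_region G (snd s) /\ double_map Gam r s = x) /\
  (forall s t, nielsen_region G (snd s) -> nielsen_region G (snd t) ->
     (double_map Gam r s = double_map Gam r t <-> double_eq G s t)).

(* Main.v *)
(** Work in the hyperboloid model of the hyperbolic plane, where PSU(1,1) acts
    by Lorentz transformations of [V] = R^(2,1).  Let [q I1], [q I2], [q I3] be
    the unit vectors of [pA], [p], [pB].  Three vectors [FF q i] in their span
    are permuted by the half-turns [HH q i]: each half-turn exchanges two of them.
    [FF q I2] is fixed by the product of the three half-turns, whose square
    is the commutator, so it is normal to the axis of reflection; it is spacelike
    because a discrete free group without parabolics acts freely and has
    hyperbolic commutator.  In the coordinates [ph] of the basis [FF q],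
    the cone [0 <= ph] is a fundamental domain of the group generated by the three
    half-turns, and ping-pong shows that the orbit [NN q] of the normals bounds
    pairwise disjoint half-planes.  The complement of these half-planes is the
    Nielsen region.  A second ping-pong, for the reflections in the walls,
    describes the action of the group of the double on the region: every
    element is a product of an even number of wall reflections with an
    even word in the half-turns ([Ext q true]).  A fixed point of the involution
    is thus a fixed point of an odd word in the half-turns, or the mirror image of
    one, hence equivalent to one of the six points. *)
From Stdlib Require Import Reals Lra Psatz Bool Classical ClassicalEpsilon
  FunctionalExtensionality PropExtensionality ProofIrrelevance FinFun ZArith.
From Coquelicot Require Import Coquelicot.
Require Import Defs.
From Stdlib Require Import List.
Import ListNotations.
Local Open Scope R_scope.

(** * The hyperboloid model *)

(** In this model the side of a geodesic on which a point lies is the sign of [dot] with the normal,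
    and half-turns and reflections act linearly on all of [V], so that they apply to normals as well
    as to points. The group [G] contains none of the three half-turns; it consists of the even words
    in them. Hence parity accompanies every statement about words: odd words are lifts of the
    involution, even words are deck transformations, and the parity of the wall reflections likewise
    tells the two copies of the region apart. Both ping-pong domains are reached by descent, but for
    different reasons. For the half-turns each step gains at least a fixed amount [eta]. For the
    wall reflections each step only gives a strict decrease, so termination comes from discreteness
    of [Gam]; this has to be proved beforehand, from the positive gap between an interior point of
    the region and all the walls. *)

Record V : Type := mkV { vx : R; vy : R; vt : R }.

Definition vadd (v w : V) : V := mkV (vx v + vx w) (vy v + vy w) (vt v + vt w).
Definition vscal (k : R) (v : V) : V := mkV (k * vx v) (k * vy v) (k * vt v).
Definition dot (v w : V) : R := vx v * vx w + vy v * vy w - vt v * vt w.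
Definition vzero : V := mkV 0 0 0.

Definition in_H2 (v : V) : Prop := dot v v = -1 /\ 0 < vt v.

Lemma V_eq (v w : V) : vx v = vx w -> vy v = vy w -> vt v = vt w -> v = w.
Proof. destruct v, w; simpl; intros; subst; reflexivity. Qed.

Ltac vring := apply V_eq; unfold vadd, vscal, dot, vzero; simpl; ring.
Ltac vfield := apply V_eq; unfold vadd, vscal, dot, vzero; simpl; field.

Lemma dot_comm v w : dot v w = dot w v.
Proof. unfold dot; ring. Qed.

Lemma dot_addl u v w : dot (vadd u v) w = dot u w + dot v w.
Proof. unfold dot, vadd; simpl; ring. Qed.

Lemma dot_addr u v w : dot w (vadd u v) = dot w u + dot w v.
Proof. unfold dot, vadd; simpl; ring. Qed.

Lemma dot_scall k v w : dot (vscal k v) w = k * dot v w.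
Proof. unfold dot, vscal; simpl; ring. Qed.

Lemma dot_scalr k v w : dot w (vscal k v) = k * dot w v.
Proof. unfold dot, vscal; simpl; ring. Qed.

#[local] Hint Rewrite dot_addl dot_addr dot_scall dot_scalr : dot.

Lemma reverse_cauchy_schwarz v w :
  dot v v < 0 -> 0 < vt v -> dot w w <= 0 -> 0 < vt w ->
  dot v w < 0 /\ dot v v * dot w w <= dot v w ^ 2.
Proof.
destruct v as [x y t], w as [x' y' t']; unfold dot; simpl; intros hv ht hw ht'.
assert (hcs : (x * x' + y * y') ^ 2 <= (x * x + y * y) * (x' * x' + y' * y')).
{ pose proof (pow2_ge_0 (x * y' - y * x')); nra. }
set (s := x * x' + y * y') in *.
set (a := x * x + y * y) in *. set (b := x' * x' + y' * y') in *.
assert (ha : 0 <= a) by (unfold a; nra). assert (hb : 0 <= b) by (unfold b; nra).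
assert (h1 : a < t * t) by lra. assert (h2 : b <= t' * t') by lra.
assert (hlt : s < t * t').
{ destruct (Rlt_or_le s (t * t')) as [h|h]; [exact h|exfalso].
  assert (0 < t * t') by nra.
  assert ((t * t') * (t * t') <= s * s) by nra.
  destruct (Req_dec b 0) as [hb0|hb0].
  - rewrite hb0 in hcs; nra.
  - assert (a * b < t * t * (t' * t')).
    { apply Rlt_le_trans with (t * t * b); nra. }
    nra. }
split; [lra|].
(* [(m, n)] is the spatial part of [t w - t' v], whose time component vanishes; the identity [E]
   expresses the defect of the inequality through it. *)
set (m := t * x' - t' * x). set (n := t * y' - t' * y).
assert (h3 : t ^ 2 * (x * y' - y * x') ^ 2 <= a * (m ^ 2 + n ^ 2)).
{ replace (t ^ 2 * (x * y' - y * x') ^ 2) with ((x * n - y * m) ^ 2) by (unfold m, n; ring).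
  pose proof (pow2_ge_0 (x * m + y * n)); unfold a; nra. }
assert (h4 : (x * y' - y * x') ^ 2 <= m ^ 2 + n ^ 2).
{ pose proof (pow2_ge_0 m); pose proof (pow2_ge_0 n).
  apply Rmult_le_reg_l with (t ^ 2); [nra|].
  apply Rle_trans with (1 := h3); apply Rmult_le_compat_r; nra. }
assert (E : (s - t * t') ^ 2 - (a - t * t) * (b - t' * t')
            = m ^ 2 + n ^ 2 - (x * y' - y * x') ^ 2) by (unfold s, a, b, m, n; ring).
lra.
Qed.

(** Otherwise [w] vanishes or its negative is future pointing, and [reverse_cauchy_schwarz] gives
    the wrong sign. Vectors constructed as linear combinations are recognised as future pointing in
    this way. *)
Lemma future_of_dot v w :
  dot v v < 0 -> 0 < vt v -> dot w w <= 0 -> dot v w < 0 -> 0 < vt w.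
Proof.
intros hv ht hw h.
destruct (Rlt_or_le 0 (vt w)) as [h0|h0]; [exact h0|exfalso].
destruct (Req_dec (vt w) 0) as [e|e].
- assert (vx w = 0 /\ vy w = 0) as [ex ey].
  { unfold dot in hw; rewrite e in hw; split; nra. }
  unfold dot in h; rewrite e, ex, ey in h; lra.
- assert (hn : 0 < vt (vscal (-1) w)) by (simpl; lra).
  assert (hw' : dot (vscal (-1) w) (vscal (-1) w) <= 0).
  { autorewrite with dot; lra. }
  destruct (reverse_cauchy_schwarz v _ hv ht hw' hn) as [h1 _].
  rewrite dot_scalr in h1; lra.
Qed.

Lemma in_H2_dot v w : in_H2 v -> in_H2 w -> dot v w <= -1.
Proof.
intros [hv tv] [hw tw].
destruct (reverse_cauchy_schwarz v w) as [h1 h2]; try lra.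
rewrite hv, hw in h2; nra.
Qed.

Lemma in_H2_dot_eq v w : in_H2 v -> in_H2 w -> dot v w = -1 -> v = w.
Proof.
intros [hv tv] [hw tw] h.
unfold dot in *; destruct v as [x y t], w as [x' y' t']; simpl in *.
assert (hxy : (t' * x - t * x') ^ 2 + (t' * y - t * y') ^ 2 = - (t - t') ^ 2).
{ assert (E : x * x' + y * y' = t * t' - 1) by lra.
  assert (E1 : x * x + y * y = t * t - 1) by lra.
  assert (E2 : x' * x' + y' * y' = t' * t' - 1) by lra.
  transitivity (t' ^ 2 * (x * x + y * y) + t ^ 2 * (x' * x' + y' * y') - 2 * t * t' * (x * x' + y * y')); [ring|].
  rewrite E, E1, E2; ring. }
pose proof (pow2_ge_0 (t - t')). pose proof (pow2_ge_0 (t' * x - t * x')).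
pose proof (pow2_ge_0 (t' * y - t * y')).
assert (ht : t = t') by nra. subst t'.
assert (t * x - t * x' = 0) by nra. assert (t * y - t * y' = 0) by nra.
apply V_eq; simpl; try reflexivity; apply Rmult_eq_reg_l with t; lra.
Qed.

Lemma in_H2_of_neg_dot v w : in_H2 v -> dot w w = -1 -> dot v w < 0 -> in_H2 w.
Proof.
intros [hv tv] hw h; split; [exact hw|].
apply (future_of_dot v w); lra.
Qed.

(* If a half-plane separates [z] from [w], and [z] is at distance at least
   [arsinh (e / sqrt dl)] from its boundary, then so far is [w]. *)
Lemma separated_far z w v e dl :
  in_H2 z -> in_H2 w -> 0 < dl -> dot v v = dl -> 0 <= e -> dot z v <= - e ->
  0 <= dot w v -> 1 + e ^ 2 / dl <= dot z w ^ 2.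
Proof.
intros hz hw hdl hv he hzv hwv.
(* [z'] is the orthogonal projection of [z] to the plane of the geodesic. The correction
   [dot z v * dot w v / dl] has the favourable sign because the geodesic separates the points. *)
set (z' := vadd z (vscal (- (dot z v / dl)) v)).
assert (n1 : dot z' z' = -1 - dot z v ^ 2 / dl).
{ unfold z'; autorewrite with dot; rewrite hv, (dot_comm v z), (proj1 hz); field; lra. }
assert (hq : 0 <= dot z v ^ 2 / dl).
{ apply Rmult_le_pos; [apply pow2_ge_0|left; apply Rinv_0_lt_compat; lra]. }
assert (n2 : dot z z' = -1 - dot z v ^ 2 / dl).
{ unfold z'; autorewrite with dot; rewrite (proj1 hz); field; lra. }
assert (hf : 0 < vt z').
{ apply (future_of_dot z z'); destruct hz; lra. }
destruct hw as [hw tw].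
destruct (reverse_cauchy_schwarz z' w) as [h1 h2]; try lra.
assert (h3 : dot z w = dot z' w + dot z v * dot w v / dl).
{ unfold z'; autorewrite with dot; rewrite (dot_comm v w); field; lra. }
assert (h4 : dot z v * dot w v / dl <= 0).
{ unfold Rdiv; assert (0 < / dl) by (apply Rinv_0_lt_compat; lra).
  assert (dot z v * dot w v <= 0) by nra. nra. }
assert (h5 : e ^ 2 / dl <= dot z v ^ 2 / dl).
{ apply Rmult_le_compat_r; [left; apply Rinv_0_lt_compat; lra|nra]. }
rewrite n1, hw in h2. nra.
Qed.

Definition refl (n v : V) : V := vadd v (vscal (- (2 * dot v n / dot n n)) n).
Definition half (q v : V) : V := vadd (vscal (-1) v) (vscal (- (2 * dot v q)) q).

Lemma half_invol q v : dot q q = -1 -> half q (half q v) = v.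
Proof.
intros h; unfold half; autorewrite with dot; rewrite h; vring.
Qed.

Lemma half_dot q v w : dot q q = -1 -> dot (half q v) (half q w) = dot v w.
Proof.
intros h; unfold half; autorewrite with dot; rewrite h, (dot_comm q w); ring.
Qed.

Lemma half_fix q : dot q q = -1 -> half q q = q.
Proof. intros h; unfold half; rewrite h; vring. Qed.

Lemma half_in_H2 q v : in_H2 q -> in_H2 v -> in_H2 (half q v).
Proof.
intros hq hv; apply (in_H2_of_neg_dot q); [exact hq| |].
- rewrite half_dot; [apply hv|apply hq].
- rewrite <- (half_fix q) at 1 by apply hq.
  rewrite half_dot by apply hq. pose proof (in_H2_dot q v hq hv); lra.
Qed.

Lemma refl_invol n v : dot n n <> 0 -> refl n (refl n v) = v.
Proof. intros h; unfold refl; autorewrite with dot; vfield; exact h. Qed.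

Lemma refl_dot n v w : dot n n <> 0 -> dot (refl n v) (refl n w) = dot v w.
Proof.
intros h; unfold refl; autorewrite with dot; rewrite (dot_comm n w); field; exact h.
Qed.

Lemma refl_in_H2 n v : 0 < dot n n -> in_H2 v -> in_H2 (refl n v).
Proof.
intros hn hv; apply (in_H2_of_neg_dot v); [exact hv| |].
- rewrite refl_dot; [apply hv|lra].
- unfold refl; autorewrite with dot; rewrite (proj1 hv).
  replace (- (2 * dot v n / dot n n) * dot v n) with (- (2 * (dot v n ^ 2 / dot n n))) by (field; lra).
  assert (0 <= dot v n ^ 2 / dot n n).
  { apply Rmult_le_pos; [apply pow2_ge_0|left; apply Rinv_0_lt_compat; lra]. }
  lra.
Qed.

Lemma refl_fix n v : dot v n = 0 -> refl n v = v.
Proof. intros h; unfold refl; rewrite h; apply V_eq; simpl; unfold Rdiv; ring. Qed.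

Lemma half_refl q n v : dot q q = -1 ->
  half q (refl n v) = refl (half q n) (half q v).
Proof.
intros h; unfold refl at 2; rewrite !half_dot by exact h.
unfold refl, half; autorewrite with dot; vring.
Qed.

(** * Three half-turns *)

Definition det (u v w : V) : R :=
  vx u * (vy v * vt w - vt v * vy w) - vy u * (vx v * vt w - vt v * vx w)
  + vt u * (vx v * vy w - vy v * vx w).

(** The form has signature (2,1), so the Gram determinant is [- det u v w ^ 2]. *)
Lemma det_gram u v w :
  dot u u = -1 -> dot v v = -1 -> dot w w = -1 ->
  det u v w ^ 2
  = 1 - 2 * dot u v * dot v w * dot u w - dot u v ^ 2 - dot v w ^ 2 - dot u w ^ 2.
Proof.
intros hu hv hw.
assert (E : det u v w ^ 2 =
  - (dot u u * (dot v v * dot w w - dot v w ^ 2) - dot u v * (dot u v * dot w w - dot v w * dot u w)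
     + dot u w * (dot u v * dot v w - dot v v * dot u w))).
{ unfold det, dot; ring. }
rewrite E, hu, hv, hw; ring.
Qed.

Lemma det_expand u v w z :
  vscal (det u v w) z =
  vadd (vscal (det z v w) u) (vadd (vscal (det u z w) v) (vscal (det u v z) w)).
Proof. apply V_eq; unfold det; simpl; ring. Qed.

Inductive idx : Type := I1 | I2 | I3.
Definition nx (i : idx) : idx := match i with I1 => I2 | I2 => I3 | I3 => I1 end.
Definition pv (i : idx) : idx := match i with I1 => I3 | I2 => I1 | I3 => I2 end.

Lemma idx_dec (i j : idx) : {i = j} + {i <> j}.
Proof. decide equality. Defined.

Lemma idx_cases (i j : idx) : j = i \/ j = nx i \/ j = pv i.
Proof. destruct i, j; simpl; auto. Qed.

Section Config.

Context (q : idx -> V) (hq : forall i, in_H2 (q i)).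

Definition cc (i : idx) : R := - dot (q (nx i)) (q (pv i)).

(* The normal of one of the three geodesics permuted by the half-turns about
   the [q i]: the half-turn about [q i] exchanges the other two. *)
Definition FF (i : idx) : V :=
  vadd (vscal (- cc i) (q i))
    (vadd (vscal (cc (nx i)) (q (nx i))) (vscal (cc (pv i)) (q (pv i)))).

(* [dl = det^2 - 1], see [det_gram]; positivity means that the product of the
   three half-turns is hyperbolic. *)
Definition dl : R :=
  2 * cc I1 * cc I2 * cc I3 - cc I1 ^ 2 - cc I2 ^ 2 - cc I3 ^ 2.

(** [gg k / dl] is the hyperbolic cosine of the distance between the two geodesics other than the
    [k]-th, see [FF_dot_nx]. *)
Definition gg (i : idx) : R := dl + 2 * cc i ^ 2.
Definition HH (i : idx) (v : V) : V := half (q i) v.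

Lemma cc_ge1 i : 1 <= cc i.
Proof. unfold cc; pose proof (in_H2_dot _ _ (hq (nx i)) (hq (pv i))); lra. Qed.

Lemma q_norm i : dot (q i) (q i) = -1.
Proof. apply hq. Qed.

Lemma q_dots :
  dot (q I1) (q I2) = - cc I3 /\ dot (q I2) (q I1) = - cc I3 /\
  dot (q I2) (q I3) = - cc I1 /\ dot (q I3) (q I2) = - cc I1 /\
  dot (q I1) (q I3) = - cc I2 /\ dot (q I3) (q I1) = - cc I2.
Proof.
unfold cc; simpl; repeat split; try ring.
all: rewrite dot_comm; ring.
Qed.

Ltac qdots :=
  rewrite ?q_norm;
  let h := fresh in pose proof q_dots as h;
  repeat match type of h with
         | _ /\ _ => let a := fresh in destruct h as [a h]; rewrite ?a; clear a
         end;
  rewrite ?h; clear h.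

Lemma FF_dot_q i j :
  dot (FF i) (q j) =
  (if idx_dec i j then 1 else -1) * cc j
  - (if idx_dec i j then 1 else 0) * (2 * cc (nx j) * cc (pv j)).
Proof.
destruct i, j; unfold FF; simpl; autorewrite with dot; qdots; ring.
Qed.

Lemma FF_norm i : dot (FF i) (FF i) = dl.
Proof. destruct i; unfold FF; simpl; autorewrite with dot; qdots; unfold dl; ring. Qed.

Lemma FF_dot_nx i : dot (FF i) (FF (nx i)) = - gg (pv i).
Proof. destruct i; unfold FF, gg; simpl; autorewrite with dot; qdots; unfold dl; ring. Qed.

Lemma FF_dot_pv i : dot (FF i) (FF (pv i)) = - gg (nx i).
Proof. destruct i; unfold FF, gg; simpl; autorewrite with dot; qdots; unfold dl; ring. Qed.

Lemma q_FF i : vscal (2 * cc i) (q i) = vadd (FF (nx i)) (FF (pv i)).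
Proof. destruct i; unfold FF; simpl; vring. Qed.

Lemma HH_invol i v : HH i (HH i v) = v.
Proof. apply half_invol, q_norm. Qed.

Lemma HH_dot i v w : dot (HH i v) (HH i w) = dot v w.
Proof. apply half_dot, q_norm. Qed.

Lemma HH_add i v w : HH i (vadd v w) = vadd (HH i v) (HH i w).
Proof. unfold HH, half; vring. Qed.

Lemma HH_scal i k v : HH i (vscal k v) = vscal k (HH i v).
Proof. unfold HH, half; vring. Qed.

Lemma HH_nx i : HH i (FF (nx i)) = FF (pv i).
Proof.
unfold HH, half; rewrite FF_dot_q.
destruct i; simpl; unfold FF; simpl; vring.
Qed.

Lemma HH_pv i : HH i (FF (pv i)) = FF (nx i).
Proof. rewrite <- HH_nx, HH_invol; reflexivity. Qed.

Context (hdl : 0 < dl).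

Lemma gg_gt i : dl < gg i.
Proof. unfold gg; pose proof (cc_ge1 i); nra. Qed.

(** [v + HH i v] is a multiple of [q i], which by [q_FF] lies in the span of the other two normals.
    So [HH i] negates the coordinate [ph i], and the side [ph i = 0] of the cone passes through
    [q i]. *)
Lemma HH_self i :
  HH i (FF i) = vadd (vscal (-1) (FF i))
    (vscal ((gg (nx i) + gg (pv i)) / (gg i - dl)) (vadd (FF (nx i)) (FF (pv i)))).
Proof.
rewrite <- q_FF; unfold HH, half; rewrite FF_dot_q.
pose proof (cc_ge1 i).
assert (E : gg (nx i) + gg (pv i) = 2 * cc i * (2 * cc (nx i) * cc (pv i) - cc i)).
{ destruct i; unfold gg, dl; simpl; ring. }
rewrite E; unfold gg; destruct (idx_dec i i); [|congruence].
vfield; nra.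
Qed.

(** * Coordinates with respect to the three normals *)

Definition dq : R := det (q I1) (q I2) (q I3).

Lemma dq_sqr : dq ^ 2 = dl + 1.
Proof.
unfold dq; rewrite det_gram by apply q_norm; qdots; unfold dl; ring.
Qed.

Lemma dq_neq0 : dq <> 0.
Proof. intros h; pose proof dq_sqr as e; rewrite h in e; lra. Qed.

(** Cramer's rule in the basis [q]; [q_FF] turns these coordinates into those for the basis [FF]. *)
Definition al (i : idx) (v : V) : R :=
  match i with
  | I1 => det v (q I2) (q I3) | I2 => det (q I1) v (q I3) | I3 => det (q I1) (q I2) v
  end / dq.

(* The coordinates in the basis [FF], see [ph_expand]. *)
Definition ph (i : idx) (v : V) : R :=
  (al (nx i) v / cc (nx i) + al (pv i) v / cc (pv i)) / 2.

Lemma al_add i v w : al i (vadd v w) = al i v + al i w.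
Proof. destruct i; unfold al, det; simpl; field; apply dq_neq0. Qed.

Lemma al_scal i k v : al i (vscal k v) = k * al i v.
Proof. destruct i; unfold al, det; simpl; field; apply dq_neq0. Qed.

Lemma ph_add i v w : ph i (vadd v w) = ph i v + ph i w.
Proof.
unfold ph; rewrite !al_add; pose proof (cc_ge1 (nx i)); pose proof (cc_ge1 (pv i)).
field; lra.
Qed.

Lemma ph_scal i k v : ph i (vscal k v) = k * ph i v.
Proof.
unfold ph; rewrite !al_scal; pose proof (cc_ge1 (nx i)); pose proof (cc_ge1 (pv i)).
field; lra.
Qed.

Lemma al_q i j : al i (q j) = if idx_dec i j then 1 else 0.
Proof.
destruct i, j; unfold al; simpl; fold dq;
  first [apply Rmult_eq_reg_r with dq; [|apply dq_neq0]; unfold Rdiv; rewrite Rmult_assoc, Rinv_l by apply dq_neq0;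
  unfold dq, det; ring].
Qed.

Lemma ph_FF i j : ph i (FF j) = if idx_dec i j then 1 else 0.
Proof.
pose proof (cc_ge1 I1); pose proof (cc_ge1 I2); pose proof (cc_ge1 I3).
unfold ph, FF; rewrite !al_add, !al_scal, !al_q.
destruct i, j; simpl; field; lra.
Qed.

Definition comb (a b d : R) : V :=
  vadd (vscal a (FF I1)) (vadd (vscal b (FF I2)) (vscal d (FF I3))).

Lemma ph_expand v : v = comb (ph I1 v) (ph I2 v) (ph I3 v).
Proof.
pose proof (cc_ge1 I1); pose proof (cc_ge1 I2); pose proof (cc_ge1 I3).
pose proof dq_neq0 as hd.
assert (E : v = vadd (vscal (al I1 v) (q I1)) (vadd (vscal (al I2 v) (q I2)) (vscal (al I3 v) (q I3)))).
{ pose proof (det_expand (q I1) (q I2) (q I3) v) as e; fold dq in e.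
  assert (e' : v = vscal (/ dq) (vscal dq v)) by (vfield; exact hd).
  rewrite e' at 1; rewrite e; unfold al; vfield; exact hd. }
rewrite E at 1; unfold comb, FF, ph; simpl; generalize (al I1 v) (al I2 v) (al I3 v); intros.
vfield; lra.
Qed.

Lemma dot_comb z v :
  dot z v = ph I1 z * dot (FF I1) v + ph I2 z * dot (FF I2) v + ph I3 z * dot (FF I3) v.
Proof. rewrite (ph_expand z) at 1; unfold comb; autorewrite with dot; ring. Qed.

Definition xx (i : idx) (v : V) : R := - dot v (FF i).

Lemma xx_ph i v : xx i v = - dl * ph i v + gg (pv i) * ph (nx i) v + gg (nx i) * ph (pv i) v.
Proof.
unfold xx; rewrite dot_comb.
pose proof (FF_dot_nx I1); pose proof (FF_dot_nx I2); pose proof (FF_dot_nx I3).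
pose proof (FF_dot_pv I1); pose proof (FF_dot_pv I2); pose proof (FF_dot_pv I3).
pose proof (FF_norm i); destruct i; simpl in *; nra.
Qed.

(** [ph] and [xx] are dual coordinates: for [z] in the cone, lower bounds on all [xx i v] keep
    [dot z v] away from zero, see [good_gap]. *)
Lemma dot_xx z v : - dot z v = ph I1 z * xx I1 v + ph I2 z * xx I2 v + ph I3 z * xx I3 v.
Proof. rewrite dot_comb; unfold xx; rewrite (dot_comm v), (dot_comm v), (dot_comm v); ring. Qed.

Lemma ph_HH_self i v : ph i (HH i v) = - ph i v.
Proof.
rewrite (ph_expand v) at 1; unfold comb.
rewrite !HH_add, !HH_scal, !ph_add, !ph_scal.
pose proof (HH_nx i) as h1; pose proof (HH_pv i) as h2; pose proof (HH_self i) as h3.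
destruct i; simpl in *; rewrite h1, h2, h3, !ph_add, !ph_scal, !ph_add, !ph_FF; simpl; ring.
Qed.

Lemma xx_HH_nx i v : xx (nx i) (HH i v) = xx (pv i) v.
Proof. unfold xx; rewrite <- (HH_pv i), HH_dot; reflexivity. Qed.

Lemma xx_HH_pv i v : xx (pv i) (HH i v) = xx (nx i) v.
Proof. unfold xx; rewrite <- (HH_nx i), HH_dot; reflexivity. Qed.

Lemma HH_in_H2 i v : in_H2 v -> in_H2 (HH i v).
Proof. apply half_in_H2, hq. Qed.

(* The foot on the [j]-th geodesic of its common perpendicular with the [i]-th
   one, up to scaling. *)
Definition foot (i j k : idx) : V := vadd (vscal dl (FF i)) (vscal (gg k) (FF j)).

Lemma q_dot_FF_neg i j : dot (q i) (FF j) < 0.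
Proof.
rewrite dot_comm, FF_dot_q.
pose proof (cc_ge1 i); pose proof (cc_ge1 (nx i)); pose proof (cc_ge1 (pv i)).
destruct (idx_dec j i); [|lra].
assert (E : 2 * cc i * cc (nx i) * cc (pv i) = dl + cc i ^ 2 + cc (nx i) ^ 2 + cc (pv i) ^ 2).
{ destruct i; unfold dl; simpl; ring. }
subst; nra.
Qed.

Definition third (i j k : idx) : Prop := (j = nx i /\ k = pv i) \/ (j = pv i /\ k = nx i).

Lemma foot_norm i j k : third i j k ->
  dot (foot i j k) (foot i j k) = - dl * (gg k ^ 2 - dl ^ 2).
Proof.
unfold foot; autorewrite with dot; rewrite !FF_norm.
intros [[-> ->]|[-> ->]].
- rewrite (dot_comm (FF (nx i))), FF_dot_nx; ring.
- rewrite (dot_comm (FF (pv i))), FF_dot_pv; ring.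
Qed.

Lemma foot_future i j k : third i j k -> dot (foot i j k) (foot i j k) < 0 /\ 0 < vt (foot i j k).
Proof.
intros h; pose proof (foot_norm i j k h) as e; pose proof (gg_gt k) as hg.
assert (hn : dot (foot i j k) (foot i j k) < 0).
{ rewrite e; assert (0 < dl * (gg k ^ 2 - dl ^ 2)) by (apply Rmult_lt_0_compat; nra); lra. }
split; [exact hn|].
destruct (hq i) as [h1 h2].
apply (future_of_dot (q i)); try lra.
unfold foot; autorewrite with dot.
pose proof (q_dot_FF_neg i i); pose proof (q_dot_FF_neg i j); nra.
Qed.

(** [- ss i ^ 2] is the Gram determinant of the two normals spanning the plane [ph i = 0]; up to a
    factor common to all [i], [ss i] is therefore the length of the linear form [ph i]. *)
Definition ss (i : idx) : R := sqrt (gg i ^ 2 - dl ^ 2).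

Lemma ss_pos i : 0 < ss i.
Proof. pose proof (gg_gt i); apply sqrt_lt_R0; nra. Qed.

Lemma ss_sqr i : ss i ^ 2 = gg i ^ 2 - dl ^ 2.
Proof. pose proof (gg_gt i); unfold ss; apply pow2_sqrt; nra. Qed.

Lemma ss_le i : ss i <= gg i.
Proof.
pose proof (ss_sqr i); pose proof (gg_gt i).
apply Rsqr_incr_0_var; unfold Rsqr; nra.
Qed.

(** The coordinate [ph j] is absent because [foot i j k] is orthogonal to [FF j]. *)
Lemma dot_foot i j k z : third i j k ->
  - dot z (foot i j k) = ph i z * ss k ^ 2 + ph k z * (dl * gg j + gg i * gg k).
Proof.
intros h; rewrite ss_sqr; unfold foot; rewrite dot_addr, !dot_scalr.
pose proof (xx_ph i z) as e1; pose proof (xx_ph j z) as e2; unfold xx in e1, e2.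
replace (dot z (FF i)) with (- (- dl * ph i z + gg (pv i) * ph (nx i) z + gg (nx i) * ph (pv i) z)) by lra.
replace (dot z (FF j)) with (- (- dl * ph j z + gg (pv j) * ph (nx j) z + gg (nx j) * ph (pv j) z)) by lra.
destruct h as [[-> ->]|[-> ->]]; destruct i; simpl; ring.
Qed.

Lemma foot_bound i j k z : third i j k -> in_H2 z ->
  sqrt dl * ss k <= ph i z * ss k ^ 2 + ph k z * (dl * gg j + gg i * gg k).
Proof.
intros h [hz tz]; rewrite <- (dot_foot i j k z h).
destruct (foot_future i j k h) as [h1 h2].
destruct (reverse_cauchy_schwarz (foot i j k) z) as [h3 h4]; try lra.
rewrite foot_norm, hz, dot_comm, <- ss_sqr in h4 by exact h; rewrite dot_comm in h3.
pose proof (ss_pos k). pose proof (sqrt_pos dl). pose proof (sqrt_sqrt dl (Rlt_le _ _ hdl)) as hs.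
apply Rsqr_incr_0_var; [|lra]; unfold Rsqr.
replace (sqrt dl * ss k * (sqrt dl * ss k)) with (sqrt dl * sqrt dl * ss k ^ 2) by ring.
rewrite hs; nra.
Qed.

Lemma third_exists i k : i <> k -> exists j, third i j k.
Proof.
intros h; destruct (idx_cases i k) as [-> | [-> | ->]]; [congruence| |].
- exists (pv i); right; auto.
- exists (nx i); left; auto.
Qed.

(** Ping-pong table for the half-turns: the half-planes beyond the three sides are disjoint because
    [foot_bound] keeps a positive combination of [ph i] and [ph k] positive. *)
Lemma ph_nonneg_other i k z : i <> k -> in_H2 z -> ph i z <= 0 -> 0 < ph k z.
Proof.
intros hik hz hi; destruct (third_exists i k hik) as [j h].
pose proof (foot_bound i j k z h hz) as hb.
pose proof (ss_pos k); pose proof (sqrt_lt_R0 dl hdl).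
assert (0 < sqrt dl * ss k) by nra.
pose proof (gg_gt i); pose proof (gg_gt j); pose proof (gg_gt k).
assert (0 < dl * gg j + gg i * gg k) by nra.
assert (0 <= ss k ^ 2) by nra.
destruct (Rlt_or_le 0 (ph k z)); [assumption|nra].
Qed.

(** A lower bound for [sqrt dl / (ss i * ss k)] uniform in [i] and [k]; it is the gain of one step
    of the descent in [cover]. *)
Definition eta : R := sqrt dl / (ss I1 + ss I2 + ss I3) ^ 2.

Lemma eta_pos : 0 < eta.
Proof.
pose proof (ss_pos I1); pose proof (ss_pos I2); pose proof (ss_pos I3).
apply Rdiv_lt_0_compat; [apply sqrt_lt_R0, hdl|nra].
Qed.

(* [ph i z / ss i] is, up to a common factor, minus the hyperbolic sine of the
   distance from [z] to a side of the fundamental domain [0 <= ph]. *)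
Lemma descent i k z : i <> k -> in_H2 z -> ph k z < 0 ->
  - ph k z / ss k <= ph i z / ss i - eta.
Proof.
intros hik hz hk; destruct (third_exists i k hik) as [j h].
pose proof (foot_bound i j k z h hz) as hb.
pose proof (ss_pos i) as si; pose proof (ss_pos j) as sj; pose proof (ss_pos k) as sk.
pose proof (sqrt_lt_R0 dl hdl) as sd.
pose proof (gg_gt i); pose proof (gg_gt j); pose proof (gg_gt k).
(* As [ph k z < 0], its coefficient in [foot_bound] may be lowered to [ss i * ss k]; division by
   [ss i * ss k ^ 2] then gives the claim. *)
assert (hss : ss i * ss k <= dl * gg j + gg i * gg k).
{ apply Rle_trans with (gg i * gg k); [|assert (0 < dl * gg j) by (apply Rmult_lt_0_compat; lra); lra].
  apply Rmult_le_compat; try lra; apply ss_le. }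
assert (heta : eta <= sqrt dl / (ss i * ss k)).
{ unfold eta; apply Rmult_le_compat_l; [lra|].
  apply Rinv_le_contravar; [nra|].
  pose proof (ss_pos I1); pose proof (ss_pos I2); pose proof (ss_pos I3).
  apply Rle_trans with ((ss I1 + ss I2 + ss I3) * (ss I1 + ss I2 + ss I3)); [|right; ring].
  apply Rmult_le_compat; try lra; [destruct i|destruct k]; lra. }
assert (hb' : sqrt dl * ss k - ph k z * (ss i * ss k) <= ph i z * ss k ^ 2) by nra.
assert (hp : 0 < ss i * ss k ^ 2) by (apply Rmult_lt_0_compat; [|apply pow_lt]; lra).
apply Rmult_le_reg_r with (ss i * ss k ^ 2); [exact hp|].
apply Rle_trans with ((ph i z / ss i - sqrt dl / (ss i * ss k)) * (ss i * ss k ^ 2)).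
- apply Rle_trans with (ph i z * ss k ^ 2 - sqrt dl * ss k); [|right; field; lra].
  replace (- ph k z / ss k * (ss i * ss k ^ 2)) with (- ph k z * (ss i * ss k)) by (field; lra).
  lra.
- apply Rmult_le_compat_r; lra.
Qed.

(** * Words in the half-turns and descent into the cone *)

Definition hw (w : list idx) (v : V) : V := fold_right HH v w.

Lemma hw_app w w' v : hw (w ++ w') v = hw w (hw w' v).
Proof. unfold hw; apply fold_right_app. Qed.

Lemma hw_dot w v v' : dot (hw w v) (hw w v') = dot v v'.
Proof. induction w; simpl; [|rewrite HH_dot]; auto. Qed.

Lemma hw_in_H2 w v : in_H2 v -> in_H2 (hw w v).
Proof. intros h; induction w; simpl; [|apply HH_in_H2]; auto. Qed.

Lemma hw_rev w v : hw (rev w) (hw w v) = v.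
Proof.
induction w as [|i w IH]; simpl; [reflexivity|].
rewrite hw_app; simpl; rewrite HH_invol; exact IH.
Qed.

Lemma hw_rev' w v : hw w (hw (rev w) v) = v.
Proof. rewrite <- (rev_involutive w) at 1; apply hw_rev. Qed.

(** The half-turn [HH i] makes a negative [ph i] positive, and by [descent] any coordinate that is
    negative afterwards has an excess [- ph k / ss k] smaller by [eta] than the one removed.
    Finitely many steps thus suffice. *)
Lemma cover z : in_H2 z -> exists w, forall i, 0 <= ph i (hw w z).
Proof.
intros hz.
assert (main : forall n z, in_H2 z -> (forall i, - ph i z / ss i <= INR n * eta) ->
  exists w, forall i, 0 <= ph i (hw w z)).
{ clear z hz; induction n as [|n IH]; intros z hz hn.
  - exists []; intros i; simpl; specialize (hn i); simpl in hn; pose proof (ss_pos i).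
    assert (E : ph i z = - (- ph i z / ss i) * ss i) by (field; lra). rewrite E; nra.
  - destruct (classic (forall i, 0 <= ph i z)) as [h|h]; [exists []; exact h|].
    apply not_all_ex_not in h as [i hi]; apply Rnot_le_lt in hi.
    destruct (IH (HH i z)) as [w hw'].
    + apply HH_in_H2, hz.
    + intros k; pose proof (ss_pos k) as sk; pose proof eta_pos as he; pose proof (pos_INR n) as pn.
      assert (h0 : 0 <= INR n * eta) by nra.
      destruct (Rle_or_lt 0 (ph k (HH i z))) as [hk|hk].
      * apply Rle_trans with 0; [|exact h0].
        assert (0 < / ss k) by (apply Rinv_0_lt_compat; lra).
        unfold Rdiv; nra.
      * destruct (idx_dec i k) as [e|e].
        { subst k; rewrite ph_HH_self in hk; lra. }
        pose proof (descent i k _ e (HH_in_H2 i z hz) hk) as hd.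
        rewrite ph_HH_self in hd; pose proof (hn i) as hni.
        rewrite S_INR in hni; lra.
    + exists (w ++ [i]); intros k; rewrite hw_app; apply hw'. }
pose proof eta_pos as he.
assert (hb : exists n, forall i, - ph i z / ss i <= INR n * eta).
{ destruct (INR_unbounded (Rabs (ph I1 z / ss I1 / eta) + Rabs (ph I2 z / ss I2 / eta) + Rabs (ph I3 z / ss I3 / eta))) as [n hn].
  exists n; intros i; pose proof (ss_pos i).
  pose proof (Rabs_pos (ph I1 z / ss I1 / eta)); pose proof (Rabs_pos (ph I2 z / ss I2 / eta)); pose proof (Rabs_pos (ph I3 z / ss I3 / eta)).
  replace (- ph i z / ss i) with (- (ph i z / ss i / eta) * eta) by (field; lra).
  apply Rmult_le_compat_r; [lra|].
  pose proof (Rle_abs (- (ph i z / ss i / eta))) as ha; rewrite Rabs_Ropp in ha.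
  destruct i; lra. }
destruct hb as [n hn]; exact (main n z hz hn).
Qed.

(** * Reduced words in involutions *)

Section Involutions.

Context {T : Type} (s : T -> V -> V).

Definition aw (l : list T) (v : V) : V := fold_right s v l.

Fixpoint alt (l : list T) : Prop :=
  match l with
  | x :: ((y :: _) as t) => x <> y /\ alt t
  | _ => True
  end.

Lemma alt_tail x l : alt (x :: l) -> alt l.
Proof. destruct l; simpl; tauto. Qed.

(** Serves half-turns and wall reflections alike. The hypothesis concerns only the letters of [l]
    because [refl] is involutive only for suitable normals. Equal neighbours cancel in pairs, so
    parity survives. *)
Lemma aw_reduce (l : list T) :
  (forall t v, In t l -> s t (s t v) = v) ->
  exists l', alt l' /\ incl l' l /\ Nat.even (length l') = Nat.even (length l) /\
    forall v, aw l' v = aw l v.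
Proof.
induction l as [|x l IH]; intros hs.
- exists []; simpl; repeat split; auto; apply incl_refl.
- destruct IH as (l' & h1 & h2 & h3 & h4); [intros t v ht; apply hs; right; exact ht|].
  assert (cons_case : alt (x :: l') -> exists l', alt l' /\ incl l' (x :: l) /\
    Nat.even (length l') = Nat.even (length (x :: l)) /\ forall v, aw l' v = aw (x :: l) v).
  { intros h; exists (x :: l'); repeat split; auto.
    - intros t [ht|ht]; [left; exact ht|right; apply h2, ht].
    - simpl length; rewrite !Nat.even_succ, <- !Nat.negb_even, h3; reflexivity.
    - intros v; simpl; rewrite h4; reflexivity. }
  destruct l' as [|y l']; [apply cons_case; exact I|].
  destruct (classic (x = y)) as [e|e].
  + subst y; exists l'; repeat split.
    * apply alt_tail in h1; exact h1.
    * intros t ht; right; apply h2; right; exact ht.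
    * simpl length in *; rewrite Nat.even_succ, <- Nat.negb_even, <- h3, Nat.even_succ,
        <- Nat.negb_even, negb_involutive; reflexivity.
    * intros v; simpl; rewrite <- h4; simpl; rewrite hs; [reflexivity|left; reflexivity].
  + apply cons_case; split; assumption.
Qed.

End Involutions.

(** * The orbit of the normals *)

Definition NN (v : V) : Prop := exists w i, v = hw w (FF i).

(** Ping-pong invariant for images of normals under words with first letter [i]: [v] lies beyond the
    side [ph i = 0], and its geodesic does not cross any of the three initial ones, which
    [dl <= xx j v] expresses for vectors of norm [dl]. *)
Definition good (i : idx) (v : V) : Prop :=
  dot v v = dl /\ (forall j, dl <= xx j v) /\ ph i v < 0.

(** [HH i] exchanges the conditions for the other two normals but does not transport the one for
    [FF i]; here that one is derived from the rest. *)
Lemma good_intro i v : dot v v = dl -> dl <= xx (nx i) v -> dl <= xx (pv i) v ->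
  ph i v < 0 -> good i v.
Proof.
intros hv h1 h2 hi; repeat split; try assumption.
assert (hii : dl <= xx i v).
{ pose proof (gg_gt I1) as g1; pose proof (gg_gt I2) as g2; pose proof (gg_gt I3) as g3.
  assert (hn : 0 < ph (nx i) v).
  { assert (h3 : - dot v (foot (nx i) (pv i) i) = ph (nx i) v * ss i ^ 2 + ph i v * (dl * gg (pv i) + gg (nx i) * gg i)).
    { apply dot_foot; destruct i; [left|left|left]; auto. }
    unfold foot in h3; autorewrite with dot in h3. unfold xx in h1, h2.
    pose proof (ss_pos i). assert (0 < ss i ^ 2) by nra.
    assert (0 < dl * gg (pv i) + gg (nx i) * gg i) by (destruct i; simpl; nra).
    assert (0 < gg i) by (destruct i; lra).
    assert (0 < - (dl * dot v (FF (nx i)) + gg i * dot v (FF (pv i)))) by nra.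
    nra. }
  assert (hp : 0 < ph (pv i) v).
  { assert (h3 : - dot v (foot (pv i) (nx i) i) = ph (pv i) v * ss i ^ 2 + ph i v * (dl * gg (nx i) + gg (pv i) * gg i)).
    { apply dot_foot; destruct i; [right|right|right]; auto. }
    unfold foot in h3; autorewrite with dot in h3. unfold xx in h1, h2.
    pose proof (ss_pos i). assert (0 < ss i ^ 2) by nra.
    assert (0 < dl * gg (nx i) + gg (pv i) * gg i) by (destruct i; simpl; nra).
    assert (0 < gg i) by (destruct i; lra).
    assert (0 < - (dl * dot v (FF (pv i)) + gg i * dot v (FF (nx i)))) by nra.
    nra. }
  (* For [ph i v <= -1] the formula [xx_ph] gives the bound; otherwise [dot v v = dl] and the
     duality [dot_xx] do, since then [- ph i v < 1]. *)
  destruct (Rle_or_lt (ph i v) (-1)) as [hle|hgt].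
  - rewrite xx_ph.
    assert (0 < gg (pv i) * ph (nx i) v) by (apply Rmult_lt_0_compat; [destruct i; simpl; lra|exact hn]).
    assert (0 < gg (nx i) * ph (pv i) v) by (apply Rmult_lt_0_compat; [destruct i; simpl; lra|exact hp]).
    nra.
  - assert (e : - dot v v = ph i v * xx i v + ph (nx i) v * xx (nx i) v + ph (pv i) v * xx (pv i) v).
    { rewrite dot_xx; destruct i; simpl; ring. }
    rewrite hv in e.
    assert (0 < ph (nx i) v * xx (nx i) v) by (apply Rmult_lt_0_compat; lra).
    assert (0 < ph (pv i) v * xx (pv i) v) by (apply Rmult_lt_0_compat; lra).
    nra. }
intros j; destruct (idx_cases i j) as [-> | [-> | ->]]; assumption.
Qed.

Lemma HH_FF_good i k : (HH i (FF k) = FF (nx i) \/ HH i (FF k) = FF (pv i)) \/ good i (HH i (FF k)).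
Proof.
destruct (idx_cases i k) as [-> | [-> | ->]].
- right; pose proof (gg_gt I1); pose proof (gg_gt I2); pose proof (gg_gt I3).
  apply good_intro.
  + rewrite HH_dot; apply FF_norm.
  + rewrite xx_HH_nx; unfold xx; rewrite FF_dot_pv; destruct i; simpl; lra.
  + rewrite xx_HH_pv; unfold xx; rewrite FF_dot_nx; destruct i; simpl; lra.
  + rewrite ph_HH_self, ph_FF; destruct (idx_dec i i); [lra|congruence].
- left; right; apply HH_nx.
- left; left; apply HH_pv.
Qed.

(** The disjointness argument of [ph_nonneg_other], for spacelike [v]: the bounds on [xx] replace
    the reverse Cauchy-Schwarz inequality. *)
Lemma good_step i j v : i <> j -> good i v -> good j (HH j v).
Proof.
intros hij (hv & hx & hi).
assert (hj : 0 < ph j v).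
{ destruct (third_exists i j hij) as [k h].
  assert (h3 := dot_foot i k j v h).
  unfold foot in h3; autorewrite with dot in h3.
  pose proof (hx i) as xi; pose proof (hx k) as xk; unfold xx in xi, xk.
  pose proof (gg_gt i); pose proof (gg_gt j); pose proof (gg_gt k).
  pose proof (ss_pos j). assert (0 < ss j ^ 2) by nra.
  assert (0 < dl * gg k + gg i * gg j) by nra.
  assert (0 < - (dl * dot v (FF i) + gg j * dot v (FF k))) by nra.
  nra. }
apply good_intro.
- rewrite HH_dot; exact hv.
- rewrite xx_HH_nx; apply hx.
- rewrite xx_HH_pv; apply hx.
- rewrite ph_HH_self; lra.
Qed.

Lemma word_good w : alt w -> forall s w', w = s :: w' -> forall k,
  (hw w (FF k) = FF (nx s) \/ hw w (FF k) = FF (pv s)) \/ good s (hw w (FF k)).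
Proof.
induction w as [|t w IH]; intros ha s w' e k; inversion e; subst; clear e.
destruct w' as [|t w'].
- apply HH_FF_good.
- destruct ha as [hne ha].
  destruct (IH ha t w' eq_refl k) as [[h|h]|h]; simpl in *.
  + rewrite h; apply HH_FF_good.
  + rewrite h; apply HH_FF_good.
  + right; apply (good_step t); [congruence|exact h].
Qed.

Lemma hw_reduce w : exists w', alt w' /\ Nat.even (length w') = Nat.even (length w) /\
  forall v, hw w' v = hw w v.
Proof.
destruct (aw_reduce HH w) as (w' & h1 & _ & h3 & h4); [intros; apply HH_invol|].
exists w'; auto.
Qed.

Lemma NN_cases v : NN v -> (exists k, v = FF k) \/ exists s, good s v.
Proof.
intros (w & i & ->); destruct (hw_reduce w) as (w' & h1 & _ & h2); rewrite <- h2.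
destruct w' as [|s w']; [left; exists i; reflexivity|].
destruct (word_good _ h1 s w' eq_refl i) as [[h|h]|h]; eauto.
Qed.

Lemma NN_hw w v : NN v -> NN (hw w v).
Proof. intros (w' & i & ->); exists (w ++ w'), i; rewrite hw_app; reflexivity. Qed.

Lemma NN_FF i : NN (FF i).
Proof. exists [], i; reflexivity. Qed.

Lemma NN_norm v : NN v -> dot v v = dl.
Proof. intros (w & i & ->); rewrite hw_dot; apply FF_norm. Qed.

Lemma NN_dot_FF v i : NN v -> v = FF i \/ dot v (FF i) <= - dl.
Proof.
pose proof (gg_gt I1); pose proof (gg_gt I2); pose proof (gg_gt I3).
intros hv; destruct (NN_cases v hv) as [[k ->]|[s (_ & h & _)]].
- destruct (idx_cases i k) as [-> | [-> | ->]]; [left; reflexivity| |]; right; rewrite dot_comm.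
  + rewrite FF_dot_nx; destruct i; simpl; lra.
  + rewrite FF_dot_pv; destruct i; simpl; lra.
- right; pose proof (h i) as hi; unfold xx in hi; lra.
Qed.

(** By invariance one of the normals may be taken among the three [FF i], where the ping-pong
    invariant applies. *)
Lemma NN_dot v v' : NN v -> NN v' -> v = v' \/ dot v v' <= - dl.
Proof.
intros hv (w & i & ->).
destruct (NN_dot_FF (hw (rev w) v) i (NN_hw _ _ hv)) as [h|h].
- left; rewrite <- h, hw_rev'; reflexivity.
- right; rewrite <- (hw_dot w), hw_rev' in h; exact h.
Qed.

Lemma NN_q_neg v i : NN v -> dot (q i) v < 0.
Proof.
intros hv; destruct (NN_cases v hv) as [[k ->]|[s (_ & h & _)]]; [apply q_dot_FF_neg|].
assert (e : 2 * cc i * dot (q i) v = - xx (nx i) v - xx (pv i) v).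
{ rewrite <- dot_scall, q_FF; unfold xx; rewrite dot_addl, !(dot_comm v); ring. }
pose proof (h (nx i)); pose proof (h (pv i)); pose proof (cc_ge1 i); nra.
Qed.

(** Ping-pong table for the wall reflections: by [NN_dot] the sum [v + v'] is not spacelike, and it
    is future pointing, so [dot z (v + v') < 0]. *)
Lemma NN_disjoint v v' z : NN v -> NN v' -> v <> v' -> in_H2 z -> 0 <= dot z v -> dot z v' < 0.
Proof.
intros hv hv' hne hz h.
destruct (NN_dot v v' hv hv') as [e|hd]; [congruence|].
pose proof (NN_q_neg v I1 hv); pose proof (NN_q_neg v' I1 hv').
assert (hn : dot (vadd v v') (vadd v v') <= 0).
{ autorewrite with dot; rewrite (dot_comm v' v), !NN_norm by assumption; lra. }
destruct (hq I1) as [h1 h2]; destruct hz as [h3 h4].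
assert (hf : 0 < vt (vadd v v')).
{ apply (future_of_dot (q I1)); try lra; rewrite dot_addr; lra. }
destruct (reverse_cauchy_schwarz z (vadd v v')) as [h5 _]; try lra.
rewrite dot_addr in h5; lra.
Qed.

(** * The region and the wall reflections *)

Definition inK (z : V) : Prop := in_H2 z /\ forall v, NN v -> dot z v <= 0.
Definition on_wall (z : V) : Prop := exists v, NN v /\ dot z v = 0.

Lemma inK_hw w z : inK z -> inK (hw w z).
Proof.
intros [h1 h2]; split; [apply hw_in_H2, h1|].
intros v hv; rewrite <- (hw_rev' w v), hw_dot; apply h2, NN_hw, hv.
Qed.

Lemma inK_q i : inK (q i) /\ ~ on_wall (q i).
Proof.
split; [split; [apply hq|intros v hv; left; apply NN_q_neg, hv]|].
intros (v & hv & h); pose proof (NN_q_neg v i hv); lra.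
Qed.

Definition rw (l : list V) (z : V) : V := fold_right refl z l.

Lemma rw_app l l' z : rw (l ++ l') z = rw l (rw l' z).
Proof. apply fold_right_app. Qed.

Lemma NN_refl_invol v z : NN v -> refl v (refl v z) = z.
Proof. intros h; apply refl_invol; rewrite NN_norm by exact h; lra. Qed.

Lemma rw_in_H2 l z : Forall NN l -> in_H2 z -> in_H2 (rw l z).
Proof.
intros hl hz; induction hl; simpl; [exact hz|].
apply refl_in_H2; [rewrite NN_norm by assumption; exact hdl|assumption].
Qed.

Lemma rw_rev l z : Forall NN l -> rw (rev l) (rw l z) = z.
Proof.
intros hl; revert z; induction hl; intros z; simpl; [reflexivity|].
rewrite rw_app; simpl; rewrite NN_refl_invol by assumption; auto.
Qed.

Lemma hw_refl w n z : hw w (refl n z) = refl (hw w n) (hw w z).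
Proof.
induction w as [|i w IH]; simpl; [reflexivity|].
rewrite IH; apply half_refl, q_norm.
Qed.

Lemma hw_rw w l z : hw w (rw l z) = rw (map (hw w) l) (hw w z).
Proof.
induction l; simpl; [reflexivity|]; rewrite hw_refl, IHl; reflexivity.
Qed.

Lemma rw_reduce l : Forall NN l -> exists l', alt l' /\ Forall NN l' /\
  Nat.even (length l') = Nat.even (length l) /\ forall z, rw l' z = rw l z.
Proof.
intros hl; rewrite Forall_forall in hl.
destruct (aw_reduce refl l) as (l' & h1 & h2 & h3 & h4).
- intros t v ht; apply NN_refl_invol, hl, ht.
- exists l'; repeat split; auto; apply Forall_forall; auto.
Qed.

Lemma dot_refl_self n z : dot n n <> 0 -> dot (refl n z) n = - dot z n.
Proof. intros h; unfold refl; autorewrite with dot; field; exact h. Qed.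

(** Images of the region lie in the half-plane of the first letter, by [NN_disjoint]. The equality
    clause controls points on the walls, which a single reflection can return to the region. *)
Lemma rw_pingpong l z : alt l -> Forall NN l -> inK z -> forall v l', l = v :: l' ->
  0 <= dot (rw l z) v /\ (dot (rw l z) v = 0 -> l' = [] /\ dot z v = 0).
Proof.
intros ha hl hz; induction l as [|u l IH]; intros v l' e; inversion e; subst; clear e.
inversion hl; subst.
assert (hv0 : dot v v <> 0) by (rewrite NN_norm by assumption; lra).
simpl; rewrite dot_refl_self by exact hv0.
destruct l' as [|u l'].
- simpl; destruct hz as [_ hz]; pose proof (hz v H1); split; [lra|intros; split; [reflexivity|lra]].
- destruct ha as [hne ha].
  destruct (IH ha H2 u l' eq_refl) as [h1 _].
  inversion H2; subst.
  assert (hd : dot (rw (u :: l') z) v < 0).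
  { apply (NN_disjoint u); auto; apply rw_in_H2; [assumption|apply hz]. }
  split; lra.
Qed.

Lemma rw_inK l z : alt l -> Forall NN l -> inK z -> inK (rw l z) ->
  l = [] \/ exists v, l = [v] /\ NN v /\ dot z v = 0.
Proof.
intros ha hl hz hlz; destruct l as [|v l]; [left; reflexivity|right].
destruct (rw_pingpong _ z ha hl hz v l eq_refl) as [h1 h2].
inversion hl; subst.
destruct hlz as [_ hlz]; pose proof (hlz v H1).
destruct h2 as [-> h2]; [lra|]; exists v; auto.
Qed.

Lemma hw_pingpong w z : alt w -> in_H2 z -> (forall i, 0 <= ph i z) -> forall i w', w = i :: w' ->
  ph i (hw w z) <= 0 /\ (ph i (hw w z) = 0 -> w' = [] /\ ph i z = 0).
Proof.
intros ha hz hp; induction w as [|j w IH]; intros i w' e; inversion e; subst; clear e.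
simpl; rewrite ph_HH_self.
destruct w' as [|u w'].
- simpl; pose proof (hp i); split; [lra|intros; split; [reflexivity|lra]].
- destruct ha as [hne ha]; destruct (IH ha u w' eq_refl) as [h1 _].
  assert (hd : 0 < ph i (hw (u :: w') z)).
  { apply (ph_nonneg_other u); auto; apply hw_in_H2, hz. }
  simpl in hd |- *; split; lra.
Qed.

(** * Fixed points of words in the half-turns *)

Lemma ph_q i j : ph i (q j) = if idx_dec i j then 0 else / (2 * cc j).
Proof.
pose proof (cc_ge1 j).
assert (e : q j = vscal (/ (2 * cc j)) (vadd (FF (nx j)) (FF (pv j)))).
{ rewrite <- q_FF; vfield; lra. }
rewrite e, ph_scal, ph_add, !ph_FF; destruct i, j; simpl; field; lra.
Qed.

Lemma ph_q_nonneg i j : 0 <= ph i (q j).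
Proof.
rewrite ph_q; pose proof (cc_ge1 j).
destruct (idx_dec i j); [lra|left; apply Rinv_0_lt_compat; lra].
Qed.

Lemma HH_fixed i z : in_H2 z -> HH i z = z -> z = q i.
Proof.
intros hz e2; unfold HH, half in e2.
apply eq_sym, in_H2_dot_eq; [apply hq|exact hz|].
set (t := dot z (q i)) in *.
assert (e : vscal 2 z = vscal (- (2 * t)) (q i)).
{ rewrite <- e2 at 1; destruct z as [a b d]; destruct (q i) as [a' b' d'];
  unfold vadd, vscal in *; simpl in *; injection e2; intros; f_equal; lra. }
assert (e3 : dot (vscal 2 z) z = dot (vscal (- (2 * t)) (q i)) z) by (rewrite e; reflexivity).
rewrite !dot_scall, (dot_comm (q i)) in e3; fold t in e3; rewrite (proj1 hz) in e3.
rewrite dot_comm; fold t; pose proof (in_H2_dot z (q i) hz (hq i)) as h; fold t in h; nra.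
Qed.

Lemma even_app {T : Type} (l l' : list T) :
  Nat.even (length (l ++ l')) = Bool.eqb (Nat.even (length l)) (Nat.even (length l')).
Proof.
rewrite length_app, Nat.even_add; reflexivity.
Qed.

Lemma even_rev {T : Type} (l : list T) : Nat.even (length (rev l)) = Nat.even (length l).
Proof. rewrite length_rev; reflexivity. Qed.

(** Ping-pong leaves reduced words of length at most one, and parity excludes length one: the three
    vertices are inequivalent under the group of even words. *)
Lemma even_word_q w i j : Nat.even (length w) = true -> hw w (q i) = q j -> i = j.
Proof.
intros he h; destruct (hw_reduce w) as (w' & h1 & h2 & h3).
rewrite <- h3 in h; rewrite he in h2; clear h3 w he.
destruct w' as [|s w'].
- simpl in h; destruct (idx_dec j i) as [e|e]; [auto|exfalso].
  pose proof (ph_q j j) as a; pose proof (ph_q j i) as b; rewrite h in b.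
  destruct (idx_dec j j); [|congruence]; destruct (idx_dec j i); [congruence|].
  pose proof (cc_ge1 i); assert (0 < / (2 * cc i)) by (apply Rinv_0_lt_compat; lra); lra.
- destruct (hw_pingpong _ (q i) h1 (hq i) (fun k => ph_q_nonneg k i) s w' eq_refl) as [a b].
  rewrite h in a, b; pose proof (ph_q_nonneg s j).
  destruct b as [-> _]; [lra|discriminate h2].
Qed.

(** Conjugation by a word moving [z] into the cone keeps the word odd; ping-pong then reduces it to
    a single letter, whose only fixed point is a vertex. *)
Lemma odd_word_fixed w z : in_H2 z -> Nat.even (length w) = false -> hw w z = z ->
  exists w' i, Nat.even (length w') = true /\ z = hw w' (q i).
Proof.
intros hz ho h; destruct (cover z hz) as [u hu].
set (z1 := hw u z) in *.
assert (h1 : hw (u ++ w ++ rev u) z1 = z1).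
{ unfold z1; rewrite !hw_app, hw_rev, h; reflexivity. }
destruct (hw_reduce (u ++ w ++ rev u)) as (w' & a1 & a2 & a3).
rewrite <- a3 in h1; rewrite !even_app, even_rev, ho in a2.
assert (hz1 : in_H2 z1) by (apply hw_in_H2, hz).
destruct w' as [|s w']; [destruct (Nat.even (length u)); discriminate a2|].
destruct (hw_pingpong _ z1 a1 hz1 hu s w' eq_refl) as [b1 b2].
rewrite h1 in b1, b2; pose proof (hu s).
destruct b2 as [-> _]; [lra|].
simpl in h1; apply HH_fixed in h1; [|exact hz1].
assert (e : z = hw (rev u) (q s)) by (rewrite <- h1; unfold z1; rewrite hw_rev; reflexivity).
destruct (Nat.even (length (rev u))) eqn:E; [exists (rev u), s; auto|].
(* A final letter [s] fixes [q s], so it corrects the parity at no cost. *)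
exists (rev u ++ [s]), s; split; [rewrite even_app, E; reflexivity|].
rewrite hw_app; simpl; unfold HH; rewrite half_fix by apply q_norm; exact e.
Qed.

Lemma hw_add w v v' : hw w (vadd v v') = vadd (hw w v) (hw w v').
Proof. induction w; simpl; [|rewrite IHw, HH_add]; reflexivity. Qed.

Lemma hw_scal w k v : hw w (vscal k v) = vscal k (hw w v).
Proof. induction w; simpl; [|rewrite IHw, HH_scal]; reflexivity. Qed.

Lemma ph_sum_pos z : in_H2 z -> (forall i, 0 <= ph i z) -> 0 < ph I1 z + ph I2 z + ph I3 z.
Proof.
intros hz h; pose proof (h I1); pose proof (h I2); pose proof (h I3).
destruct (Req_dec (ph I1 z) 0) as [e|e]; [|lra].
assert (0 < ph I2 z) by (apply (ph_nonneg_other I1); [discriminate|exact hz|lra]); lra.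
Qed.

Lemma good_gap z v s : (forall i, 0 <= ph i z) -> good s v ->
  dot z v <= - (dl * (ph I1 z + ph I2 z + ph I3 z)).
Proof.
intros hz (_ & h & _); pose proof (dot_xx z v) as e.
pose proof (h I1); pose proof (h I2); pose proof (h I3).
pose proof (hz I1); pose proof (hz I2); pose proof (hz I3); nra.
Qed.

(** There are infinitely many walls, but after moving [z] into the cone only three of them can be
    close: [good_gap] bounds the products with all the others at once. *)
Lemma wall_gap z : inK z -> ~ on_wall z -> exists e, 0 < e /\ forall v, NN v -> dot z v <= - e.
Proof.
intros hz hw0; destruct (cover z (proj1 hz)) as [u hu].
assert (hz1 : inK (hw u z)) by (apply inK_hw, hz).
assert (hx : forall i, 0 < xx i (hw u z)).
{ intros i; unfold xx; destruct hz1 as [_ hz1]; pose proof (hz1 (FF i) (NN_FF i)) as h.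
  destruct (Rle_lt_or_eq_dec _ _ h) as [h'|h']; [lra|exfalso; apply hw0].
  exists (hw (rev u) (FF i)); split; [apply NN_hw, NN_FF|].
  rewrite <- (hw_dot u), hw_rev'; exact h'. }
pose proof (ph_sum_pos _ (proj1 hz1) hu) as hs.
set (e0 := dl * (ph I1 (hw u z) + ph I2 (hw u z) + ph I3 (hw u z))).
assert (he0 : 0 < e0) by (apply Rmult_lt_0_compat; assumption).
exists (Rmin e0 (Rmin (xx I1 (hw u z)) (Rmin (xx I2 (hw u z)) (xx I3 (hw u z))))).
pose proof (Rmin_l e0 (Rmin (xx I1 (hw u z)) (Rmin (xx I2 (hw u z)) (xx I3 (hw u z))))).
pose proof (Rmin_r e0 (Rmin (xx I1 (hw u z)) (Rmin (xx I2 (hw u z)) (xx I3 (hw u z))))).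
pose proof (Rmin_l (xx I1 (hw u z)) (Rmin (xx I2 (hw u z)) (xx I3 (hw u z)))).
pose proof (Rmin_r (xx I1 (hw u z)) (Rmin (xx I2 (hw u z)) (xx I3 (hw u z)))).
pose proof (Rmin_l (xx I2 (hw u z)) (xx I3 (hw u z))).
pose proof (Rmin_r (xx I2 (hw u z)) (xx I3 (hw u z))).
split; [repeat apply Rmin_glb_lt; auto|].
intros v hv; rewrite <- (hw_dot u).
destruct (NN_cases _ (NN_hw u v hv)) as [[k ->]|[s h]].
- assert (dot (hw u z) (FF k) = - xx k (hw u z)) by (unfold xx; ring).
  destruct k; lra.
- pose proof (good_gap _ _ s hu h); unfold e0 in *; lra.
Qed.

(** * The region as a convex hull *)

Section Hull.

Context (P : V -> Prop).
Context (Padd : forall v w, P v -> P w -> P (vadd v w)).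
Context (Pscal : forall k v, 0 <= k -> P v -> P (vscal k v)).

(** The inequalities place the vector between the bisector [foot i j k + foot j i k] and the ray of
    [foot j i k]; [s] and [t] are its coefficients there. *)
Lemma hull_edge i j k a b : (forall i j k, third i j k -> P (foot i j k)) -> third i j k ->
  0 <= b <= a -> dl * a <= gg k * b -> P (vadd (vscal a (FF i)) (vscal b (FF j))).
Proof.
intros hP h hab hd; pose proof (gg_gt k) as hg.
assert (h' : third j i k) by (destruct h as [[-> ->]|[-> ->]]; destruct i; [right|right|right|left|left|left]; auto).
set (t := (a - b) / (gg k - dl)). set (s := b - t * dl).
assert (ht : 0 <= t) by (apply Rmult_le_pos; [lra|left; apply Rinv_0_lt_compat; lra]).
assert (hs : 0 <= s).
{ unfold s, t; apply Rmult_le_reg_r with (gg k - dl); [lra|].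
  rewrite Rmult_0_l; replace ((b - (a - b) / (gg k - dl) * dl) * (gg k - dl)) with (gg k * b - dl * a) by (field; lra).
  lra. }
assert (E : vadd (vscal a (FF i)) (vscal b (FF j)) =
  vadd (vscal (s / (dl + gg k)) (vadd (foot i j k) (foot j i k))) (vscal t (foot j i k))).
{ unfold foot, s, t; vfield; lra. }
rewrite E; apply Padd; apply Pscal; auto.
apply Rmult_le_pos; [exact hs|left; apply Rinv_0_lt_compat; lra].
Qed.

(* The feet are the vertices of a right-angled hexagon whose sides lie
   alternately on the geodesics [FF i] and on the sides of the cone [0 <= ph]. *)
Lemma hull_feet z : (forall i j k, third i j k -> P (foot i j k)) ->
  (forall i, 0 <= ph i z) -> (forall i, 0 <= xx i z) -> P z.
Proof.
intros hP hp hx.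
(* If one coordinate exceeds the sum of the other two, [z] splits into two edge vectors sharing
   [FF i]. Otherwise the triangle inequalities make [z] a non-negative combination of the sums
   [FF (nx i) + FF (pv i)]. *)
destruct (classic (exists i, ph (nx i) z + ph (pv i) z < ph i z)) as [[i hi]|hno].
- pose proof (hp (nx i)) as pn; pose proof (hp (pv i)) as pp; pose proof (hx i) as xi.
  rewrite xx_ph in xi.
  assert (hz : forall s t, s + t = ph i z ->
    vadd (vadd (vscal s (FF i)) (vscal (ph (nx i) z) (FF (nx i))))
         (vadd (vscal t (FF i)) (vscal (ph (pv i) z) (FF (pv i)))) = z).
  { intros s t e; rewrite (ph_expand z) at 3; unfold comb; destruct i; simpl in *; rewrite <- e; vring. }
  assert (t1 : third i (nx i) (pv i)) by (left; auto).
  assert (t2 : third i (pv i) (nx i)) by (right; auto).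
  destruct (Rle_or_lt (dl * (ph i z - ph (pv i) z)) (gg (pv i) * ph (nx i) z)) as [h|h].
  + rewrite <- (hz (ph i z - ph (pv i) z) (ph (pv i) z)) by ring.
    apply Padd; [apply hull_edge with (pv i)|apply hull_edge with (nx i)]; auto; try lra.
    pose proof (gg_gt (nx i)); apply Rmult_le_compat_r; lra.
  + pose proof (gg_gt (nx i)) as gn; pose proof (gg_gt (pv i)) as gp.
    (* The largest share of [ph i z] that [hull_edge] permits on the edge with [FF (nx i)]; the
       preceding case instead gave the other edge its least share. *)
    set (s := gg (pv i) * ph (nx i) z / dl).
    assert (es : dl * s = gg (pv i) * ph (nx i) z) by (unfold s; field; lra).
    rewrite <- (hz s (ph i z - s)) by ring.
    apply Padd; [apply hull_edge with (pv i)|apply hull_edge with (nx i)]; auto; try lra; try split; auto; nra.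
- assert (ht : forall i, ph i z <= ph (nx i) z + ph (pv i) z).
  { intros i; apply Rnot_lt_le; intros h; apply hno; exists i; exact h. }
  pose proof (ht I1) as h1; pose proof (ht I2) as h2; pose proof (ht I3) as h3; simpl in *.
  assert (he : forall i, P (vadd (FF (nx i)) (FF (pv i)))).
  { intros i; pose proof (gg_gt i).
    assert (E : vadd (FF (nx i)) (FF (pv i)) = vscal (/ (dl + gg i)) (vadd (foot (nx i) (pv i) i) (foot (pv i) (nx i) i))).
    { unfold foot; vfield; lra. }
    rewrite E; apply Pscal; [left; apply Rinv_0_lt_compat; lra|].
    apply Padd; apply hP; destruct i; [left|left|left|right|right|right]; auto. }
  assert (E : z = vadd (vscal ((ph I2 z + ph I3 z - ph I1 z) / 2) (vadd (FF (nx I1)) (FF (pv I1))))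
    (vadd (vscal ((ph I1 z + ph I3 z - ph I2 z) / 2) (vadd (FF (nx I2)) (FF (pv I2))))
          (vscal ((ph I1 z + ph I2 z - ph I3 z) / 2) (vadd (FF (nx I3)) (FF (pv I3)))))).
  { rewrite (ph_expand z) at 1; unfold comb; simpl; vfield. }
  rewrite E; apply Padd; [|apply Padd]; (apply Pscal; [lra|apply he]).
Qed.

End Hull.

(** Stated for an arbitrary convex cone [P], so that it applies to the cone over any competitor in
    the definition of the Nielsen region. *)
Lemma inK_hull (P : V -> Prop) :
  (forall v w, P v -> P w -> P (vadd v w)) ->
  (forall k v, 0 <= k -> P v -> P (vscal k v)) ->
  (forall u i j k, third i j k -> P (hw u (foot i j k))) ->
  forall z, inK z -> P z.
Proof.
intros Pa Ps Pf z hz; destruct (cover z (proj1 hz)) as [u hu].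
rewrite <- (hw_rev u z).
apply (hull_feet (fun y => P (hw (rev u) y))).
- intros v w hv hw'; rewrite hw_add; auto.
- intros k v hk hv; rewrite hw_scal; auto.
- intros; apply Pf; assumption.
- exact hu.
- intros i; unfold xx; pose proof (proj2 (inK_hw u z hz) (FF i) (NN_FF i)); lra.
Qed.

(** The normalised sum of the three normals; it provides a point that the involution moves. *)
Lemma center_exists : exists z, in_H2 z /\ (forall i, 0 < ph i z) /\ forall i, 0 <= xx i z.
Proof.
pose proof (gg_gt I1); pose proof (gg_gt I2); pose proof (gg_gt I3).
set (o := comb 1 1 1).
assert (po : forall i, ph i o = 1).
{ intros i; unfold o, comb; rewrite !ph_add, !ph_scal, !ph_FF; destruct i; simpl; ring. }
assert (xo : forall i, dl < xx i o).
{ intros i; rewrite xx_ph, !po; destruct i; simpl; lra. }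
assert (hn : dot o o < 0).
{ pose proof (dot_xx o o) as e; rewrite !po in e; pose proof (xo I1); pose proof (xo I2); pose proof (xo I3); lra. }
assert (hf : 0 < vt o).
{ destruct (hq I1); apply (future_of_dot (q I1)); try lra.
  unfold o, comb; autorewrite with dot.
  pose proof (q_dot_FF_neg I1 I1); pose proof (q_dot_FF_neg I1 I2); pose proof (q_dot_FF_neg I1 I3); lra. }
assert (hs : 0 < sqrt (- dot o o)) by (apply sqrt_lt_R0; lra).
assert (hk : 0 < / sqrt (- dot o o)) by (apply Rinv_0_lt_compat, hs).
exists (vscal (/ sqrt (- dot o o)) o); repeat split.
- autorewrite with dot; pose proof (sqrt_sqrt (- dot o o)) as e.
  replace (dot o o) with (- (sqrt (- dot o o) * sqrt (- dot o o))) at 3 by lra.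
  field; lra.
- simpl; apply Rmult_lt_0_compat; assumption.
- intros i; rewrite ph_scal, po; lra.
- intros i; pose proof (xo i) as h; unfold xx in *; rewrite dot_scall.
  assert (/ sqrt (- dot o o) * dot o (FF i) <= 0) by nra. lra.
Qed.

Lemma center_not_q w i z : in_H2 z -> (forall j, 0 < ph j z) -> z <> hw w (q i).
Proof.
intros hz hp e; assert (h : hw (rev w) z = q i) by (rewrite e; apply hw_rev).
destruct (hw_reduce (rev w)) as (w' & h1 & _ & h3); rewrite <- h3 in h.
destruct w' as [|s w'].
- simpl in h; pose proof (hp i) as hi; rewrite h, ph_q in hi.
  destruct (idx_dec i i); [lra|congruence].
- destruct (hw_pingpong _ z h1 hz (fun j => Rlt_le _ _ (hp j)) s w' eq_refl) as [a b].
  rewrite h in a, b; pose proof (ph_q_nonneg s i); pose proof (hp s).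
  destruct b as [_ b]; lra.
Qed.

Lemma inK_of_ph z : in_H2 z -> (forall i, 0 <= ph i z) -> (forall i, 0 <= xx i z) -> inK z.
Proof.
intros hz hp hx; split; [exact hz|].
intros v hv; destruct (NN_cases v hv) as [[k ->]|[s h]].
- pose proof (hx k) as h; unfold xx in h; lra.
- pose proof (good_gap z v s hp h); pose proof (ph_sum_pos z hz hp); nra.
Qed.

(* [f] is a product of reflections in the walls, with parity [b], followed on
   the right by an even word in the half-turns. *)
Definition Ext (b : bool) (f : V -> V) : Prop :=
  exists l w, Forall NN l /\ Nat.even (length l) = b /\ Nat.even (length w) = true /\
    forall z, f z = rw l (hw w z).

Lemma Forall_NN_hw w l : Forall NN l -> Forall NN (map (hw w) l).
Proof.
intros h; rewrite Forall_forall in *; intros v hv; apply in_map_iff in hv as (u & <- & hu).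
apply NN_hw; auto.
Qed.

Lemma Ext_word w : Nat.even (length w) = true -> Ext true (hw w).
Proof. intros h; exists [], w; repeat split; auto. Qed.

Lemma Ext_refl v : NN v -> Ext false (refl v).
Proof. intros h; exists [v], []; repeat split; auto. Qed.

(** Half-turn words permute [NN] and so normalise the group of wall reflections ([hw_rw]); all
    reflections can be collected on the left, and their parity is multiplicative. *)
Lemma Ext_comp b b' f f' : Ext b f -> Ext b' f' -> Ext (Bool.eqb b b') (fun z => f (f' z)).
Proof.
intros (l & w & h1 & h2 & h3 & h4) (l' & w' & h1' & h2' & h3' & h4').
exists (l ++ map (hw w) l'), (w ++ w'); repeat split.
- apply Forall_app; split; [exact h1|apply Forall_NN_hw, h1'].
- rewrite even_app, length_map, h2, h2'; reflexivity.
- rewrite even_app, h3, h3'; reflexivity.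
- intros z; rewrite h4, h4', rw_app, hw_rw, hw_app; reflexivity.
Qed.

Lemma Ext_inv b f : Ext b f ->
  exists f', Ext b f' /\ (forall z, f' (f z) = z) /\ (forall z, f (f' z) = z).
Proof.
intros (l & w & h1 & h2 & h3 & h4).
assert (h1' : Forall NN (rev l)) by (apply Forall_rev, h1).
exists (fun z => hw (rev w) (rw (rev l) z)); split; [|split].
- exists (map (hw (rev w)) (rev l)), (rev w); repeat split.
  + apply Forall_NN_hw, h1'.
  + rewrite length_map, even_rev; exact h2.
  + rewrite even_rev; exact h3.
  + intros z; apply hw_rw.
- intros z; rewrite h4, rw_rev, hw_rev by exact h1; reflexivity.
- intros z; rewrite h4, hw_rev', <- (rev_involutive l) at 1.
  apply rw_rev, h1'.
Qed.

Lemma Ext_HH i b f : Ext b f -> Ext b (fun z => HH i (f (HH i z))).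
Proof.
intros (l & w & h1 & h2 & h3 & h4).
exists (map (hw [i]) l), ([i] ++ w ++ [i]); repeat split.
- apply Forall_NN_hw, h1.
- rewrite length_map; exact h2.
- rewrite !even_app, h3; reflexivity.
- intros z; rewrite h4, !hw_app; change (HH i (rw l (hw w (HH i z)))) with (hw [i] (rw l (hw w (HH i z)))).
  apply hw_rw.
Qed.

Lemma Ext_in_H2 b f z : Ext b f -> in_H2 z -> in_H2 (f z).
Proof.
intros (l & w & h1 & h2 & h3 & h4) hz; rewrite h4; apply rw_in_H2, hw_in_H2, hz; exact h1.
Qed.

(** By [rw_inK] at most one reflection survives, and then the point lies on its wall, where that
    reflection acts trivially. Only in the first case is the whole map [f] a word; in the second the
    equality holds at [z]. *)
Lemma Ext_inK b f z : Ext b f -> inK z -> inK (f z) ->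
  (b = true /\ exists w, Nat.even (length w) = true /\ forall y, f y = hw w y) \/
  (b = false /\ on_wall z /\ exists w, Nat.even (length w) = true /\ f z = hw w z).
Proof.
intros (l & w & h1 & h2 & h3 & h4) hz hfz.
destruct (rw_reduce l h1) as (l' & a1 & a2 & a3 & a4).
rewrite h4, <- a4 in hfz.
destruct (rw_inK l' _ a1 a2 (inK_hw w z hz) hfz) as [->|(v & -> & hv & e)].
- left; rewrite <- h2, <- a3; split; [reflexivity|].
  exists w; split; [exact h3|]; intros y; rewrite h4, <- a4; reflexivity.
- right; rewrite <- h2, <- a3; split; [reflexivity|split].
  + exists (hw (rev w) v); split; [apply NN_hw, hv|].
    rewrite <- (hw_dot w), hw_rev'; exact e.
  + exists w; split; [exact h3|]; rewrite h4, <- a4; simpl; apply refl_fix, e.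
Qed.

(* A product involving at least one reflection moves points of the region away
   by a definite amount. *)
Lemma Ext_near f z e : Ext true f -> inK z -> 0 < e -> (forall v, NN v -> dot z v <= - e) ->
  dot z (f z) ^ 2 < 1 + e ^ 2 / dl ->
  exists w, Nat.even (length w) = true /\ forall y, f y = hw w y.
Proof.
intros (l & w & h1 & h2 & h3 & h4) hz he hgap hn.
destruct (rw_reduce l h1) as (l' & a1 & a2 & a3 & a4).
destruct l' as [|v l'].
- exists w; split; [exact h3|]; intros y; rewrite h4, <- a4; reflexivity.
- exfalso.
  destruct (rw_pingpong _ _ a1 a2 (inK_hw w z hz) v l' eq_refl) as [b1 _].
  rewrite h4, <- a4 in hn.
  assert (hv : NN v) by (inversion a2; assumption).
  pose proof (separated_far z (rw (v :: l') (hw w z)) v e dl (proj1 hz)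
    (rw_in_H2 _ _ a2 (hw_in_H2 w z (proj1 hz))) hdl (NN_norm v hv) (Rlt_le _ _ he) (hgap v hv) b1).
  lra.
Qed.

End Config.

(** * Automorphisms of the disc *)

Definition mkD (z : C) (h : Cmod z < 1) : Disc := exist _ z h.

Lemma Disc_eq (z w : Disc) : dval z = dval w -> z = w.
Proof.
destruct z as [z hz], w as [w hw]; simpl; intros ->; f_equal; apply proof_irrelevance.
Qed.

Lemma aut_eq (g h : aut) : ca g = ca h -> cb g = cb h -> g = h.
Proof.
destruct g as [a b e], h as [a' b' e']; simpl; intros; subst; f_equal; apply proof_irrelevance.
Qed.

Ltac cring := apply injective_projections; unfold Cplus, Cmult, Cconj, Copp, Cminus, RtoC; simpl; ring.

Lemma mul_assoc f g h : mul f (mul g h) = mul (mul f g) h.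
Proof. apply aut_eq; simpl; cring. Qed.

Lemma mul_one_l g : mul one g = g.
Proof. apply aut_eq; simpl; cring. Qed.

Lemma Cmod_sqr (z : C) : Cmod z ^ 2 = fst z ^ 2 + snd z ^ 2.
Proof. rewrite Cmod2_alt; reflexivity. Qed.

Lemma aut_det' (g : aut) :
  fst (ca g) ^ 2 + snd (ca g) ^ 2 - (fst (cb g) ^ 2 + snd (cb g) ^ 2) = 1.
Proof. rewrite <- !Cmod_sqr; apply aut_det. Qed.

Lemma mul_inv_r g : mul g (inv g) = one.
Proof.
pose proof (aut_det' g) as h; apply aut_eq; apply injective_projections;
  unfold Cplus, Cmult, Cconj, Copp, Cminus, RtoC in *; simpl in *; lra.
Qed.

Lemma mul_inv_l g : mul (inv g) g = one.
Proof.
pose proof (aut_det' g) as h; apply aut_eq; apply injective_projections;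
  unfold Cplus, Cmult, Cconj, Copp, Cminus, RtoC in *; simpl in *; lra.
Qed.

Lemma moebius_den (g : aut) (z : C) : Cmod z <= 1 ->
  (Cconj (cb g) * z + Cconj (ca g))%C <> 0.
Proof.
intros hz h; pose proof (aut_gap g z) as e; rewrite h, Cmod_0 in e.
pose proof (Cmod_ge_0 z).
set (n := (ca g * z + cb g)%C) in e.
pose proof (pow2_ge_0 (Cmod n)).
assert (hn : Cmod n = 0) by nra. assert (hz1 : Cmod z = 1) by nra.
apply Cmod_eq_0 in hn; unfold n in hn.
pose proof (aut_det g) as hd.
assert (ha : Cmod (ca g) = Cmod (cb g)).
{ rewrite <- (Cmod_opp (cb g)). replace (- cb g)%C with (ca g * z)%C.
  - rewrite Cmod_mult, hz1; ring.
  - replace (ca g * z)%C with ((ca g * z + cb g) + - cb g)%C by ring; rewrite hn; ring. }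
rewrite ha in hd; lra.
Qed.

Lemma moebius_closed (g : aut) (z : C) : Cmod z <= 1 -> Cmod (moebius g z) <= 1.
Proof.
intros hz; unfold moebius; pose proof (aut_gap g z) as hg; pose proof (moebius_den g z hz) as hd.
rewrite Cmod_div by exact hd; apply Cmod_gt_0 in hd.
apply Rle_div_l; [exact hd|].
pose proof (Cmod_ge_0 z); pose proof (Cmod_ge_0 (ca g * z + cb g)%C); nra.
Qed.

Lemma moebius_circle (g : aut) (z : C) : Cmod z = 1 -> Cmod (moebius g z) = 1.
Proof.
intros hz; unfold moebius; pose proof (aut_gap g z) as hg; pose proof (moebius_den g z (Req_le _ _ hz)) as hd.
rewrite Cmod_div by exact hd; apply Cmod_gt_0 in hd.
rewrite hz in hg.
pose proof (Cmod_ge_0 (ca g * z + cb g)%C).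
assert (e : Cmod (ca g * z + cb g)%C = Cmod (Cconj (cb g) * z + Cconj (ca g))%C) by nra.
rewrite e; field; lra.
Qed.

Lemma moebius_mul (g h : aut) (z : C) : Cmod z <= 1 ->
  moebius (mul g h) z = moebius g (moebius h z).
Proof.
intros hz; pose proof (moebius_den h z hz) as h1.
pose proof (moebius_den g (moebius h z) (moebius_closed h z hz)) as h2.
pose proof (moebius_den (mul g h) z hz) as h3.
unfold moebius in *; simpl in *.
set (n := (ca h * z + cb h)%C) in *. set (d := (Cconj (cb h) * z + Cconj (ca h))%C) in *.
assert (e1 : ((ca g * ca h + cb g * Cconj (cb h)) * z + (ca g * cb h + cb g * Cconj (ca h)))%C
   = (ca g * n + cb g * d)%C) by (unfold n, d; ring).
assert (e2 : (Cconj (ca g * cb h + cb g * Cconj (ca h)) * z + Cconj (ca g * ca h + cb g * Cconj (cb h)))%C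
   = (Cconj (cb g) * n + Cconj (ca g) * d)%C) by (unfold n, d; cring).
rewrite e1, e2 in *; field; repeat split; assumption.
Qed.

Lemma act_mul g h z : act (mul g h) z = act g (act h z).
Proof. apply Disc_eq; simpl; apply moebius_mul; left; exact (proj2_sig z). Qed.

Lemma act_one z : act one z = z.
Proof.
apply Disc_eq; simpl; unfold moebius; simpl.
replace (Cconj 0 * z + Cconj 1)%C with (RtoC 1) by cring. field.

Qed.

Lemma act_inv_l g z : act (inv g) (act g z) = z.
Proof. rewrite <- act_mul, mul_inv_l; apply act_one. Qed.

Lemma act_inv_r g z : act g (act (inv g) z) = z.
Proof. rewrite <- act_mul, mul_inv_r; apply act_one. Qed.

(** * From the disc to the hyperboloid *)

Definition nrm (z : Disc) : R := fst (dval z) ^ 2 + snd (dval z) ^ 2.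

Lemma nrm_lt z : nrm z < 1.
Proof.
unfold nrm; rewrite <- Cmod_sqr; pose proof (proj2_sig z) as h; pose proof (Cmod_ge_0 z).
unfold dval in *; simpl in h; nra.
Qed.

(* Hyperboloid model: the unit future vector corresponding to a point. *)
Definition pt (z : Disc) : V :=
  mkV (2 * fst (dval z) / (1 - nrm z)) (2 * snd (dval z) / (1 - nrm z))
      ((1 + nrm z) / (1 - nrm z)).

Lemma pt_in_H2 z : in_H2 (pt z).
Proof.
pose proof (nrm_lt z); split.
- unfold dot, pt; simpl. transitivity ((4 * nrm z - (1 + nrm z) ^ 2) / (1 - nrm z) ^ 2).
  + unfold nrm in *; field; lra.
  + field; lra.
- simpl; apply Rdiv_lt_0_compat; [unfold nrm; nra|lra].
Qed.

Lemma pt_surj v : in_H2 v -> exists z, pt z = v.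
Proof.
intros [hv ht]; unfold dot in hv; destruct v as [x y t]; simpl in *.
assert (hm : Cmod (x / (1 + t), y / (1 + t)) < 1).
{ apply Rsqr_incrst_0; try apply Cmod_ge_0; try lra; rewrite !Rsqr_pow2, Cmod_sqr; simpl.
  replace (x / (1 + t) * (x / (1 + t) * 1) + y / (1 + t) * (y / (1 + t) * 1))
    with ((x * x + y * y) / (1 + t) ^ 2) by (field; lra).
  apply Rlt_div_l; nra. }
exists (mkD _ hm).
assert (e : nrm (mkD _ hm) = (t - 1) / (t + 1)).
{ unfold nrm; simpl; transitivity ((x * x + y * y) / (1 + t) ^ 2); [field; lra|].
  replace (x * x + y * y) with (t * t - 1) by lra; field; lra. }
unfold pt; rewrite e; apply V_eq; simpl; field; lra.
Qed.

Lemma pt_inj z w : pt z = pt w -> z = w.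
Proof.
intros h; pose proof (nrm_lt z) as hz; pose proof (nrm_lt w) as hw.
unfold pt in h; injection h as h1 h2 h3.
assert (e : nrm z = nrm w).
{ assert (e1 : (1 + nrm z) / (1 - nrm z) * ((1 - nrm z) * (1 - nrm w)) = (1 + nrm w) / (1 - nrm w) * ((1 - nrm z) * (1 - nrm w))) by (rewrite h3; ring).
  field_simplify in e1; lra. }
rewrite e in h1, h2.
apply Disc_eq, injective_projections.
- apply Rmult_eq_reg_l with (2 / (1 - nrm w)); [|apply Rgt_not_eq, Rdiv_lt_0_compat; lra].
  transitivity (2 * fst (dval z) / (1 - nrm w)); [field; lra|rewrite h1; field; lra].
- apply Rmult_eq_reg_l with (2 / (1 - nrm w)); [|apply Rgt_not_eq, Rdiv_lt_0_compat; lra].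
  transitivity (2 * snd (dval z) / (1 - nrm w)); [field; lra|rewrite h2; field; lra].
Qed.

Lemma dot_pt z w : dot (pt z) (pt w) =
  -1 - 2 * Cmod (z - w)%C ^ 2 / ((1 - nrm z) * (1 - nrm w)).
Proof.
pose proof (nrm_lt z); pose proof (nrm_lt w).
rewrite Cmod_sqr; unfold dot, pt; simpl.
transitivity ((4 * (fst (dval z) * fst (dval w) + snd (dval z) * snd (dval w))
  - (1 + nrm z) * (1 + nrm w)) / ((1 - nrm z) * (1 - nrm w))); [field; lra|].
unfold nrm in *; field; lra.
Qed.

(* The adjoint action of SU(1,1): with [zeta = vx + i vy], it sends
   [(zeta, vt)] to [(a^2 zeta + b^2 conj zeta + 2 a b vt,
   (|a|^2 + |b|^2) vt + 2 Re (a conj b zeta))]. *)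
Definition lin (g : aut) (v : V) : V :=
  let a1 := fst (ca g) in let a2 := snd (ca g) in
  let b1 := fst (cb g) in let b2 := snd (cb g) in
  mkV ((a1 ^ 2 - a2 ^ 2 + b1 ^ 2 - b2 ^ 2) * vx v + 2 * (b1 * b2 - a1 * a2) * vy v
        + 2 * (a1 * b1 - a2 * b2) * vt v)
      (2 * (a1 * a2 + b1 * b2) * vx v + (a1 ^ 2 - a2 ^ 2 - b1 ^ 2 + b2 ^ 2) * vy v
        + 2 * (a1 * b2 + a2 * b1) * vt v)
      (2 * (a1 * b1 + a2 * b2) * vx v + 2 * (a1 * b2 - a2 * b1) * vy v
        + (a1 ^ 2 + a2 ^ 2 + b1 ^ 2 + b2 ^ 2) * vt v).

Lemma lin_mul g h v : lin (mul g h) v = lin g (lin h v).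
Proof.
destruct g as [[] [] ?], h as [[] [] ?]; apply V_eq; unfold lin; simpl; ring.
Qed.

Lemma lin_one v : lin one v = v.
Proof. apply V_eq; unfold lin; simpl; ring. Qed.

Lemma lin_inv_l g v : lin (inv g) (lin g v) = v.
Proof. rewrite <- lin_mul, mul_inv_l; apply lin_one. Qed.

Lemma lin_inv_r g v : lin g (lin (inv g) v) = v.
Proof. rewrite <- lin_mul, mul_inv_r; apply lin_one. Qed.

Lemma lin_add g v w : lin g (vadd v w) = vadd (lin g v) (lin g w).
Proof. apply V_eq; unfold lin; simpl; ring. Qed.

Lemma lin_scal g k v : lin g (vscal k v) = vscal k (lin g v).
Proof. apply V_eq; unfold lin; simpl; ring. Qed.

Lemma lin_dot g v w : dot (lin g v) (lin g w) = dot v w.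
Proof.
assert (E : dot (lin g v) (lin g w) =
  (fst (ca g) ^ 2 + snd (ca g) ^ 2 - (fst (cb g) ^ 2 + snd (cb g) ^ 2)) ^ 2 * dot v w).
{ unfold dot, lin; simpl; ring. }
rewrite E, aut_det'; ring.
Qed.

Lemma pt_act g z : pt (act g z) = lin g (pt z).
Proof.
pose proof (nrm_lt z) as hz.
pose proof (aut_gap g z) as hg.
pose proof (moebius_den g z (Rlt_le _ _ (proj2_sig z))) as hd.
set (N := (ca g * z + cb g)%C) in *.
set (D := (Cconj (cb g) * z + Cconj (ca g))%C) in *.
rewrite !Cmod_sqr in hg; fold (nrm z) in hg.
assert (hp : 0 < fst D ^ 2 + snd D ^ 2) by (rewrite <- Cmod_sqr; apply pow_lt, Cmod_gt_0, hd).
assert (e1 : dval (act g z) = ((fst N * fst D + snd N * snd D) / (fst D ^ 2 + snd D ^ 2),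
  (snd N * fst D - fst N * snd D) / (fst D ^ 2 + snd D ^ 2))).
{ change (dval (act g z)) with (N / D)%C; clearbody N D; destruct N as [n1 n2], D as [d1 d2].
  unfold Cdiv, Cinv, Cmult; apply injective_projections; simpl in *; field; lra. }
assert (hD1 : fst D = fst (cb g) * fst (dval z) + snd (cb g) * snd (dval z) + fst (ca g)) by (unfold D; simpl; ring).
assert (hD2 : snd D = fst (cb g) * snd (dval z) - snd (cb g) * fst (dval z) - snd (ca g)) by (unfold D; simpl; ring).
assert (hN1 : fst N = fst (ca g) * fst (dval z) - snd (ca g) * snd (dval z) + fst (cb g)) by (unfold N; simpl; ring).
assert (hN2 : snd N = fst (ca g) * snd (dval z) + snd (ca g) * fst (dval z) + snd (cb g)) by (unfold N; simpl; ring).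
clearbody N D.
assert (e2 : 1 - nrm (act g z) = (1 - nrm z) / (fst D ^ 2 + snd D ^ 2)).
{ unfold nrm at 1; rewrite e1, <- hg; simpl; field; lra. }
assert (e3 : 1 + nrm (act g z) = (fst D ^ 2 + snd D ^ 2 + (fst N ^ 2 + snd N ^ 2)) / (fst D ^ 2 + snd D ^ 2)).
{ unfold nrm at 1; rewrite e1; simpl; field; lra. }
unfold pt at 1; rewrite e2, e3, e1; cbn [fst snd].
apply V_eq; cbn [vx vy vt lin pt].
- transitivity (2 * (fst N * fst D + snd N * snd D) / (1 - nrm z)); [field; lra|].
  rewrite hD1, hD2, hN1, hN2; unfold nrm in *; field; lra.
- transitivity (2 * (snd N * fst D - fst N * snd D) / (1 - nrm z)); [field; lra|].
  rewrite hD1, hD2, hN1, hN2; unfold nrm in *; field; lra.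
- transitivity ((fst D ^ 2 + snd D ^ 2 + (fst N ^ 2 + snd N ^ 2)) / (1 - nrm z)); [field; lra|].
  rewrite hD1, hD2, hN1, hN2; unfold nrm in *; field; lra.
Qed.

Lemma lin_in_H2 g v : in_H2 v -> in_H2 (lin g v).
Proof.
intros h; destruct (pt_surj v h) as [z <-]; rewrite <- pt_act; apply pt_in_H2.
Qed.

Lemma lin_half_turn x v : lin (half_turn x) v = half (pt x) v.
Proof.
pose proof (nrm_lt x) as h; unfold half, dot, lin, half_turn.
apply V_eq; cbn [ca cb vx vy vt vadd vscal]; rewrite Cmod_sqr; fold (nrm x);
unfold pt; simpl; unfold nrm in *; field; lra.
Qed.

Lemma pt_half_turn x z : pt (act (half_turn x) z) = half (pt x) (pt z).
Proof. rewrite pt_act; apply lin_half_turn. Qed.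

(** * Faithfulness of the linear action *)

Definition linear_map (f : V -> V) : Prop :=
  (forall v w, f (vadd v w) = vadd (f v) (f w)) /\
  (forall k v, f (vscal k v) = vscal k (f v)).

Lemma linear_ext (f f' : V -> V) : linear_map f -> linear_map f' ->
  (forall z, f (pt z) = f' (pt z)) -> forall v, f v = f' v.
Proof.
intros [fa fs] [fa' fs'] h v.
assert (hp : forall u, in_H2 u -> f u = f' u) by (intros u hu; destruct (pt_surj u hu) as [z <-]; apply h).
(* Three points of the hyperboloid that form a basis of [V], with rational coordinates from the
   triple 3, 4, 5. *)
assert (e : v = vadd (vscal (4 / 3 * vx v) (mkV (3 / 4) 0 (5 / 4)))
  (vadd (vscal (4 / 3 * vy v) (mkV 0 (3 / 4) (5 / 4)))
    (vscal (vt v - 5 / 3 * vx v - 5 / 3 * vy v) (mkV 0 0 1)))) by vfield.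
rewrite e, !fa, !fs, !fa', !fs', !hp; [reflexivity|..];
  split; unfold dot; simpl; lra.
Qed.

Lemma lin_linear g : linear_map (lin g).
Proof. split; intros; [apply lin_add|apply lin_scal]. Qed.

Lemma same_iff_lin g h : same g h <-> forall v, lin g v = lin h v.
Proof.
split.
- intros hs; apply linear_ext; try apply lin_linear.
  intros z; rewrite <- !pt_act, hs; reflexivity.
- intros hl z; apply pt_inj; rewrite !pt_act; apply hl.
Qed.

Definition sgn_eq (g h : aut) : Prop :=
  (ca g = ca h /\ cb g = cb h) \/ (ca g = (- ca h)%C /\ cb g = (- cb h)%C).

(** [lin g] determines the square of [ca g] and the product [ca g * cb g], and [ca g] does not
    vanish. The sign form is needed on the boundary circle, about which [same] says nothing
    directly. *)
Lemma same_sgn_eq g h : same g h -> sgn_eq g h.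
Proof.
rewrite same_iff_lin; intros hl.
pose proof (hl (mkV 1 0 0)) as e1; pose proof (hl (mkV 0 1 0)) as e2; pose proof (hl (mkV 0 0 1)) as e3.
unfold sgn_eq; pose proof (aut_det' g) as dg; pose proof (aut_det' h) as dh.
unfold lin in e1, e2, e3; destruct (ca g) as [a1 a2], (cb g) as [b1 b2], (ca h) as [c1 c2], (cb h) as [d1 d2].
simpl in *; injection e1; injection e2; injection e3; clear e1 e2 e3 hl; intros.
assert (s1 : a1 ^ 2 = c1 ^ 2) by lra. assert (s2 : a1 * a2 = c1 * c2) by lra.
assert (s3 : a2 ^ 2 = c2 ^ 2) by lra.
assert (p1 : a1 * b1 - a2 * b2 = c1 * d1 - c2 * d2) by lra.
assert (p2 : a1 * b2 + a2 * b1 = c1 * d2 + c2 * d1) by lra.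
assert (hs : (a1 = c1 /\ a2 = c2) \/ (a1 = - c1 /\ a2 = - c2)).
{ assert (f1 : (a1 - c1) * (a1 + c1) = 0) by lra. assert (f2 : (a2 - c2) * (a2 + c2) = 0) by lra.
  apply Rmult_integral in f1 as [f1|f1]; apply Rmult_integral in f2 as [f2|f2].
  - left; lra.
  - assert (a1 = c1) by lra; assert (a2 = - c2) by lra; subst a1 a2.
    assert (f3 : c1 * c2 = 0) by lra; apply Rmult_integral in f3 as [f3|f3]; [right|left]; lra.
  - assert (a1 = - c1) by lra; assert (a2 = c2) by lra; subst a1 a2.
    assert (f3 : c1 * c2 = 0) by lra; apply Rmult_integral in f3 as [f3|f3]; [left|right]; lra.
  - right; lra. }
assert (hc : 0 < c1 ^ 2 + c2 ^ 2) by nra.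
assert (key : forall x y, c1 * x - c2 * y = 0 -> c1 * y + c2 * x = 0 -> x = 0 /\ y = 0).
{ intros x y k1 k2; split; apply Rmult_eq_reg_l with (c1 ^ 2 + c2 ^ 2); try lra.
  - replace ((c1 ^ 2 + c2 ^ 2) * x) with (c1 * (c1 * x - c2 * y) + c2 * (c1 * y + c2 * x)) by ring; rewrite k1, k2; ring.
  - replace ((c1 ^ 2 + c2 ^ 2) * y) with (c1 * (c1 * y + c2 * x) - c2 * (c1 * x - c2 * y)) by ring; rewrite k1, k2; ring. }
destruct hs as [[-> ->]|[-> ->]]; [left|right].
- destruct (key (b1 - d1) (b2 - d2)) as [k1 k2]; try lra.
  split; apply injective_projections; simpl; lra.
- destruct (key (b1 + d1) (b2 + d2)) as [k1 k2]; try lra.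
  split; apply injective_projections; simpl; lra.
Qed.

Lemma sgn_eq_moebius g h z : sgn_eq g h -> Cmod z <= 1 -> moebius g z = moebius h z.
Proof.
intros [[e1 e2]|[e1 e2]] hz; pose proof (moebius_den h z hz) as hd; unfold moebius; rewrite e1, e2.
- reflexivity.
- replace (Cconj (- cb h) * z + Cconj (- ca h))%C with (- (Cconj (cb h) * z + Cconj (ca h)))%C by cring.
  field; exact hd.
Qed.

Lemma sgn_eq_same g h : sgn_eq g h -> same g h.
Proof. intros hs z; apply Disc_eq; simpl; apply sgn_eq_moebius; [exact hs|left; exact (proj2_sig z)]. Qed.

(* The fixed vector of [lin g]: the traceless part of the matrix of [g]. *)
Definition Nv (g : aut) : V := mkV (- snd (cb g)) (fst (cb g)) (snd (ca g)).

Lemma Nv_norm g : dot (Nv g) (Nv g) = fst (ca g) ^ 2 - 1.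
Proof. pose proof (aut_det' g); unfold dot, Nv; simpl in *; lra. Qed.

Lemma Nv_conj k g : Nv (mul (mul k g) (inv k)) = lin k (Nv g).
Proof.
destruct k as [[] [] ?], g as [[] [] ?]; apply V_eq; unfold Nv, lin; simpl; ring.
Qed.

Lemma Re_conj k g : fst (ca (mul (mul k g) (inv k))) = fst (ca g).
Proof.
pose proof (aut_det' k) as h; destruct k as [[a1 a2] [b1 b2] ?], g as [[c1 c2] [d1 d2] ?]; simpl in *.
assert (h' : a1 ^ 2 + a2 ^ 2 - (b1 ^ 2 + b2 ^ 2) = 1) by exact h.
transitivity ((a1 ^ 2 + a2 ^ 2 - (b1 ^ 2 + b2 ^ 2)) * c1); [ring|rewrite h'; ring].
Qed.

(** Either alternative gives [cb g <> 0], so that the fixed space of [lin g] is a line. It later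
    identifies the normal [FF q I2] with the axis vector of the commutator. *)
Lemma fixed_vector_Nv g v : hyperbolic g \/ cb g <> 0 -> lin g v = v ->
  exists k, v = vscal k (Nv g).
Proof.
intros hb hv; pose proof (aut_det' g) as hd.
assert (hb' : 0 < fst (cb g) ^ 2 + snd (cb g) ^ 2).
{ destruct hb as [hb|hb].
  - unfold hyperbolic, abs_trace, Re in hb.
    assert (1 < fst (ca g) ^ 2).
    { rewrite <- (Rsqr_pow2 (fst (ca g))), (Rsqr_abs (fst (ca g))); unfold Rsqr.
      rewrite Rabs_mult, (Rabs_right 2) in hb by lra; nra. }
    pose proof (pow2_ge_0 (snd (ca g))); lra.
  - rewrite <- Cmod_sqr; apply pow_lt, Cmod_gt_0, hb. }
destruct g as [[a1 a2] [b1 b2] hg], v as [x y t]; unfold lin, Nv in *; cbn [ca cb fst snd vx vy vt vscal] in *; clear hg hb.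
injection hv; intros e3 e2 e1; clear hv.
set (B := b1 ^ 2 + b2 ^ 2) in *.
assert (hA : a1 ^ 2 + a2 ^ 2 = 1 + B) by lra.
(* [conj b * zeta] is purely imaginary *)
set (s1 := b1 * x + b2 * y). set (s2 := b1 * y - b2 * x).
assert (e3' : a1 * s1 - a2 * s2 + B * t = 0).
{ assert (E : 2 * (a1 * s1 - a2 * s2 + B * t) = 0); [|lra].
  transitivity (2 * (a1 * b1 + a2 * b2) * x + 2 * (a1 * b2 - a2 * b1) * y + (1 + B + B) * t - t);
    [unfold s1, s2; ring|rewrite <- hA; unfold B; lra]. }
assert (E12 : (a1 ^ 2 - a2 ^ 2 - 1) * s1 - 2 * a1 * a2 * s2 + B * s1 + 2 * a1 * (B * t) = 0).
{ transitivity (b1 * ((a1 ^ 2 - a2 ^ 2 + b1 ^ 2 - b2 ^ 2) * x + 2 * (b1 * b2 - a1 * a2) * y + 2 * (a1 * b1 - a2 * b2) * t - x)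
    + b2 * (2 * (a1 * a2 + b1 * b2) * x + (a1 ^ 2 - a2 ^ 2 - b1 ^ 2 + b2 ^ 2) * y + 2 * (a1 * b2 + a2 * b1) * t - y)).
  - unfold s1, s2, B; ring.
  - match goal with |- b1 * ?u + b2 * ?v = 0 =>
      assert (u1 : u = 0) by lra; assert (u2 : v = 0) by lra; rewrite u1, u2; ring end. }
assert (hBt : B * t = a2 * s2 - a1 * s1) by lra.
assert (hs1 : s1 = 0).
{ rewrite hBt in E12.
  assert (E : (a1 ^ 2 + a2 ^ 2 + 1 - B) * s1 = 0) by lra.
  rewrite hA in E; lra. }
exists (s2 / B).
apply V_eq; cbn [vx vy vt vscal]; apply Rmult_eq_reg_l with B; try lra.
- transitivity (b1 * s1 - b2 * s2); [unfold s1, s2, B; ring|rewrite hs1; field; lra].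
- transitivity (b2 * s1 + b1 * s2); [unfold s1, s2, B; ring|rewrite hs1; field; lra].
- rewrite hBt, hs1; field; lra.
Qed.

(** * Hyperbolic elements and their axes *)

Lemma zero_lt1 : Cmod 0 < 1.
Proof. rewrite Cmod_0; lra. Qed.

Definition D0 : Disc := mkD 0 zero_lt1.

Lemma pt_D0 : pt D0 = mkV 0 0 1.
Proof. unfold pt, nrm; apply V_eq; simpl; field. Qed.

Lemma bo_det (s : R) : Cmod (RtoC (cosh s)) ^ 2 - Cmod (RtoC (sinh s)) ^ 2 = 1.
Proof.
rewrite !Cmod_sqr; simpl; unfold cosh, sinh.
pose proof (exp_plus s (- s)) as e; rewrite Rplus_opp_r, exp_0 in e; nra.
Qed.

(* The hyperbolic translation along the real diameter. *)
Definition bo (s : R) : aut := Aut _ _ (bo_det s).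

Lemma bo_add s t : mul (bo s) (bo t) = bo (s + t).
Proof.
apply aut_eq; apply injective_projections; simpl; unfold cosh, sinh;
  rewrite ?Ropp_plus_distr, ?exp_plus; field.
Qed.

Lemma bo_zero : bo 0 = one.
Proof.
apply aut_eq; apply injective_projections; simpl; unfold cosh, sinh;
  rewrite ?Ropp_0, ?exp_0; field.
Qed.

Lemma bo_inv s : inv (bo s) = bo (- s).
Proof.
apply aut_eq; apply injective_projections; simpl; unfold cosh, sinh;
  rewrite ?Ropp_involutive; field.
Qed.

Lemma cosh_sinh_sum s : cosh s + sinh s = exp s.
Proof. unfold cosh, sinh; field. Qed.

Lemma moebius_bo_1 s : moebius (bo s) 1%C = 1%C.
Proof.
unfold moebius; simpl.
assert (e : (Cconj (sinh s) * 1 + Cconj (cosh s))%C = RtoC (exp s)).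
{ rewrite <- (cosh_sinh_sum s); cring. }
assert (e' : (cosh s * 1 + sinh s)%C = RtoC (exp s)).
{ rewrite <- (cosh_sinh_sum s); cring. }
rewrite e, e'; field.
intros h; injection h; pose proof (exp_pos s); lra.
Qed.

Lemma moebius_bo_m1 s : moebius (bo s) (- 1)%C = (- 1)%C.
Proof.
unfold moebius; simpl.
assert (e0 : cosh s - sinh s = exp (- s)) by (unfold cosh, sinh; field).
assert (e : (Cconj (sinh s) * (- 1) + Cconj (cosh s))%C = RtoC (exp (- s))).
{ rewrite <- e0; cring. }
assert (e' : (cosh s * (- 1) + sinh s)%C = (- RtoC (exp (- s)))%C).
{ rewrite <- e0; cring. }
rewrite e, e'; field.
intros h; injection h; pose proof (exp_pos (- s)); lra.
Qed.

Lemma unit_sqrt (u : C) : fst u ^ 2 + snd u ^ 2 = 1 ->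
  exists k : C, fst k ^ 2 + snd k ^ 2 = 1 /\ (k * k)%C = u.
Proof.
destruct u as [c d]; cbn [fst snd]; intros h.
destruct (Req_dec c (-1)) as [e|e].
- exists (0, 1); simpl; split; [ring|].
  assert (d = 0) by (subst c; nra); subst; apply injective_projections; simpl; ring.
- assert (hc : 0 < 1 + c) by nra.
  (* The root is [(1 + u) / |1 + u|], with [|1 + u| ^ 2 = 2 * (1 + c)]; the point [-1] was treated
     apart. *)
  assert (hm : 0 < sqrt (2 * (1 + c))) by (apply sqrt_lt_R0; lra).
  pose proof (sqrt_sqrt (2 * (1 + c))) as hs; set (m := sqrt (2 * (1 + c))) in *.
  assert (hm2 : m ^ 2 = 2 * (1 + c)) by (rewrite <- hs by lra; ring).
  exists ((1 + c) / m, d / m); split; [|apply injective_projections]; simpl.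
  + transitivity (((1 + c) ^ 2 + d ^ 2) / m ^ 2); [field; lra|].
    rewrite hm2; replace (d ^ 2) with (1 - c ^ 2) by lra; field; lra.
  + transitivity (((1 + c) ^ 2 - d ^ 2) / m ^ 2); [field; lra|].
    rewrite hm2; replace (d ^ 2) with (1 - c ^ 2) by lra; field; lra.
  + transitivity (2 * (1 + c) * d / m ^ 2); [field; lra|].
    rewrite hm2; field; lra.
Qed.

Lemma trans_exists (z : Disc) : exists k : aut, act k D0 = z.
Proof.
pose proof (nrm_lt z) as hz.
assert (hm : 0 < sqrt (1 - nrm z)) by (apply sqrt_lt_R0; lra).
pose proof (sqrt_sqrt (1 - nrm z)) as hs.
set (m := sqrt (1 - nrm z)) in *.
assert (hd : Cmod (RtoC (/ m)) ^ 2 - Cmod (RtoC (/ m) * z)%C ^ 2 = 1).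
{ rewrite !Cmod_sqr; simpl.
  transitivity ((1 - nrm z) / (m * m)); [unfold nrm; field; lra|rewrite hs by lra; field; lra]. }
exists (Aut _ _ hd); apply Disc_eq; simpl; unfold moebius; simpl.
assert (e : (Cconj (RtoC (/ m) * z) * 0 + Cconj (RtoC (/ m)))%C = RtoC (/ m)) by cring.
rewrite e; field.
intros h; injection h; apply Rinv_neq_0_compat; lra.
Qed.

Lemma rot_det (k : C) : fst k ^ 2 + snd k ^ 2 = 1 -> Cmod k ^ 2 - Cmod 0 ^ 2 = 1.
Proof. intros h; rewrite Cmod_0, Cmod_sqr, h; ring. Qed.

Lemma sgn_eq_mul_l k g h : sgn_eq g h -> sgn_eq (mul k g) (mul k h).
Proof.
unfold sgn_eq; simpl; intros [[-> ->]|[-> ->]]; [left; auto|right; split; cring].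
Qed.

Lemma hyperbolic_sqr g : hyperbolic g <-> 1 < fst (ca g) ^ 2.
Proof.
unfold hyperbolic, abs_trace, Re; rewrite Rabs_mult, (Rabs_right 2) by lra.
rewrite <- (Rsqr_pow2 (fst (ca g))), (Rsqr_abs (fst (ca g))), Rsqr_pow2.
pose proof (Rabs_pos (fst (ca g))); split; nra.
Qed.

(** Any point of the axis can be the origin of the normal form. Moving [z] to [D0], the condition on
    [Nv] makes the diagonal entry real. Conjugation by a rotation [kp] multiplies [cb] by [kp]
    squared, so a square root of its direction makes [cb] real of the right sign. *)
Lemma hyperbolic_normal_form g z : hyperbolic g -> dot (pt z) (Nv g) = 0 ->
  exists h s, 0 < s /\ act h D0 = z /\ sgn_eq (mul g h) (mul h (bo s)).
Proof.
intros hg hz; destruct (trans_exists z) as [k hk].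
set (g' := mul (mul (inv k) g) k).
assert (hki : inv (inv k) = k) by (apply aut_eq; simpl; cring).
assert (hg' : g' = mul (mul (inv k) g) (inv (inv k))) by (rewrite hki; reflexivity).
assert (hkg : mul k g' = mul g k).
{ unfold g'; rewrite !mul_assoc, mul_inv_r, mul_one_l; reflexivity. }
clearbody g'.
assert (him : snd (ca g') = 0).
{ assert (E : dot (pt D0) (Nv g') = 0).
  { rewrite hg', Nv_conj, <- (lin_inv_l k (pt D0)), lin_dot, <- pt_act, hk; exact hz. }
  rewrite pt_D0 in E; unfold dot, Nv in E; simpl in E; lra. }
assert (hre : fst (ca g') = fst (ca g)) by (rewrite hg'; apply Re_conj).
apply hyperbolic_sqr in hg; rewrite <- hre in hg.
pose proof (aut_det' g') as hd; rewrite him in hd.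
set (be := fst (ca g')) in *.
set (b := cb g') in *.
assert (hS : 0 < sqrt (be ^ 2 - 1)) by (apply sqrt_lt_R0; lra).
pose proof (sqrt_sqrt (be ^ 2 - 1)) as hS2.
set (S := sqrt (be ^ 2 - 1)) in *.
assert (hb : fst b ^ 2 + snd b ^ 2 = S ^ 2) by (simpl in *; lra).
(* [eps] is the sign of the trace, which is invisible in PSU(1,1). *)
assert (heps : exists eps, eps * eps = 1 /\ 1 < eps * be).
{ destruct (Rle_or_lt 0 be); [exists 1|exists (-1)]; split; nra. }
destruct heps as (eps & he1 & he2).
destruct (unit_sqrt (eps * fst b / S, eps * snd b / S)) as (kp & hk1 & hk2).
{ simpl; transitivity ((eps * eps) * (fst b ^ 2 + snd b ^ 2) / S ^ 2); [field; lra|].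
  rewrite he1, hb; field; lra. }
set (rot := Aut kp 0 (rot_det kp hk1)).
set (s := ln (eps * be + S)).
assert (hexp : exp s = eps * be + S) by (unfold s; apply exp_ln; lra).
assert (hexp' : exp (- s) = eps * be - S).
{ rewrite exp_Ropp, hexp; apply Rmult_eq_reg_r with (eps * be + S); [|lra].
  rewrite Rinv_l by lra; transitivity ((eps * eps) * be ^ 2 - S * S); [rewrite he1, hS2 by lra; ring|ring]. }
exists (mul k rot), s; split; [|split].
- unfold s; rewrite <- ln_1; apply ln_increasing; lra.
- rewrite act_mul; replace (act rot D0) with D0; [exact hk|].
  apply Disc_eq; simpl; unfold moebius; simpl.
  replace (Cconj 0 * 0 + Cconj kp)%C with (Cconj kp) by cring.
  field; intros h0; assert (E : Cmod (Cconj kp) = 0) by (rewrite h0; apply Cmod_0).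
  rewrite Cmod_conj in E; pose proof (Cmod_sqr kp) as E2; rewrite E, hk1 in E2; lra.
- assert (E : mul g (mul k rot) = mul k (mul g' rot)).
  { rewrite !mul_assoc, hkg; reflexivity. }
  rewrite E, <- mul_assoc; apply sgn_eq_mul_l.
  assert (hkx : fst kp * fst kp - snd kp * snd kp = eps * fst b / S).
  { change (fst (kp * kp)%C = eps * fst b / S); rewrite hk2; reflexivity. }
  assert (hky : fst kp * snd kp + snd kp * fst kp = eps * snd b / S).
  { change (snd (kp * kp)%C = eps * snd b / S); rewrite hk2; reflexivity. }
  assert (hc : cosh s = eps * be) by (unfold cosh; rewrite hexp, hexp'; field).
  assert (hs : sinh s = S) by (unfold sinh; rewrite hexp, hexp'; field).
  assert (hbx : fst b = eps * S * (fst kp * fst kp - snd kp * snd kp)).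
  { rewrite hkx; transitivity ((eps * eps) * fst b); [rewrite he1; ring|field; lra]. }
  assert (hby : snd b = eps * S * (fst kp * snd kp + snd kp * fst kp)).
  { rewrite hky; transitivity ((eps * eps) * snd b); [rewrite he1; ring|field; lra]. }
  assert (hca : ca g' = (be, 0)) by (apply injective_projections; [reflexivity|exact him]).
  assert (hcb : cb g' = (fst b, snd b)) by (apply injective_projections; reflexivity).
  assert (main : ca (mul g' rot) = (RtoC eps * ca (mul rot (bo s)))%C /\
    cb (mul g' rot) = (RtoC eps * cb (mul rot (bo s)))%C).
  { simpl; rewrite hca, hcb, hc, hs, hbx, hby; destruct kp as [k1 k2]; simpl in *.
    split; apply injective_projections; simpl.
    - transitivity (be * k1); [ring|]; transitivity ((eps * eps) * (be * k1)); [rewrite he1; ring|ring].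
    - transitivity (be * k2); [ring|]; transitivity ((eps * eps) * (be * k2)); [rewrite he1; ring|ring].
    - transitivity (eps * S * k1 * (k1 * (k1 * 1) + k2 * (k2 * 1))); [ring|rewrite hk1; ring].
    - transitivity (eps * S * k2 * (k1 * (k1 * 1) + k2 * (k2 * 1))); [ring|rewrite hk1; ring]. }
  destruct main as [m1 m2].
  assert (heps : eps = 1 \/ eps = -1).
  { assert (E0 : (eps - 1) * (eps + 1) = 0) by lra.
    apply Rmult_integral in E0 as [|]; [left|right]; lra. }
  destruct heps as [h|h]; rewrite h in m1, m2; [left|right]; rewrite m1, m2; split; cring.
Qed.

Lemma moebius_inj h z w : Cmod z <= 1 -> Cmod w <= 1 -> moebius h z = moebius h w -> z = w.
Proof.
intros hz hw e.
assert (one_id : forall u, moebius one u = u).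
{ intros u; unfold moebius; simpl.
  replace (Cconj 0 * u + Cconj 1)%C with (RtoC 1) by cring; field. }
rewrite <- (one_id z), <- (one_id w), <- (mul_inv_l h), !moebius_mul, e by assumption; reflexivity.
Qed.

Lemma Cmod_m1 : Cmod (- 1)%C = 1.
Proof. rewrite Cmod_R, Rabs_left; lra. Qed.

Lemma fixed_boundary g h s w : sgn_eq (mul g h) (mul h (bo s)) -> Cmod w = 1 ->
  moebius (bo s) w = w -> moebius g (moebius h w) = moebius h w.
Proof.
intros hs hw hb; rewrite <- moebius_mul by lra.
rewrite (sgn_eq_moebius _ _ w hs), moebius_mul, hb by lra; reflexivity.
Qed.

Lemma geodesic_center h : geodesic (moebius h (- 1)%C) (moebius h 1%C) (act h D0).
Proof. exists h, D0; repeat split. Qed.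

Lemma axis_intro g z : hyperbolic g -> dot (pt z) (Nv g) = 0 -> axis g z.
Proof.
intros hg hz; destruct (hyperbolic_normal_form g z hg hz) as (h & s & hs & <- & e).
exists (moebius h (- 1)%C), (moebius h 1%C); repeat split.
- apply moebius_circle, Cmod_m1.
- apply moebius_circle, Cmod_1.
- intros hne; apply moebius_inj in hne; rewrite ?Cmod_m1, ?Cmod_1; try lra.
  injection hne; lra.
- apply (fixed_boundary g h s); [exact e|apply Cmod_m1|apply moebius_bo_m1].
- apply (fixed_boundary g h s); [exact e|apply Cmod_1|apply moebius_bo_1].
- apply geodesic_center.
Qed.

(** * End points of axes as limit points *)

Lemma moebius_den_lower (h : aut) (u : C) : Cmod u <= 1 ->
  / (Cmod (ca h) + Cmod (cb h)) <= Cmod (Cconj (cb h) * u + Cconj (ca h))%C.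
Proof.
intros hu; pose proof (aut_det h) as hd.
  assert (ht : Cmod (Cconj (ca h)) <= Cmod (Cconj (cb h) * u + Cconj (ca h))%C + Cmod (cb h)).
  { replace (Cconj (ca h)) with ((Cconj (cb h) * u + Cconj (ca h)) + - (Cconj (cb h) * u))%C at 1 by ring.
    apply Rle_trans with (1 := Cmod_triangle _ _); rewrite Cmod_opp, Cmod_mult, Cmod_conj.
    pose proof (Cmod_ge_0 (cb h)); nra. }
  rewrite Cmod_conj in ht; pose proof (Cmod_ge_0 (ca h)); pose proof (Cmod_ge_0 (cb h)).
  apply Rmult_le_reg_l with (Cmod (ca h) + Cmod (cb h)); [nra|].
  rewrite Rinv_r by nra. nra.
Qed.

(** The denominators have modulus at least [|ca h| - |cb h|], which equals [1 / (|ca h| + |cb h|)]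
    by the determinant condition. *)
Lemma moebius_lipschitz h z w : Cmod z <= 1 -> Cmod w <= 1 ->
  Cmod (moebius h z - moebius h w)%C <= (Cmod (ca h) + Cmod (cb h)) ^ 2 * Cmod (z - w)%C.
Proof.
intros hz hw; pose proof (aut_det h) as hd.
pose proof (moebius_den h z hz) as n1; pose proof (moebius_den h w hw) as n2.
pose proof (moebius_den_lower h z hz) as b1; pose proof (moebius_den_lower h w hw) as b2.
set (d1 := (Cconj (cb h) * z + Cconj (ca h))%C) in *.
set (d2 := (Cconj (cb h) * w + Cconj (ca h))%C) in *.
assert (hdc : (ca h * Cconj (ca h) - cb h * Cconj (cb h))%C = RtoC 1).
{ pose proof (aut_det' h) as e; apply injective_projections; simpl in *; lra. }
assert (E : (moebius h z - moebius h w)%C = ((z - w) / (d1 * d2))%C).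
{ unfold moebius; fold d1 d2.
  transitivity (((ca h * Cconj (ca h) - cb h * Cconj (cb h)) * (z - w)) / (d1 * d2))%C.
  - unfold d1, d2 in *; field; split; assumption.
  - rewrite hdc; field; split; assumption. }
rewrite E, Cmod_div, Cmod_mult by (apply Cmult_neq_0; assumption).
pose proof (Cmod_ge_0 (z - w)%C) as h0.
set (M := Cmod (ca h) + Cmod (cb h)) in *.
assert (hM : 0 < M) by (unfold M; pose proof (Cmod_ge_0 (ca h)); pose proof (Cmod_ge_0 (cb h)); nra).
assert (hMi : 0 < / M) by (apply Rinv_0_lt_compat; exact hM).

unfold Rdiv; apply Rle_trans with (/ (/ M * / M) * Cmod (z - w)%C).
- rewrite Rmult_comm; apply Rmult_le_compat_r; [exact h0|].
  apply Rinv_le_contravar; [apply Rmult_lt_0_compat; exact hMi|].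
  apply Rmult_le_compat; lra.
- right; field; lra.
Qed.

Fixpoint pw (g : aut) (n : nat) : aut :=
  match n with O => one | S n => mul g (pw g n) end.

Lemma pw_add g m n : pw g (m + n) = mul (pw g m) (pw g n).
Proof. induction m; simpl; [rewrite mul_one_l|rewrite IHm, mul_assoc]; reflexivity. Qed.

Lemma pw_in (G : aut -> Prop) g n : is_subgroup G -> G g -> G (pw g n).
Proof. intros (h1 & h2 & _) hg; induction n; simpl; auto. Qed.

Lemma cosh_ge1 r : 1 <= cosh r.
Proof.
unfold cosh; pose proof (exp_ineq1_le r); pose proof (exp_ineq1_le (- r)); lra.
Qed.

Lemma tanh_near e r : (e = 1 \/ e = -1) -> 0 <= e * r ->
  Cmod (act (bo r) D0 - RtoC e)%C <= / (1 + e * r).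
Proof.
intros he hr; pose proof (cosh_ge1 r) as hc.
assert (E : dval (act (bo r) D0) = RtoC (sinh r / cosh r)).
{ simpl; unfold moebius; simpl.
  replace (cosh r * 0 + sinh r)%C with (RtoC (sinh r)) by cring.
  replace (Cconj (sinh r) * 0 + Cconj (cosh r))%C with (RtoC (cosh r)) by cring.
  rewrite RtoC_div; [reflexivity|lra]. }
rewrite E, <- RtoC_minus, Cmod_R.
assert (E2 : Rabs (sinh r / cosh r - e) = exp (- (e * r)) / cosh r).
{ destruct he as [-> | ->].
  - rewrite Rabs_left1.
    + unfold cosh, sinh in *; rewrite Rmult_1_l; field; lra.
    + replace (sinh r / cosh r - 1) with (- (exp (- r) / cosh r)) by (unfold cosh, sinh in *; field; lra).
      assert (0 < exp (- r) / cosh r) by (apply Rdiv_lt_0_compat; [apply exp_pos|lra]); lra.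
  - rewrite Rabs_right.
    + replace (- (-1 * r)) with r by ring; unfold cosh, sinh in *; field; lra.
    + replace (sinh r / cosh r - -1) with (exp r / cosh r) by (unfold cosh, sinh in *; field; lra).
      assert (0 < exp r / cosh r) by (apply Rdiv_lt_0_compat; [apply exp_pos|lra]); lra. }
rewrite E2, exp_Ropp; pose proof (exp_ineq1_le (e * r)).
unfold Rdiv; rewrite <- Rinv_mult; apply Rinv_le_contravar; nra.
Qed.

Lemma pw_normal_form g h s n x : sgn_eq (mul g h) (mul h (bo s)) ->
  act (pw g n) (act h x) = act h (act (bo (INR n * s)) x).
Proof.
intros hs; induction n as [|n IH].
- simpl INR; rewrite Rmult_0_l, bo_zero; simpl pw; rewrite !act_one; reflexivity.
- simpl pw; rewrite act_mul, IH, <- act_mul, (sgn_eq_same _ _ hs), act_mul, S_INR, <- (act_mul (bo s)), bo_add.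
  do 3 f_equal; ring.
Qed.

(** Powers of [g] push [act h D0] to the end point selected by the sign of [s]; the other end point
    comes from [inv g], whose normal form has [- s]. *)
Lemma limit_point_axis (G : aut -> Prop) g h s e : is_subgroup G -> G g ->
  sgn_eq (mul g h) (mul h (bo s)) -> (e = 1 \/ e = -1) -> 0 < e * s ->
  limit_point G (moebius h (RtoC e)).
Proof.
intros hG hg hs he hes.
assert (he1 : Cmod (RtoC e) = 1) by (rewrite Cmod_R; destruct he as [-> | ->]; [apply Rabs_R1|rewrite Rabs_left; lra]).
split; [apply moebius_circle, he1|].
exists (act h D0); intros eps heps.
set (M := (Cmod (ca h) + Cmod (cb h)) ^ 2).
assert (hM : 0 <= M) by apply pow2_ge_0.
destruct (INR_unbounded ((M / eps + 1) / (e * s))) as [n hn].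
exists (pw g n); split; [apply pw_in; assumption|].
rewrite (pw_normal_form g h s n _ hs).
change (dval (act h (act (bo (INR n * s)) D0))) with (moebius h (act (bo (INR n * s)) D0)).
apply Rle_lt_trans with (1 := moebius_lipschitz h _ _ (Rlt_le _ _ (proj2_sig (act (bo (INR n * s)) D0))) (Req_le _ _ he1)).
fold M.
assert (hns : M / eps + 1 < e * (INR n * s)).
{ apply Rgt_lt, (Rmult_lt_compat_r (e * s) _ _ hes) in hn.
  replace ((M / eps + 1) / (e * s) * (e * s)) with (M / eps + 1) in hn by (unfold Rdiv; rewrite Rmult_assoc, Rinv_l; lra). lra. }
assert (hMe : 0 <= M / eps) by (apply Rmult_le_pos; [exact hM|left; apply Rinv_0_lt_compat, heps]).
pose proof (tanh_near e (INR n * s) he ltac:(lra)) as ht.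
apply Rle_lt_trans with (M * / (1 + e * (INR n * s))).
- apply Rmult_le_compat_l; assumption.
- apply Rmult_lt_reg_r with (1 + e * (INR n * s)); [lra|].
  rewrite Rmult_assoc, Rinv_l, Rmult_1_r by lra.
  replace M with (eps * (M / eps)) at 1 by (field; lra); nra.
Qed.

Lemma axis_limit_points (G : aut -> Prop) g z : is_subgroup G -> G g -> hyperbolic g ->
  dot (pt z) (Nv g) = 0 ->
  exists xi eta, limit_point G xi /\ limit_point G eta /\ xi <> eta /\ geodesic xi eta z.
Proof.
intros hG hg hh hz; destruct (hyperbolic_normal_form g z hh hz) as (h & s & hs & <- & e).
exists (moebius h (- 1)%C), (moebius h 1%C); split; [|split; [|split]].
- apply (limit_point_axis G (inv g) h (- s)); auto; try lra.
  + apply hG, hg.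
  + apply same_sgn_eq; intros z; rewrite !act_mul, <- bo_inv.
    rewrite <- (act_inv_r (bo s) z) at 1; rewrite <- (act_mul h), <- (sgn_eq_same _ _ e), act_mul, act_inv_l.
    reflexivity.
- apply (limit_point_axis G g h s); auto; lra.
- intros hne; apply moebius_inj in hne; rewrite ?Cmod_m1, ?Cmod_1; try lra.
  injection hne; lra.
- apply geodesic_center.
Qed.

(** * Geodesics, distance and convexity in the linear model *)

Definition nullv (w : C) : V := mkV (fst w) (snd w) 1.

Lemma lin_null g w : Cmod w = 1 -> exists k, 0 < k /\ lin g (nullv w) = vscal k (nullv (moebius g w)).
Proof.
intros hw; pose proof (moebius_den g w (Req_le _ _ hw)) as hd.
pose proof (aut_gap g w) as hg; rewrite hw in hg.
set (N := (ca g * w + cb g)%C) in *.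
set (D := (Cconj (cb g) * w + Cconj (ca g))%C) in *.
rewrite !Cmod_sqr in hg.
assert (hp : 0 < fst D ^ 2 + snd D ^ 2) by (rewrite <- Cmod_sqr; apply pow_lt, Cmod_gt_0, hd).
exists (fst D ^ 2 + snd D ^ 2); split; [exact hp|].
assert (e1 : moebius g w = ((fst N * fst D + snd N * snd D) / (fst D ^ 2 + snd D ^ 2),
  (snd N * fst D - fst N * snd D) / (fst D ^ 2 + snd D ^ 2))).
{ change (moebius g w) with (N / D)%C; clearbody N D; destruct N as [n1 n2], D as [d1 d2].
  unfold Cdiv, Cinv, Cmult; apply injective_projections; simpl in *; field; lra. }
assert (hD1 : fst D = fst (cb g) * fst w + snd (cb g) * snd w + fst (ca g)) by (unfold D; simpl; ring).
assert (hD2 : snd D = fst (cb g) * snd w - snd (cb g) * fst w - snd (ca g)) by (unfold D; simpl; ring).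
assert (hN1 : fst N = fst (ca g) * fst w - snd (ca g) * snd w + fst (cb g)) by (unfold N; simpl; ring).
assert (hN2 : snd N = fst (ca g) * snd w + snd (ca g) * fst w + snd (cb g)) by (unfold N; simpl; ring).
clearbody N D.
assert (hr : fst w ^ 2 = 1 - snd w ^ 2).
{ pose proof (Cmod_sqr w) as e; rewrite hw in e; lra. }
rewrite e1; apply V_eq; cbn [vx vy vt nullv lin vscal fst snd].
- transitivity (fst N * fst D + snd N * snd D); [|field; lra].
  rewrite hD1, hD2, hN1, hN2; ring_simplify; rewrite hr; ring.
- transitivity (snd N * fst D - fst N * snd D); [|field; lra].
  rewrite hD1, hD2, hN1, hN2; ring_simplify; rewrite hr; ring.
- transitivity (fst D ^ 2 + snd D ^ 2); [|ring].
  rewrite hD1, hD2; ring_simplify; rewrite hr; ring.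
Qed.

Lemma geodesic_comb xi eta u : geodesic xi eta u ->
  exists k l, 0 < k /\ 0 < l /\ pt u = vadd (vscal k (nullv xi)) (vscal l (nullv eta)).
Proof.
intros (g & t & <- & <- & ht & ->).
destruct (lin_null g (- 1)%C Cmod_m1) as (k & hk & ek).
destruct (lin_null g 1%C Cmod_1) as (l & hl & el).
pose proof (nrm_lt t) as hn; unfold nrm in hn.
unfold Im in ht; set (x := fst (dval t)) in *; rewrite ht in hn.
assert (hx : 0 < 1 - x ^ 2) by lra.
assert (x <> 1) by nra. assert (x <> -1) by nra.
(* On the real diameter the fractions are the coefficients of [pt t] in the null vectors of [-1] and
   [1]; [k] and [l] are the factors by which [lin g] rescales these. *)
exists ((1 - x) ^ 2 / (2 * (1 - x ^ 2)) * k), ((1 + x) ^ 2 / (2 * (1 - x ^ 2)) * l).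
split; [|split].
- apply Rmult_lt_0_compat; [apply Rdiv_lt_0_compat; nra|exact hk].
- apply Rmult_lt_0_compat; [apply Rdiv_lt_0_compat; nra|exact hl].
- assert (hs : forall a b v, vscal (a * b) v = vscal a (vscal b v)) by (intros; vring).
  rewrite !hs, <- ek, <- el, <- !lin_scal, <- lin_add, pt_act; f_equal.
  unfold pt, nrm; rewrite ht; fold x; apply V_eq; simpl; field; lra.
Qed.

(** Equivalently, [- dot (pt z) (pt w)] is the hyperbolic cosine of [rho z w]. *)
Lemma rho_ch z w :
  exp (rho z w) = - dot (pt z) (pt w) + sqrt (dot (pt z) (pt w) ^ 2 - 1).
Proof.
pose proof (nrm_lt z) as hz; pose proof (nrm_lt w) as hw.
unfold rho; set (n := Cmod (z - w)%C); set (d := Cmod (1 - Cconj w * z)%C).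
assert (hn : 0 <= n) by apply Cmod_ge_0. assert (hd : 0 <= d) by apply Cmod_ge_0.
assert (hm : d ^ 2 - n ^ 2 = (1 - nrm z) * (1 - nrm w)).
{ unfold d, n; rewrite !Cmod_sqr; unfold nrm; simpl; ring. }
assert (hmp : 0 < (1 - nrm z) * (1 - nrm w)) by (apply Rmult_lt_0_compat; lra).
set (m := (1 - nrm z) * (1 - nrm w)) in *.
assert (hdn : n < d) by nra.
rewrite exp_ln by (apply Rdiv_lt_0_compat; lra).
assert (hc : - dot (pt z) (pt w) = (d ^ 2 + n ^ 2) / m).
{ rewrite dot_pt; fold n m; replace (d ^ 2) with (m + n ^ 2) by lra; field; lra. }
assert (hs : sqrt (dot (pt z) (pt w) ^ 2 - 1) = 2 * d * n / m).
{ replace (dot (pt z) (pt w) ^ 2 - 1) with (Rsqr (2 * d * n / m)).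
  - apply sqrt_Rsqr; apply Rmult_le_pos; [nra|left; apply Rinv_0_lt_compat; lra].
  - replace (dot (pt z) (pt w) ^ 2) with ((- dot (pt z) (pt w)) ^ 2) by ring.
    rewrite hc; unfold Rsqr; rewrite <- hm; field; lra. }
rewrite hc, hs, <- hm; field; nra.
Qed.

Definition sh (z w : Disc) : R := sqrt (dot (pt z) (pt w) ^ 2 - 1).

Lemma sh_sqr z w : sh z w ^ 2 = dot (pt z) (pt w) ^ 2 - 1.
Proof.
unfold sh; apply pow2_sqrt; pose proof (in_H2_dot _ _ (pt_in_H2 z) (pt_in_H2 w)); nra.
Qed.

Lemma sh_pos z w : 0 <= sh z w.
Proof. apply sqrt_pos. Qed.

(** The addition formula for the hyperbolic cosine, [sh] being the hyperbolic sine of [rho]; it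
    makes betweenness algebraic. *)
Lemma rho_additive z u w : rho z u + rho u w = rho z w <->
  - dot (pt z) (pt w) = dot (pt z) (pt u) * dot (pt u) (pt w) + sh z u * sh u w.
Proof.
pose proof (rho_ch z u) as e1; pose proof (rho_ch u w) as e2; pose proof (rho_ch z w) as e3.
fold (sh z u) in e1; fold (sh u w) in e2; fold (sh z w) in e3.
pose proof (sh_sqr z u) as s1; pose proof (sh_sqr u w) as s2; pose proof (sh_sqr z w) as s3.
pose proof (sh_pos z u) as p1; pose proof (sh_pos u w) as p2; pose proof (sh_pos z w) as p3.
pose proof (in_H2_dot _ _ (pt_in_H2 z) (pt_in_H2 u)) as d1.
pose proof (in_H2_dot _ _ (pt_in_H2 u) (pt_in_H2 w)) as d2.
pose proof (in_H2_dot _ _ (pt_in_H2 z) (pt_in_H2 w)) as d3.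
set (c1 := dot (pt z) (pt u)) in *. set (c2 := dot (pt u) (pt w)) in *. set (c3 := dot (pt z) (pt w)) in *.
set (a1 := sh z u) in *. set (a2 := sh u w) in *. set (a3 := sh z w) in *.
split; intros h.
- assert (e4 : (- c1 + a1) * (- c2 + a2) = - c3 + a3) by (rewrite <- e1, <- e2, <- e3, <- h, exp_plus; reflexivity).
  assert (f1 : (- c1 - a1) * (- c2 - a2) * (- c3 + a3) = 1).
  { rewrite <- e4; transitivity ((c1 ^ 2 - a1 ^ 2) * (c2 ^ 2 - a2 ^ 2)); [ring|rewrite s1, s2; ring]. }
  assert (f2 : (- c3 - a3) * (- c3 + a3) = 1).
  { transitivity (c3 ^ 2 - a3 ^ 2); [ring|rewrite s3; ring]. }
  assert (f3 : (- c1 - a1) * (- c2 - a2) = - c3 - a3).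
  { apply Rmult_eq_reg_r with (- c3 + a3); lra. }
  lra.
- apply exp_inv; rewrite exp_plus, e1, e2, e3, h.
  assert (f : a3 = - (a1 * c2 + c1 * a2)).
  { apply Rsqr_inj; [exact p3|nra|].
    rewrite !Rsqr_pow2, s3; replace (c3 ^ 2) with ((- c3) ^ 2) by ring; rewrite h.
    transitivity ((c1 * c2 + a1 * a2) ^ 2 - (c1 ^ 2 - a1 ^ 2) * (c2 ^ 2 - a2 ^ 2)); [rewrite s1, s2; ring|ring]. }
  rewrite f; ring.
Qed.

Lemma null_orth_timelike u v : dot u u = -1 -> dot v v = 0 -> dot u v = 0 -> v = vzero.
Proof.
destruct u as [a b c], v as [x y t]; unfold dot; simpl; intros h1 h2 h3.
assert (hcs : (a * x + b * y) ^ 2 <= (a * a + b * b) * (x * x + y * y)).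
{ pose proof (pow2_ge_0 (a * y - b * x)); nra. }
assert (e1 : a * x + b * y = c * t) by lra. assert (e2 : a * a + b * b = c * c - 1) by lra.
assert (e3 : x * x + y * y = t * t) by lra.
rewrite e1, e2, e3 in hcs.
assert (t = 0) by nra. subst t. apply V_eq; simpl; nra.
Qed.

(** The difference of the two sides is a null vector orthogonal to the timelike [pt u], hence zero.
    The second clause covers the degenerate segment, where the first is empty. *)
Lemma rho_additive_comb z u w : rho z u + rho u w = rho z w ->
  vscal (sh z w) (pt u) = vadd (vscal (sh u w) (pt z)) (vscal (sh z u) (pt w)) /\
  (sh z w = 0 -> z = u).
Proof.
intros h; apply rho_additive in h.
pose proof (sh_sqr z u) as s1; pose proof (sh_sqr u w) as s2; pose proof (sh_sqr z w) as s3.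
pose proof (sh_pos z u) as p1; pose proof (sh_pos u w) as p2; pose proof (sh_pos z w) as p3.
pose proof (in_H2_dot _ _ (pt_in_H2 z) (pt_in_H2 u)) as d1.
pose proof (in_H2_dot _ _ (pt_in_H2 u) (pt_in_H2 w)) as d2.
assert (f : sh z w = - (sh z u * dot (pt u) (pt w) + dot (pt z) (pt u) * sh u w)).
{ apply Rsqr_inj; [exact p3|nra|].
  rewrite !Rsqr_pow2, s3; replace (dot (pt z) (pt w) ^ 2) with ((- dot (pt z) (pt w)) ^ 2) by ring; rewrite h.
  transitivity ((dot (pt z) (pt u) * dot (pt u) (pt w) + sh z u * sh u w) ^ 2
    - (dot (pt z) (pt u) ^ 2 - sh z u ^ 2) * (dot (pt u) (pt w) ^ 2 - sh u w ^ 2)); [rewrite s1, s2; ring|ring]. }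
assert (nz : dot (pt z) (pt z) = -1) by apply pt_in_H2.
assert (nu : dot (pt u) (pt u) = -1) by apply pt_in_H2.
assert (nw : dot (pt w) (pt w) = -1) by apply pt_in_H2.
assert (hw : dot (pt z) (pt w) = - (dot (pt z) (pt u) * dot (pt u) (pt w) + sh z u * sh u w)) by lra.
set (c1 := dot (pt z) (pt u)) in *. set (c2 := dot (pt u) (pt w)) in *.
set (a1 := sh z u) in *. set (a2 := sh u w) in *.
split.
- set (v := vadd (vscal (sh z w) (pt u)) (vadd (vscal (- a2) (pt z)) (vscal (- a1) (pt w)))).
  assert (hv : v = vzero).
  { apply (null_orth_timelike (pt u)); [exact nu| |].
    - unfold v; autorewrite with dot; rewrite (dot_comm (pt u) (pt z)), (dot_comm (pt w) (pt z)), (dot_comm (pt w) (pt u)).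
      fold c1 c2; rewrite nz, nu, nw, hw, f.
      transitivity (a1 ^ 2 * (c2 ^ 2 - a2 ^ 2 - 1) + a2 ^ 2 * (c1 ^ 2 - a1 ^ 2 - 1) + 0); [|rewrite s1, s2; ring].
      ring.
    - unfold v; autorewrite with dot; rewrite (dot_comm (pt u) (pt z)); fold c1 c2; rewrite nu, f; ring. }
  unfold v in hv; destruct (pt z), (pt u), (pt w); unfold vadd, vscal, vzero in *; simpl in *.
  injection hv; intros; f_equal; lra.
- intros h0; rewrite h0 in f.
  assert (a1 = 0) by nra.
  apply pt_inj, in_H2_dot_eq; try apply pt_in_H2; fold c1.
  rewrite H in s1; nra.
Qed.

Lemma rho_halfplane z u w v : rho z u + rho u w = rho z w ->
  dot (pt z) v <= 0 -> dot (pt w) v <= 0 -> dot (pt u) v <= 0.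
Proof.
intros h hz hw; destruct (rho_additive_comb z u w h) as [e e0].
pose proof (sh_pos z u); pose proof (sh_pos u w).
destruct (Req_dec (sh z w) 0) as [h0|h0]; [rewrite <- (e0 h0); exact hz|].
pose proof (sh_pos z w).
assert (E : sh z w * dot (pt u) v = sh u w * dot (pt z) v + sh z u * dot (pt w) v).
{ rewrite <- dot_scall, e; autorewrite with dot; reflexivity. }
assert (sh z w * dot (pt u) v <= 0) by nra.
assert (0 < sh z w) by lra. nra.
Qed.

Lemma rho_of_comb z u w a b r : 0 <= a -> 0 <= b -> 0 < r ->
  vscal r (pt u) = vadd (vscal a (pt z)) (vscal b (pt w)) -> rho z u + rho u w = rho z w.
Proof.
intros ha hb hr e; apply rho_additive.
assert (nz : dot (pt z) (pt z) = -1) by apply pt_in_H2.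
assert (nu : dot (pt u) (pt u) = -1) by apply pt_in_H2.
assert (nw : dot (pt w) (pt w) = -1) by apply pt_in_H2.
set (c := dot (pt z) (pt w)).
assert (e1 : r * dot (pt z) (pt u) = - a + b * c).
{ rewrite <- dot_scalr, e; autorewrite with dot; rewrite nz; unfold c; ring. }
assert (e2 : r * dot (pt u) (pt w) = a * c - b).
{ rewrite <- dot_scall, e; autorewrite with dot; rewrite nw; unfold c; ring. }
assert (e3 : r ^ 2 = a ^ 2 + b ^ 2 - 2 * a * b * c).
{ assert (E : dot (vscal r (pt u)) (vscal r (pt u)) = - r ^ 2) by (autorewrite with dot; rewrite nu; ring).
  rewrite e in E; autorewrite with dot in E; rewrite (dot_comm (pt w) (pt z)), nz, nw in E; fold c in E; lra. }
assert (s1 : r * sh z u = b * sh z w).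
{ apply Rsqr_inj; try (apply Rmult_le_pos; try apply sh_pos; lra).
  rewrite !Rsqr_pow2, !Rpow_mult_distr, !sh_sqr; fold c.
  transitivity ((r * dot (pt z) (pt u)) ^ 2 - r ^ 2); [ring|rewrite e1, e3; ring]. }
assert (s2 : r * sh u w = a * sh z w).
{ apply Rsqr_inj; try (apply Rmult_le_pos; try apply sh_pos; lra).
  rewrite !Rsqr_pow2, !Rpow_mult_distr, !sh_sqr; fold c.
  transitivity ((r * dot (pt u) (pt w)) ^ 2 - r ^ 2); [ring|rewrite e2, e3; ring]. }
apply Rmult_eq_reg_l with (r ^ 2); [|nra].
transitivity ((r * dot (pt z) (pt u)) * (r * dot (pt u) (pt w)) + (r * sh z u) * (r * sh u w)); [|ring].
rewrite e1, e2, s1, s2, e3.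
transitivity ((- a + b * c) * (a * c - b) + a * b * sh z w ^ 2); [rewrite sh_sqr; fold c; ring|ring].
Qed.

Lemma vscal_inv r v : r <> 0 -> vscal r (vscal (/ r) v) = v.
Proof. intros h; vfield; exact h. Qed.

(** Hyperbolic convexity becomes closure under addition of the cone over [K], the form required by
    [inK_hull]. *)
Lemma convex_add (K : Disc -> Prop) z w a b : hyp_convex K -> K z -> K w -> 0 < a -> 0 < b ->
  exists u r, 0 < r /\ K u /\ vadd (vscal a (pt z)) (vscal b (pt w)) = vscal r (pt u).
Proof.
intros hK hz hw ha hb.
set (v := vadd (vscal a (pt z)) (vscal b (pt w))).
destruct (pt_in_H2 z) as [nz tz]; destruct (pt_in_H2 w) as [nw tw].
pose proof (in_H2_dot _ _ (pt_in_H2 z) (pt_in_H2 w)) as d.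
assert (hn : dot v v < 0).
{ unfold v; autorewrite with dot; rewrite (dot_comm (pt w) (pt z)), nz, nw.
  set (e := dot (pt z) (pt w)) in *; clearbody e.
  assert (0 < a * b) by (apply Rmult_lt_0_compat; assumption).
  assert (a * b * e <= 0) by nra. nra. }
assert (ht : 0 < vt v) by (unfold v; cbn [vadd vscal vt]; nra).
assert (hr : 0 < sqrt (- dot v v)) by (apply sqrt_lt_R0; lra).
pose proof (sqrt_sqrt (- dot v v)) as hs; set (r := sqrt (- dot v v)) in *.
destruct (pt_surj (vscal (/ r) v)) as [u hu].
{ split.
  - autorewrite with dot; assert (E : dot v v = - (r * r)) by lra; rewrite E; field; lra.
  - cbn [vscal vt]; apply Rmult_lt_0_compat; [apply Rinv_0_lt_compat|]; assumption. }
assert (e : v = vscal r (pt u)) by (rewrite hu, vscal_inv; [reflexivity|lra]).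
exists u, r; split; [exact hr|split; [|exact e]].
apply (hK z w); try assumption.
apply (rho_of_comb z u w a b r); try lra; rewrite <- e; reflexivity.
Qed.

(** * Discrete free groups *)

Lemma pigeonhole {T : Type} (f : nat -> T) (L : list T) : (forall n, In (f n) L) ->
  exists m n, (m < n)%nat /\ f m = f n.
Proof.
intros hL; apply NNPP; intros hno.
assert (hinj : forall m n, f m = f n -> m = n).
{ intros m n e; destruct (Nat.lt_total m n) as [h|[h|h]]; [exfalso|exact h|exfalso];
    apply hno; eauto. }
assert (hnd : NoDup (map f (seq 0 (S (length L))))).
{ apply Injective_map_NoDup; [exact hinj|apply seq_NoDup]. }
apply NoDup_incl_length with (l' := L) in hnd.
- rewrite length_map, length_seq in hnd; lia.
- intros t ht; apply in_map_iff in ht as (n & <- & _); apply hL.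
Qed.

Definition cell (M d x : R) : nat := Z.to_nat (up ((x + M) / d)).

Lemma cell_bound M d : 0 < d -> exists N, forall x, Rabs x <= M -> In (cell M d x) (seq 0 N).
Proof.
intros hd; exists (S (Z.to_nat (up (2 * M / d) + 1))); intros x hx.
apply in_seq; split; [lia|]; unfold cell.
assert (hle : (x + M) / d <= 2 * M / d).
{ apply Rmult_le_compat_r; [left; apply Rinv_0_lt_compat, hd|].
  pose proof (Rle_abs x); lra. }
destruct (archimed ((x + M) / d)) as [_ h1]; destruct (archimed (2 * M / d)) as [h2 _].
assert (h3 : IZR (up ((x + M) / d)) < IZR (up (2 * M / d) + 1)) by (rewrite plus_IZR; lra).
apply lt_IZR in h3; lia.
Qed.

Lemma cell_close M d x y : 0 < d -> Rabs x <= M -> Rabs y <= M -> cell M d x = cell M d y ->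
  Rabs (x - y) < d.
Proof.
intros hd hx hy e; unfold cell in e.
assert (pos : forall u, Rabs u <= M -> 0 <= (u + M) / d).
{ intros u hu; apply Rmult_le_pos; [|left; apply Rinv_0_lt_compat, hd].
  pose proof (Rle_abs (- u)) as h; rewrite Rabs_Ropp in h; lra. }
pose proof (pos x hx) as px; pose proof (pos y hy) as py.
destruct (archimed ((x + M) / d)) as [h1 h2]; destruct (archimed ((y + M) / d)) as [h3 h4].
apply Z2Nat.inj in e; [|apply le_IZR; lra|apply le_IZR; lra].
rewrite e in h1, h2.
assert (h : Rabs ((x + M) / d - (y + M) / d) < 1) by (apply Rabs_def1; lra).
replace (x - y) with (((x + M) / d - (y + M) / d) * d) by (field; lra).
rewrite Rabs_mult, (Rabs_right d) by lra.
nra.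
Qed.

Lemma Cmod_close (z w : C) d : Rabs (fst z - fst w) < d -> Rabs (snd z - snd w) < d ->
  Cmod (z - w)%C < 2 * d.
Proof.
intros h1 h2; apply Rle_lt_trans with (Rabs (fst z - fst w) + Rabs (snd z - snd w)); [|lra].
apply Rsqr_incr_0_var.
- rewrite !Rsqr_pow2, Cmod_sqr; simpl fst; simpl snd.
  pose proof (Rabs_pos (fst z - fst w)); pose proof (Rabs_pos (snd z - snd w)).
  rewrite <- (Rsqr_pow2 (fst z + _)), <- (Rsqr_pow2 (snd z + _)), (Rsqr_abs (fst z + _)), (Rsqr_abs (snd z + _)).
  unfold Rsqr, Rminus in *; nra.
- pose proof (Rabs_pos (fst z - fst w)); pose proof (Rabs_pos (snd z - snd w)); lra.
Qed.

Lemma Rabs_fst_le (z : C) : Rabs (fst z) <= Cmod z.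
Proof. apply Rle_trans with (2 := Rmax_Cmod z); apply Rmax_l. Qed.

Lemma Rabs_snd_le (z : C) : Rabs (snd z) <= Cmod z.
Proof. apply Rle_trans with (2 := Rmax_Cmod z); apply Rmax_r. Qed.

(* Infinitely many elements in a bounded part of SU(1,1) accumulate, so two of
   them coincide in a discrete group. *)
Lemma discrete_repeat (G : aut -> Prop) (g : nat -> aut) M : is_fuchsian G ->
  (forall n, G (g n)) -> (forall n, Cmod (ca (g n)) <= M) ->
  exists m n, (m < n)%nat /\ same (g m) (g n).
Proof.
intros [(hone & hmul & hinv & hsame) (eps & heps & hdis)] hg hM.
assert (hbM : forall n, Cmod (cb (g n)) <= M).
{ intros n; pose proof (aut_det (g n)); pose proof (Cmod_ge_0 (ca (g n))); pose proof (Cmod_ge_0 (cb (g n))).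
  pose proof (hM n); nra. }
assert (hM1 : 1 <= M).
{ pose proof (aut_det (g 0%nat)); pose proof (Cmod_ge_0 (ca (g 0%nat))); pose proof (hM 0%nat).
  pose proof (pow2_ge_0 (Cmod (cb (g 0%nat)))); nra. }
(* Matrices with the same code have entries within [2 * d]. Each entry of [mul (inv (g m)) (g n)]
   then differs from that of the identity by two products of size at most [M * (2 * d)], a quarter
   of [eps]. *)
set (d := eps / (8 * M)).
assert (hd : 0 < d) by (apply Rdiv_lt_0_compat; lra).
destruct (cell_bound M d hd) as [N hN].
set (code := fun n => (cell M d (fst (ca (g n))), cell M d (snd (ca (g n))),
  cell M d (fst (cb (g n))), cell M d (snd (cb (g n))))).
destruct (pigeonhole code (list_prod (list_prod (list_prod (seq 0 N) (seq 0 N)) (seq 0 N)) (seq 0 N)))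
  as (m & n & hmn & e).
{ intros n; unfold code; repeat apply in_prod; apply hN;
  (eapply Rle_trans; [first [apply Rabs_fst_le|apply Rabs_snd_le]|auto]). }
exists m, n; split; [exact hmn|].
unfold code in e; injection e; intros e4 e3 e2 e1.
assert (hb : forall k, Rabs (fst (ca (g k))) <= M /\ Rabs (snd (ca (g k))) <= M /\
   Rabs (fst (cb (g k))) <= M /\ Rabs (snd (cb (g k))) <= M).
{ intros k; repeat split; (eapply Rle_trans; [first [apply Rabs_fst_le|apply Rabs_snd_le]|auto]). }
destruct (hb m) as (m1 & m2 & m3 & m4); destruct (hb n) as (n1 & n2 & n3 & n4).
assert (ha : Cmod (ca (g m) - ca (g n))%C < 2 * d) by (apply Cmod_close; apply cell_close with M; assumption).
assert (hbb : Cmod (cb (g m) - cb (g n))%C < 2 * d) by (apply Cmod_close; apply cell_close with M; assumption).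
assert (hcl : same (mul (inv (g m)) (g n)) one).
{ assert (bound : forall u v x y : C, Cmod u <= M -> Cmod v <= M -> Cmod x < 2 * d -> Cmod y < 2 * d ->
    Cmod (u * x + v * y)%C < eps).
  { intros u v x y hu hv hx hy; apply Rle_lt_trans with (1 := Cmod_triangle _ _); rewrite !Cmod_mult.
    assert (hed : eps = 4 * M * (2 * d)) by (unfold d; field; lra).
    pose proof (Cmod_ge_0 x); pose proof (Cmod_ge_0 y); pose proof (Cmod_ge_0 u); pose proof (Cmod_ge_0 v).
    assert (Cmod u * Cmod x <= M * (2 * d)) by (apply Rmult_le_compat; lra).
    assert (Cmod v * Cmod y <= M * (2 * d)) by (apply Rmult_le_compat; lra).
    assert (0 < M * (2 * d)) by (apply Rmult_lt_0_compat; lra). lra. }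
  pose proof (aut_det' (g m)) as hdm.
  apply hdis; [apply hmul; auto|..].
  - replace (ca (mul (inv (g m)) (g n)) - 1)%C with
      (- Cconj (ca (g m)) * (ca (g m) - ca (g n)) + cb (g m) * Cconj (cb (g m) - cb (g n)))%C.
    + apply bound; rewrite ?Cmod_opp, ?Cmod_conj; auto.
    + apply injective_projections; simpl; simpl in hdm; lra.
  - replace (cb (mul (inv (g m)) (g n))) with
      (- Cconj (ca (g m)) * (cb (g m) - cb (g n)) + cb (g m) * Cconj (ca (g m) - ca (g n)))%C.
    + apply bound; rewrite ?Cmod_opp, ?Cmod_conj; auto.
    + apply injective_projections; simpl; ring. }
intros z; pose proof (hcl z) as h; rewrite act_mul, act_one in h.
rewrite <- h at 1; apply act_inv_r.
Qed.

(** The hyperbolic cosine of the distance by which [g] moves the origin is [|ca g|^2 + |cb g|^2]; a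
    change of base points costs a bounded factor. Hence group elements moving a point boundedly are
    bounded matrices. *)
Lemma ca_bound (z w : Disc) : exists K, 0 < K /\
  forall g, Cmod (ca g) ^ 2 <= K * - dot (pt (act g z)) (pt w).
Proof.
assert (dom : forall u : Disc, exists k, 0 < k /\
  forall v, dot v v <= 0 -> 0 < vt v -> - dot (pt D0) v <= k * - dot (pt u) v).
{ intros u; destruct (pt_in_H2 u) as [nu tu].
  (* With [t = vt (pt u)], the factor [2 t] works because [4 t^2 (t^2 - 1) <= (2 t^2 - 1)^2]. *)
  exists (2 * vt (pt u)); split; [lra|]; intros v hv tv.
  rewrite pt_D0; destruct (pt u) as [x y t], v as [x' y' t']; unfold dot in *; simpl in *.
  assert (hcs : (x * x' + y * y') ^ 2 <= (t * t - 1) * (t' * t')).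
  { apply Rle_trans with ((x * x + y * y) * (x' * x' + y' * y')).
    - pose proof (pow2_ge_0 (x * y' - y * x')); nra.
    - apply Rmult_le_compat; nra. }
  assert (h : 2 * t * (x * x' + y * y') <= (2 * t * t - 1) * t').
  { apply Rsqr_incr_0_var; [|apply Rmult_le_pos; nra]; rewrite !Rsqr_pow2.
    apply Rle_trans with (4 * t ^ 2 * ((t * t - 1) * (t' * t'))); [nra|].
    assert (0 <= t' ^ 2) by apply pow2_ge_0. nra. }
  lra. }
destruct (dom z) as (k1 & p1 & h1); destruct (dom w) as (k2 & p2 & h2).
exists (k1 * k2); split; [nra|]; intros g.
assert (pz : in_H2 (lin g (pt D0))) by apply lin_in_H2, pt_in_H2.
assert (e : Cmod (ca g) ^ 2 <= - dot (lin g (pt D0)) (pt D0)).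
{ rewrite pt_D0, Cmod_sqr; unfold dot, lin; simpl.
  pose proof (pow2_ge_0 (fst (cb g))); pose proof (pow2_ge_0 (snd (cb g))); simpl in *; lra. }
apply Rle_trans with (1 := e).
apply Rle_trans with (k2 * - dot (lin g (pt D0)) (pt w)).
- rewrite !(dot_comm (lin g (pt D0))); apply h2; destruct pz; lra.
- rewrite (Rmult_comm k1), Rmult_assoc; apply Rmult_le_compat_l; [lra|].
  assert (q : forall u, dot (lin g u) (pt w) = dot u (lin (inv g) (pt w))).
  { intros u; rewrite <- (lin_inv_r g (pt w)) at 1; apply lin_dot. }
  rewrite pt_act, !q; apply h1; destruct (lin_in_H2 (inv g) _ (pt_in_H2 w)); lra.
Qed.

(** * Torsion in free groups *)

Section FreeWords.

Context (X Y : aut).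

Definition linv (c : bool * bool) : bool * bool := (fst c, negb (snd c)).
Notation E := (word_eval X Y).

Lemma linv_invol c : linv (linv c) = c.
Proof. destruct c as [x s]; unfold linv; simpl; rewrite negb_involutive; reflexivity. Qed.

Lemma letter_linv c z : act (letter X Y (linv c)) (act (letter X Y c) z) = z.
Proof.
destruct c as [x s]; unfold letter, linv; simpl; destruct s; simpl; [apply act_inv_r|apply act_inv_l].
Qed.

Lemma eval_cons c w z : act (E (c :: w)) z = act (letter X Y c) (act (E w) z).
Proof. apply act_mul. Qed.

Lemma eval_app w w' z : act (E (w ++ w')) z = act (E w) (act (E w') z).
Proof.
induction w as [|c w IH]; [symmetry; apply act_one|].
change ((c :: w) ++ w') with (c :: (w ++ w')); rewrite !eval_cons, IH; reflexivity.
Qed.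

Fixpoint red (w : list (bool * bool)) : Prop :=
  match w with
  | c :: ((d :: _) as t) => d <> linv c /\ red t
  | _ => True
  end.

Lemma red_reduced w : red w -> reduced w.
Proof.
intros h u v x s ->; induction u as [|c u IH].
- destruct h as [h _]; apply h; reflexivity.
- apply IH; destruct u; simpl in *; tauto.
Qed.

Lemma not_red w : ~ red w -> exists u v c, w = u ++ c :: linv c :: v.
Proof.
induction w as [|c w IH]; [simpl; tauto|].
destruct w as [|d w]; [simpl; tauto|intros h].
destruct (classic (d = linv c)) as [->|hd].
- exists [], w, c; reflexivity.
- destruct IH as (u & v & c' & e); [intros h'; apply h; split; assumption|].
  exists (c :: u), v, c'; rewrite e; reflexivity.
Qed.

Lemma red_app u c d v : red (u ++ [c]) -> red (d :: v) -> d <> linv c -> red ((u ++ [c]) ++ d :: v).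
Proof.
intros h1 h2 h3; induction u as [|a u IH]; [split; assumption|].
destruct u as [|b u]; simpl in h1 |- *.
- destruct h1 as [h1 _]; repeat split; try assumption.
- destruct h1 as [h1 h1']; split; [exact h1|apply IH, h1'].
Qed.

Fixpoint rep (w : list (bool * bool)) (k : nat) : list (bool * bool) :=
  match k with O => [] | S k => w ++ rep w k end.

Lemma red_rep w c t u d k : w = c :: t -> w = u ++ [d] -> c <> linv d -> red w ->
  red (rep w (S k)).
Proof.
intros e1 e2 hne hw; induction k as [|k IH]; [simpl; rewrite app_nil_r; exact hw|].
change (rep w (S (S k))) with (w ++ rep w (S k)).
assert (e : rep w (S k) = c :: (t ++ rep w k)) by (simpl; rewrite e1 at 1; reflexivity).
rewrite e in IH |- *; rewrite e2 at 1; apply red_app; [rewrite <- e2; exact hw|exact IH|exact hne].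
Qed.

Lemma eval_rep w k z : act (E (rep w k)) z = Nat.iter k (act (E w)) z.
Proof.
induction k as [|k IH]; [apply act_one|].
simpl; rewrite eval_app, IH; reflexivity.
Qed.

(** Cancelling an inverse pair, or conjugating away inverse end letters, shortens the word. A word
    that is also cyclically reduced has reduced powers, which cannot act trivially. *)
Lemma free_torsion_free : (forall w, reduced w -> w <> [] -> ~ same (E w) one) ->
  forall k w, (forall z, Nat.iter (S k) (act (E w)) z = z) -> forall z, act (E w) z = z.
Proof.
intros hfree k.
assert (main : forall n w, (length w <= n)%nat -> (forall z, Nat.iter (S k) (act (E w)) z = z) ->
  forall z, act (E w) z = z); [|intros w; apply (main (length w)); lia].
induction n as [|n IH]; intros w hn hw z.
{ destruct w; [apply act_one|simpl in hn; lia]. }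
destruct (classic (red w)) as [hr|hr].
- destruct w as [|c t]; [apply act_one|].
  destruct (exists_last (l := c :: t)) as (u & d & e); [discriminate|].
  destruct (classic (c = linv d)) as [hc|hc].
  + destruct u as [|c' u].
    { simpl in e; injection e; intros -> ->; exfalso.
      destruct d as [x s]; unfold linv in hc; simpl in hc; injection hc; destruct s; discriminate. }
    simpl in e; injection e; intros et <-.
    assert (conj : forall z, act (E (c :: t)) z = act (letter X Y c) (act (E u) (act (letter X Y d) z))).
    { intros y; rewrite eval_cons, et, eval_app; do 2 f_equal; rewrite eval_cons.
      f_equal; apply act_one. }
    assert (cd : forall y, act (letter X Y c) (act (letter X Y d) y) = y) by (intros y; rewrite hc; apply letter_linv).
    assert (dc : forall y, act (letter X Y d) (act (letter X Y c) y) = y).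
    { intros y; assert (hd : d = linv c) by (rewrite hc, linv_invol; reflexivity).
      rewrite hd; apply letter_linv. }
    assert (it : forall m y, Nat.iter m (act (E (c :: t))) y
       = act (letter X Y c) (Nat.iter m (act (E u)) (act (letter X Y d) y))).
    { induction m as [|m IHm]; intros y; simpl Nat.iter; [rewrite cd; reflexivity|].
      rewrite conj, IHm, dc; reflexivity. }
    assert (hu : forall y, act (E u) y = y).
    { apply IH.
      - rewrite et in hn; simpl in hn; rewrite length_app in hn; simpl in hn; lia.
      - intros y; rewrite <- (dc (Nat.iter (S k) (act (E u)) y)).
        rewrite <- (dc y) at 1; rewrite <- it, hw, dc; reflexivity. }
    rewrite conj, hu; apply cd.
  + exfalso; apply (hfree (rep (c :: t) (S k))).
    * apply red_reduced; apply (red_rep _ c t u d k); auto.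
    * discriminate.
    * intros y; rewrite eval_rep, hw, act_one; reflexivity.
- destruct (not_red w hr) as (u & v & c & e).
  assert (hE : forall y, act (E w) y = act (E (u ++ v)) y).
  { intros y; rewrite e, !eval_app, !eval_cons; f_equal.
    rewrite <- (linv_invol c) at 1; apply letter_linv. }
  rewrite hE; apply IH.
  + rewrite e in hn; rewrite length_app in *; simpl in hn; lia.
  + intros y; rewrite <- (hw y) at 2. clear -hE.
    induction (S k) as [|m IHm]; simpl; [reflexivity|rewrite IHm, hE; reflexivity].
Qed.

Lemma generated_word g : generated [X; Y] g -> exists w, forall z, act g z = act (E w) z.
Proof.
assert (winv : forall w, exists w', forall z, act (E w') (act (E w) z) = z).
{ induction w as [|c w (w' & h)].
  - exists []; intros z; rewrite !act_one; reflexivity.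
  - exists (w' ++ [linv c]); intros z; rewrite eval_app, eval_cons, (eval_cons c).
    change (E []) with one; rewrite act_one, letter_linv; apply h. }
induction 1 as [g hg| |g h _ [w1 h1] _ [w2 h2]|g _ [w h]|g h hs _ [w hw]].
- destruct hg as [<-|[<-|[]]]; [exists [(false, false)]|exists [(true, false)]];
    intros z; rewrite eval_cons; change (E []) with one; rewrite act_one; reflexivity.
- exists []; reflexivity.
- exists (w1 ++ w2); intros z; rewrite act_mul, h2, h1, eval_app; reflexivity.
- destruct (winv w) as [w' h']; exists w'; intros z.
  rewrite <- (h' (act (inv g) z)), <- h, act_inv_r; reflexivity.
- exists w; intros z; rewrite <- hs; apply hw.
Qed.

End FreeWords.

Lemma pw_iter g k z : act (pw g k) z = Nat.iter k (act g) z.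
Proof. induction k; simpl; [apply act_one|rewrite act_mul, IHk; reflexivity]. Qed.

(** The powers of an element with a fixed point are bounded matrices by [ca_bound], so discreteness
    makes two of them agree: the element has finite order, and a free group has no torsion. *)
Lemma free_fuchsian_acts_freely (G : aut -> Prop) :
  is_fuchsian G -> is_free_of_rank_two G -> acts_freely G.
Proof.
intros hG (X & Y & hgen & hfree) g z hg hz.
destruct (ca_bound z z) as (K & hK & hb).
destruct (discrete_repeat G (pw g) (1 + K) hG) as (m & n & hmn & hs).
- intros n; apply pw_in; [apply hG|exact hg].
- intros n; specialize (hb (pw g n)).
  assert (e : act (pw g n) z = z) by (rewrite pw_iter; clear -hz; induction n; simpl; [|rewrite IHn]; auto).
  rewrite e, (proj1 (pt_in_H2 z)) in hb.
  pose proof (Cmod_ge_0 (ca (pw g n))); nra.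
- destruct (generated_word X Y g) as [w hw]; [apply hgen, hg|].
  intros y; rewrite act_one, hw.
  (* The exponent is taken as a successor; [m < n] makes [S (n - m - 1)] equal to [n - m]. *)
  apply (free_torsion_free X Y hfree (n - m - 1)).
  intros x; replace (S (n - m - 1)) with (n - m)%nat by lia.
  assert (e : forall k y, Nat.iter k (act (word_eval X Y w)) y = act (pw g k) y).
  { intros k y'; rewrite pw_iter; induction k as [|k IH]; simpl; [reflexivity|rewrite IH, hw; reflexivity]. }
  rewrite e.
  rewrite <- (act_inv_l (pw g m) (act (pw g (n - m)) x)), <- (act_mul (pw g m)), <- pw_add.
  replace (m + (n - m))%nat with n by lia; rewrite <- hs; apply act_inv_l.
Qed.

(** * Reflections of the disc *)

Definition cj (v : V) : V := mkV (vx v) (- vy v) (vt v).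

Lemma pt_conjD z : pt (conjD z) = cj (pt z).
Proof.
assert (e : nrm (conjD z) = nrm z) by (unfold nrm; simpl; ring).
unfold pt; rewrite e; apply V_eq; simpl; pose proof (nrm_lt z); field; lra.
Qed.

(** A linear isometry fixing the plane orthogonal to [n] pointwise sends [n] to [n] or [- n]; the
    first would make it the identity, which is not anticonformal. *)
Lemma reflection_refl (L : Disc -> Prop) (r : Disc -> Disc) (n : V) :
  is_reflection_in L r -> 0 < dot n n -> (forall z, dot (pt z) n = 0 -> L z) ->
  forall z, pt (r z) = refl n (pt z).
Proof.
intros [[s hs] hfix] hn hL.
set (M := fun v => lin s (cj v)).
assert (hM : linear_map M).
{ split; intros; unfold M; [rewrite <- lin_add|rewrite <- lin_scal]; f_equal; unfold cj; vring. }
assert (hMpt : forall z, pt (r z) = M (pt z)) by (intros z; rewrite hs, pt_act, pt_conjD; reflexivity).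
assert (hMdot : forall v w, dot (M v) (M w) = dot v w).
{ intros v w; unfold M; rewrite lin_dot; unfold dot, cj; simpl; ring. }
assert (hplane : forall u, in_H2 u -> dot u n = 0 -> M u = u).
{ intros u hu h0; destruct (pt_surj u hu) as [z <-]; rewrite <- hMpt, hfix; [reflexivity|apply hL, h0]. }
destruct hM as [Madd Mscal].
assert (ho : exists o, in_H2 o /\ dot o n = 0).
{ set (e := mkV 0 0 1). set (o := vadd e (vscal (- (dot e n / dot n n)) n)).
  assert (h1 : dot o n = 0) by (unfold o; autorewrite with dot; field; lra).
  assert (h2 : dot o o = -1 - dot e n ^ 2 / dot n n).
  { unfold o; autorewrite with dot; rewrite (dot_comm n e); replace (dot e e) with (-1) by (unfold dot, e; simpl; ring).
    field; lra. }
  assert (h3 : 0 <= dot e n ^ 2 / dot n n) by (apply Rmult_le_pos; [apply pow2_ge_0|left; apply Rinv_0_lt_compat; lra]).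
  assert (ht : 0 < vt o).
  { replace (vt o) with (- dot e o) by (unfold dot, e; simpl; ring).
    unfold o at 1; autorewrite with dot; replace (dot e e) with (-1) by (unfold dot, e; simpl; ring).
    replace (- (dot e n / dot n n) * dot e n) with (- (dot e n ^ 2 / dot n n)) by (field; lra). lra. }
  assert (hr : 0 < sqrt (- dot o o)) by (apply sqrt_lt_R0; lra).
  pose proof (sqrt_sqrt (- dot o o)) as hs2; set (m := sqrt (- dot o o)) in *.
  exists (vscal (/ m) o); split; [split|].
  - autorewrite with dot; assert (E : dot o o = - (m * m)) by lra; rewrite E; field; lra.
  - cbn [vscal vt]; apply Rmult_lt_0_compat; [apply Rinv_0_lt_compat|]; assumption.
  - autorewrite with dot; rewrite h1; ring. }
destruct ho as (o & [no to] & ho).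
assert (hperp : forall v, dot v n = 0 -> M v = v).
{ intros v hv.
  (* Large enough for [v + k o] to be timelike and future pointing, so that a multiple of it is a
     point of the geodesic. *)
  set (k := 1 + Rabs (dot v v) + 2 * Rabs (dot o v)).
  set (u := vadd v (vscal k o)).
  pose proof (Rabs_pos (dot v v)) as a1; pose proof (Rabs_pos (dot o v)) as a2.
  pose proof (Rle_abs (dot v v)) as b1; pose proof (Rle_abs (dot o v)) as b2.
  assert (hu1 : dot u u < 0).
  { unfold u; autorewrite with dot; rewrite (dot_comm v o), no.
    set (x := dot o v) in *; set (y := dot v v) in *; unfold k in *; nra. }
  assert (hu2 : 0 < vt u).
  { apply (future_of_dot o); try lra; unfold u; autorewrite with dot; rewrite no; unfold k; lra. }
  assert (hu3 : dot u n = 0) by (unfold u; autorewrite with dot; rewrite hv, ho; ring).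
  assert (hr : 0 < sqrt (- dot u u)) by (apply sqrt_lt_R0; lra).
  pose proof (sqrt_sqrt (- dot u u)) as hs2; set (m := sqrt (- dot u u)) in *.
  assert (hMu : M (vscal (/ m) u) = vscal (/ m) u).
  { apply hplane.
    - split.
      + autorewrite with dot; assert (E : dot u u = - (m * m)) by lra; rewrite E; field; lra.
      + cbn [vscal vt]; apply Rmult_lt_0_compat; [apply Rinv_0_lt_compat|]; assumption.
    - autorewrite with dot; rewrite hu3; ring. }
  assert (hMu' : M u = u).
  { rewrite <- (vscal_inv m u) at 1 by lra; rewrite Mscal, hMu, vscal_inv; [reflexivity|lra]. }
  assert (hMo : M o = o) by (apply hplane; [split; assumption|exact ho]).
  unfold u in hMu'; rewrite Madd, Mscal, hMo in hMu'.
  destruct (M v), v, o; unfold vadd, vscal in hMu'; simpl in hMu'; injection hMu'; intros; f_equal; lra. }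
set (k := dot (M n) n / dot n n).
assert (hMn : M n = vscal k n).
{ set (w := vadd (M n) (vscal (- k) n)).
  assert (hwn : dot w n = 0) by (unfold w, k; autorewrite with dot; field; lra).
  assert (hw : forall v, dot v n = 0 -> dot w v = 0).
  { intros v hv; unfold w; autorewrite with dot; rewrite (dot_comm n v), hv.
    rewrite <- (hperp v hv), hMdot, dot_comm, hv; ring. }
  assert (hw0 : w = vzero).
  { apply (null_orth_timelike o); [exact no|apply hw, hwn|rewrite dot_comm; apply hw, ho]. }
  unfold w in hw0; destruct (M n), n; unfold vadd, vscal, vzero in *; simpl in *; injection hw0; intros; f_equal; lra. }
assert (hk : k * k = 1).
{ assert (e : dot (M n) (M n) = dot n n) by apply hMdot.
  rewrite hMn in e; autorewrite with dot in e.
  apply Rmult_eq_reg_r with (dot n n); lra. }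
assert (hMv : forall v, M v = vadd v (vscal ((k - 1) * (dot v n / dot n n)) n)).
{ intros v; set (c := dot v n / dot n n).
  assert (e : v = vadd (vadd v (vscal (- c) n)) (vscal c n)) by vring.
  rewrite e at 1; rewrite Madd, Mscal, hMn, hperp.
  - vring.
  - autorewrite with dot; unfold c; field; lra. }
assert (hk1 : k = -1).
{ assert (E0 : (k - 1) * (k + 1) = 0) by lra.
  apply Rmult_integral in E0 as [h|h]; [exfalso|lra].
  assert (hid : forall v, M v = v) by (intros v; rewrite hMv, h; vring).
  pose proof (hid (mkV 1 0 0)) as e1; pose proof (hid (mkV 0 1 0)) as e2; pose proof (hid (mkV 0 0 1)) as e3.
  pose proof (aut_det' s) as hd.
  unfold M, lin, cj in e1, e2, e3; simpl in *; injection e1; injection e2; injection e3; intros.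
  pose proof (pow2_ge_0 (snd (cb s))) as hb; simpl in hb; nra. }
intros z; rewrite hMpt, hMv, hk1; unfold refl; f_equal; f_equal; field; lra.
Qed.

(** * Continuity estimates and the quotient map *)

Lemma near_identity (z : Disc) d : 0 < d -> exists eps, 0 < eps /\
  forall g, Cmod (ca g - 1)%C < eps -> Cmod (cb g) < eps -> Cmod (act g z - z)%C < d.
Proof.
(* If the entries are within [e] of those of the identity, the denominator is at least 1/2 once
   [e <= / 4], and the numerator is below [4 * e]. *)
intros hd; exists (Rmin (/ 4) (d / 8)).
assert (h0 : 0 < Rmin (/ 4) (d / 8)) by (apply Rmin_glb_lt; lra).
pose proof (Rmin_l (/ 4) (d / 8)); pose proof (Rmin_r (/ 4) (d / 8)).
set (e := Rmin (/ 4) (d / 8)) in *.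
split; [exact h0|]; intros g ha hb.
pose proof (proj2_sig z) as hz; simpl in hz; fold (dval z) in hz.
pose proof (moebius_den g z (Rlt_le _ _ hz)) as hn.
change (dval (act g z)) with (moebius g z).
set (D := (Cconj (cb g) * z + Cconj (ca g))%C) in *.
assert (E : (moebius g z - z)%C =
  ((((ca g - 1) + - Cconj (ca g - 1)) * z + (cb g + - (Cconj (cb g) * (z * z)))) / D)%C).
{ transitivity ((ca g * z + cb g - D * z) / D)%C.
  - unfold moebius; fold D; field; exact hn.
  - f_equal; unfold D; cring. }
rewrite E, Cmod_div by exact hn.
assert (hD : / 2 <= Cmod D).
{ assert (ht : Cmod 1 <= Cmod D + Cmod (Cconj (cb g) * z + Cconj (ca g - 1))%C).
  { replace (RtoC 1) with (D + - (Cconj (cb g) * z + Cconj (ca g - 1)))%C at 1 by (unfold D; cring).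
    apply Rle_trans with (1 := Cmod_triangle _ _); rewrite Cmod_opp; lra. }
  pose proof (Cmod_triangle (Cconj (cb g) * z) (Cconj (ca g - 1))) as ht2.
  rewrite Cmod_mult, !Cmod_conj in ht2; rewrite Cmod_1 in ht.
  pose proof (Cmod_ge_0 (cb g)); pose proof (Cmod_ge_0 z).
  assert (Cmod (cb g) * Cmod z <= e * 1) by (apply Rmult_le_compat; lra). lra. }
assert (hN : Cmod (((ca g - 1) + - Cconj (ca g - 1)) * z + (cb g + - (Cconj (cb g) * (z * z))))%C < 4 * e).
{ apply Rle_lt_trans with (1 := Cmod_triangle _ _); rewrite Cmod_mult.
  pose proof (Cmod_triangle (ca g - 1) (- Cconj (ca g - 1))) as t1.
  pose proof (Cmod_triangle (cb g) (- (Cconj (cb g) * (z * z)))) as t2.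
  rewrite Cmod_opp, Cmod_conj in t1; rewrite Cmod_opp, !Cmod_mult, Cmod_conj in t2.
  pose proof (Cmod_ge_0 (cb g)); pose proof (Cmod_ge_0 z); pose proof (Cmod_ge_0 (ca g - 1)%C).
  pose proof (Cmod_ge_0 ((ca g - 1) + - Cconj (ca g - 1))%C).
  assert (Cmod (cb g) * (Cmod z * Cmod z) <= Cmod (cb g) * 1) by (apply Rmult_le_compat_l; nra).
  assert (Cmod ((ca g - 1) + - Cconj (ca g - 1))%C * Cmod z <= (2 * Cmod (ca g - 1)) * 1) by (apply Rmult_le_compat; lra).
  lra. }
apply Rlt_div_l; [apply Rlt_gt; lra|nra].
Qed.

Lemma dot_near (z : Disc) d : 0 < d -> exists r, 0 < r /\
  forall w : Disc, Cmod (w - z)%C < r -> dot (pt z) (pt w) ^ 2 < 1 + d.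
Proof.
intros hd; pose proof (proj2_sig z) as hz; simpl in hz; fold (dval z) in hz.
pose proof (Cmod_ge_0 z) as hz0.
set (m := (1 - Cmod z) / 2). assert (hm : 0 < m) by (unfold m; lra).
set (d' := Rmin 1 d). assert (hd' : 0 < d') by (apply Rmin_glb_lt; lra).
assert (hd1 : d' <= 1) by apply Rmin_l. assert (hd2 : d' <= d) by apply Rmin_r.
exists (m * d' / 12).
assert (hr : 0 < m * d' / 12) by (apply Rdiv_lt_0_compat; nra).
split; [exact hr|]; intros w hw.
assert (hwm : m <= 1 - Cmod w).
{ assert (ht : Cmod w <= Cmod (w - z)%C + Cmod z).
  { replace (dval w) with ((w - z) + z)%C at 1 by ring; apply Cmod_triangle. }
  assert (m * d' <= m) by nra. unfold m in *; lra. }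
assert (nz : m <= 1 - nrm z).
{ unfold nrm; rewrite <- Cmod_sqr; unfold m in *; nra. }
assert (nw : m <= 1 - nrm w).
{ unfold nrm; rewrite <- Cmod_sqr; pose proof (Cmod_ge_0 w); nra. }
rewrite dot_pt; set (r := Cmod (w - z)%C) in *.
assert (hr0 : Cmod (z - w)%C = r).
{ unfold r; replace (z - w)%C with (- (w - z))%C by ring; apply Cmod_opp. }
assert (hr1 : 0 <= r) by apply Cmod_ge_0.
rewrite hr0; set (t := 2 * r ^ 2 / ((1 - nrm z) * (1 - nrm w))).
assert (ht0 : 0 <= t).
{ apply Rmult_le_pos; [nra|left; apply Rinv_0_lt_compat; nra]. }
assert (ht1 : t <= d' / 6).
{ unfold t; apply Rle_div_l; [apply Rlt_gt; nra|].
  assert (m * m <= (1 - nrm z) * (1 - nrm w)) by (apply Rmult_le_compat; lra).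
  assert (r ^ 2 <= (m * d' / 12) * (m * 1 / 12)).
  { simpl; rewrite Rmult_1_r; apply Rmult_le_compat; try lra. nra. }
  nra. }
nra.
Qed.

Lemma proj_eq (G : aut -> Prop) z w : is_subgroup G -> (proj G z = proj G w <-> orbit G z w).
Proof.
intros (h1 & h2 & h3 & _); split.
- intros e; apply (f_equal (@proj1_sig _ _)) in e; simpl in e; rewrite e.
  exists one; split; [exact h1|symmetry; apply act_one].
- intros (g & hg & ->).
  assert (e : orbit G z = orbit G (act g z)).
  { apply functional_extensionality; intros x; apply propositional_extensionality; split.
    - intros (g' & hg' & ->); exists (mul g' (inv g)); split; [auto|].
      rewrite act_mul, act_inv_l; reflexivity.
    - intros (g' & hg' & ->); exists (mul g' g); split; [auto|].
      symmetry; apply act_mul. }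
  unfold proj.
  generalize (ex_intro (fun z0 => orbit G z = orbit G z0) z eq_refl)
    (ex_intro (fun z0 => orbit G (act g z) = orbit G z0) (act g z) eq_refl).
  rewrite <- e; intros; f_equal; apply proof_irrelevance.
Qed.

Lemma proj_surj (G : aut -> Prop) (x : surface G) : exists z, x = proj G z.
Proof.
destruct x as [X [z ->]]; exists z; unfold proj; f_equal; apply proof_irrelevance.
Qed.

Lemma moebius_ex_derive g (z : C) : Cmod z < 1 ->
  @ex_derive C_AbsRing (AbsRing_NormedModule C_AbsRing) (moebius g) z.
Proof.
intros hz; pose proof (moebius_den g z (Rlt_le _ _ hz)) as dz.
set (den := fun u : C => (Cconj (cb g) * u + Cconj (ca g))%C) in *.
change ((den z) <> 0) in dz.
exists (/ (den z * den z))%C.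
split; [apply is_linear_scal_l|].
intros x hx; pose proof (@is_filter_lim_locally_unique C_AbsRing (AbsRing_NormedModule C_AbsRing) z x hx) as e0; subst x.
intros [eps heps]; simpl.
set (M := Cmod (ca g) + Cmod (cb g)).
pose proof (aut_det g) as hd; pose proof (Cmod_ge_0 (ca g)) as ha; pose proof (Cmod_ge_0 (cb g)) as hb.
assert (hM : 0 < M) by (unfold M; nra).
set (L := Cmod (cb g) * M * M * M + 1).
assert (hL : 0 < L) by (unfold L; assert (0 <= Cmod (cb g) * M * M * M) by (repeat apply Rmult_le_pos; lra); lra).
assert (hr : 0 < Rmin (1 - Cmod z) (eps / L)) by (apply Rmin_glb_lt; [lra|apply Rdiv_lt_0_compat; lra]).
exists (mkposreal _ hr); intros y hy.
change (Cmod (y - z)%C < Rmin (1 - Cmod z) (eps / L)) in hy.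
change (Cmod ((moebius g y - moebius g z) - (y - z) * / (den z * den z))%C <= eps * Cmod (y - z)%C).
pose proof (Rmin_l (1 - Cmod z) (eps / L)); pose proof (Rmin_r (1 - Cmod z) (eps / L)).
assert (hy1 : Cmod y <= 1).
{ assert (ht : Cmod y <= Cmod (y - z)%C + Cmod z); [|lra].
  replace y with ((y - z) + z)%C at 1 by ring; apply Cmod_triangle. }
pose proof (moebius_den g y hy1) as dy; change (den y <> 0) in dy.
(* The remainder is quadratic in [y - z], and [L] bounds its coefficient. *)
assert (E : ((moebius g y - moebius g z) - (y - z) * / (den z * den z))%C
  = (- ((y - z) * (y - z) * Cconj (cb g)) / (den y * den z * den z))%C).
{ assert (hdc : (ca g * Cconj (ca g) - cb g * Cconj (cb g))%C = RtoC 1).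
  { pose proof (aut_det' g) as e; apply injective_projections; simpl in *; lra. }
  assert (E1 : (moebius g y - moebius g z)%C = ((y - z) / (den y * den z))%C).
  { unfold moebius; fold (den y) (den z).
    transitivity (((ca g * Cconj (ca g) - cb g * Cconj (cb g)) * (y - z)) / (den y * den z))%C.
    - unfold den in *; field; split; assumption.
    - rewrite hdc; field; split; assumption. }
  rewrite E1; unfold den in *; field; split; assumption. }
assert (inv_le : forall u, Cmod u <= 1 -> Cmod (/ den u)%C <= M).
{ intros u hu; pose proof (moebius_den g u hu) as du; change (den u <> 0) in du.
  pose proof (moebius_den_lower g u hu) as hl; fold M in hl; fold (den u) in hl.
  rewrite Cmod_inv by exact du; rewrite <- (Rinv_inv M).
  apply Rinv_le_contravar; [apply Rinv_0_lt_compat, hM|exact hl]. }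
pose proof (inv_le y hy1) as iy; pose proof (inv_le z (Rlt_le _ _ hz)) as iz.
assert (E2 : (- ((y - z) * (y - z) * Cconj (cb g)) / (den y * den z * den z))%C =
  (- ((y - z) * ((y - z) * (Cconj (cb g) * / den y * / den z * / den z))))%C).
{ field; split; assumption. }
rewrite E, E2, Cmod_opp, (Cmod_mult (y - z)%C), (Rmult_comm eps).
apply Rmult_le_compat_l; [apply Cmod_ge_0|].
rewrite !Cmod_mult, Cmod_conj.
pose proof (Cmod_ge_0 (/ den y)%C); pose proof (Cmod_ge_0 (/ den z)%C); pose proof (Cmod_ge_0 (y - z)%C).
assert (hLe : Cmod (cb g) * Cmod (/ den y)%C * Cmod (/ den z)%C * Cmod (/ den z)%C <= L).
{ apply Rle_trans with (Cmod (cb g) * M * M * M); [|unfold L; lra].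
  repeat apply Rmult_le_compat; try lra; repeat apply Rmult_le_pos; lra. }
apply Rle_trans with (eps / L * L); [|right; field; lra].
apply Rmult_le_compat; try lra; repeat apply Rmult_le_pos; lra.
Qed.

(** * The Nielsen double *)

Section Double.

Context (q : idx -> V) (hq : forall i, in_H2 (q i)) (hdl : 0 < dl q).
Context (G : aut -> Prop) (hG : is_fuchsian G) (hGfree : acts_freely G).
Context (hGw : forall g, G g -> exists w, Nat.even (length w) = true /\ forall v, lin g v = hw q w v).
Context (hwG : forall w, Nat.even (length w) = true -> exists g, G g /\ forall v, lin g v = hw q w v).
Context (R0 : Disc -> Disc) (hR0 : forall z, pt (R0 z) = refl (FF q I2) (pt z)).
Context (T : aut) (hT : G T) (hThyp : hyperbolic T)
  (hTaxis : forall z, dot (pt z) (FF q I2) = 0 -> dot (pt z) (Nv T) = 0).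
Context (Gam : aut -> Prop) (hGam : is_subgroup Gam).
Context (hGamE : forall g, Gam g -> exists f, Ext q true f /\ forall z, pt (act g z) = f (pt z)).
Context (hEGam : forall f, Ext q true f -> exists g, Gam g /\ forall z, pt (act g z) = f (pt z)).
Context (P : idx -> Disc) (hP : forall i, pt (P i) = q i).

(** * Orbits, limit points and the Nielsen region *)

Lemma orbit_G z w : orbit G z w <->
  exists u, Nat.even (length u) = true /\ pt w = hw q u (pt z).
Proof.
split.
- intros (g & hg & ->); destruct (hGw g hg) as (u & h1 & h2).
  exists u; rewrite pt_act, h2; auto.
- intros (u & h1 & h2); destruct (hwG u h1) as (g & hg & h3).
  exists g; split; [exact hg|]; apply pt_inj; rewrite h2, pt_act, h3; reflexivity.
Qed.

Lemma orbit_Gam z w : orbit Gam z w <-> exists f, Ext q true f /\ pt w = f (pt z).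
Proof.
split.
- intros (g & hg & ->); destruct (hGamE g hg) as (f & h1 & h2); exists f; auto.
- intros (f & h1 & h2); destruct (hEGam f h1) as (g & hg & h3).
  exists g; split; [exact hg|]; apply pt_inj; rewrite h2, h3; reflexivity.
Qed.

Lemma proj_G z w : proj G z = proj G w <-> exists u, Nat.even (length u) = true /\ pt w = hw q u (pt z).
Proof. rewrite <- orbit_G; apply proj_eq, hG. Qed.

Lemma proj_Gam z w : proj Gam z = proj Gam w <-> exists f, Ext q true f /\ pt w = f (pt z).
Proof. rewrite <- orbit_Gam; apply proj_eq, hGam. Qed.

(** The walls form one orbit under [G]: each half-turn exchanges two of the three initial normals,
    and the odd word [[I3; I2; I1]] fixes [FF q I2], so the parity can be corrected. *)
Lemma NN_in_orbit v : NN q v -> exists w, Nat.even (length w) = true /\ v = hw q w (FF q I2).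
Proof.
intros (w & i & ->).
assert (h : exists w', hw q w (FF q i) = hw q w' (FF q I2)).
{ destruct i.
  - exists (w ++ [I3]); rewrite hw_app; simpl; f_equal; symmetry; apply (HH_pv q hq I3).
  - exists w; reflexivity.
  - exists (w ++ [I1]); rewrite hw_app; simpl; f_equal; symmetry; apply (HH_nx q hq I1). }
destruct h as [w' ->].
destruct (Nat.even (length w')) eqn:E; [exists w'; auto|].
exists (w' ++ [I3; I2; I1]); split.
- rewrite even_app, E; reflexivity.
- rewrite hw_app; f_equal; simpl.
  pose proof (HH_nx q hq I1) as e1; pose proof (HH_nx q hq I2) as e2; pose proof (HH_nx q hq I3) as e3.
  simpl in *; rewrite e1, e2, e3; reflexivity.
Qed.

(** The half-planes are disjoint, so [z] lies beyond at most one wall and [M] bounds [dot (pt z)] on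
    all of [NN]; the bound persists along the orbit. If [dot (nullv xi) v] were positive,
    [dot (pt w) v] would be unbounded as [w] tends to [xi], the factor [1 - nrm w] tending to
    zero. *)
Lemma limit_point_halfplane xi v : limit_point G xi -> NN q v -> dot (nullv xi) v <= 0.
Proof.
intros [hxi [z hz]] hv.
assert (hM : exists M, 0 <= M /\ forall v', NN q v' -> dot (pt z) v' <= M).
{ destruct (classic (exists v0, NN q v0 /\ 0 < dot (pt z) v0)) as [(v0 & n0 & p0)|hno].
  - exists (dot (pt z) v0); split; [lra|]; intros v' n'.
    destruct (classic (v' = v0)) as [->|hne]; [lra|].
    pose proof (NN_disjoint q hq hdl v0 v' (pt z) n0 n' (not_eq_sym hne) (pt_in_H2 z) (Rlt_le _ _ p0)); lra.
  - exists 0; split; [lra|]; intros v' n'; apply Rnot_lt_le; intros h; apply hno; eauto. }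
destruct hM as (M & hM0 & hM).
apply Rnot_lt_le; intros hpos.
set (K := 2 * Rabs (vx v) + 2 * Rabs (vy v) + 2 * Rabs (vt v) + 2 * M + 1).
assert (hK : 0 < K).
{ unfold K; pose proof (Rabs_pos (vx v)); pose proof (Rabs_pos (vy v)); pose proof (Rabs_pos (vt v)); lra. }
destruct (hz (dot (nullv xi) v / K)) as (g & hg & hgz).
{ apply Rdiv_lt_0_compat; assumption. }
set (w := act g z) in *. set (e := Cmod (w - xi)%C) in *.
assert (he0 : 0 <= e) by apply Cmod_ge_0.
assert (hwM : dot (pt w) v <= M).
{ unfold w; destruct (hGw g hg) as (u & hu1 & hu2).
  rewrite pt_act, hu2, <- (hw_rev' q hq u v), hw_dot by exact hq.
  apply hM, NN_hw; assumption. }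
clearbody w.
pose proof (nrm_lt w) as hnw.
assert (hlin : dot (pt w) v * (1 - nrm w) =
  2 * fst (dval w) * vx v + 2 * snd (dval w) * vy v - (1 + nrm w) * vt v).
{ unfold dot, pt; simpl; field; lra. }
assert (hx : Rabs (fst (dval w) - fst xi) <= e) by apply (Rabs_fst_le (w - xi)%C).
assert (hy : Rabs (snd (dval w) - snd xi) <= e) by apply (Rabs_snd_le (w - xi)%C).
assert (hn : 1 - nrm w <= 2 * e).
{ assert (ht : Cmod xi <= Cmod w + e).
  { replace xi with (w - (w - xi))%C at 1 by ring.
    unfold Cminus at 1; apply Rle_trans with (1 := Cmod_triangle _ _); rewrite Cmod_opp; unfold e; lra. }
  unfold nrm; rewrite <- Cmod_sqr; rewrite hxi in ht.
  pose proof (proj2_sig w) as hw1; simpl in hw1; fold (dval w) in hw1; pose proof (Cmod_ge_0 w); nra. }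
assert (h1 : dot (pt w) v * (1 - nrm w) <= M * (2 * e)).
{ apply Rle_trans with (M * (1 - nrm w)); [apply Rmult_le_compat_r; lra|apply Rmult_le_compat_l; lra]. }
assert (habs : forall a b c, Rabs a <= c -> - (c * Rabs b) <= a * b).
{ intros a b c hac; pose proof (Rle_abs (- (a * b))) as h; rewrite Rabs_Ropp, Rabs_mult in h.
  pose proof (Rabs_pos b); nra. }
pose proof (habs _ (vx v) e hx) as ax; pose proof (habs _ (vy v) e hy) as ay.
assert (at_ : - (2 * e * Rabs (vt v)) <= (1 - nrm w) * vt v).
{ apply habs; rewrite Rabs_right; lra. }
assert (hlow : 2 * dot (nullv xi) v <= M * (2 * e) + 2 * e * Rabs (vx v) + 2 * e * Rabs (vy v) + 2 * e * Rabs (vt v)).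
{ unfold dot, nullv; simpl; rewrite hlin in h1. lra. }
assert (heK : e * K < dot (nullv xi) v).
{ apply (Rmult_lt_compat_r K) in hgz; [|exact hK].
  unfold Rdiv in hgz; rewrite Rmult_assoc, Rinv_l, Rmult_1_r in hgz by lra; exact hgz. }
unfold K in heK. pose proof (Rabs_pos (vx v)); pose proof (Rabs_pos (vy v)); pose proof (Rabs_pos (vt v)). nra.
Qed.

Lemma region_inK z : nielsen_region G z <-> inK q (pt z).
Proof.
split.
- intros h; apply (h (fun z => inK q (pt z))).
  + intros x w u [hx1 hx2] [hw1 hw2] hu; split; [apply pt_in_H2|].
    intros v hv; apply (rho_halfplane x u w v hu); auto.
  + intros xi eta u hxi heta hne hu; split; [apply pt_in_H2|]; intros v hv.
    destruct (geodesic_comb xi eta u hu) as (k & l & hk & hl & ->).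
    rewrite dot_addl, !dot_scall.
    pose proof (limit_point_halfplane xi v hxi hv); pose proof (limit_point_halfplane eta v heta hv); nra.
- intros hz K hK hgeo.
  (* The cone over [K], with the zero vector adjoined because scaling by zero is allowed in
     [inK_hull]. *)
  set (Kc := fun v : V => v = vzero \/ exists t x, 0 < t /\ K x /\ v = vscal t (pt x)).
  assert (hz' : Kc (pt z)).
  { apply (inK_hull q hq hdl Kc); [| | |exact hz].
    - intros v w [->|(t & x & ht & hx & ->)] [->|(s & y & hs & hy & ->)].
      + left; vring.
      + right; exists s, y; repeat split; auto; vring.
      + right; exists t, x; repeat split; auto; vring.
      + right; destruct (convex_add K x y t s hK hx hy ht hs) as (u & r & hr & hu & e).
        exists r, u; auto.
    - intros k v hk [->|(t & x & ht & hx & ->)]; [left; vring|].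
      destruct (Req_dec k 0) as [->|hk0]; [left; vring|].
      right; exists (k * t), x; repeat split; [apply Rmult_lt_0_compat; lra|exact hx|vring].
    - intros u i j k hijk; right.
      destruct (foot_future q hq hdl i j k hijk) as [hf1 hf2].
      set (f := foot q i j k) in *.
      assert (hr : 0 < sqrt (- dot f f)) by (apply sqrt_lt_R0; lra).
      pose proof (sqrt_sqrt (- dot f f)) as hs2; set (m := sqrt (- dot f f)) in *.
      destruct (pt_surj (hw q u (vscal (/ m) f))) as [x hx].
      { apply hw_in_H2; [exact hq|]; split.
        + autorewrite with dot; assert (E : dot f f = - (m * m)) by lra; rewrite E; field; lra.
        + cbn [vscal vt]; apply Rmult_lt_0_compat; [apply Rinv_0_lt_compat|]; assumption. }
      exists m, x; repeat split; [exact hr| |rewrite hx, <- hw_scal, vscal_inv; [reflexivity|lra]].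
      (* The foot lies on a wall, which is the axis of a conjugate of [T] in [G]; so it lies on a
         geodesic joining two limit points. *)
      destruct (NN_in_orbit (hw q u (FF q j))) as (w & hw1 & hw2); [apply NN_hw, NN_FF|].
      destruct (hwG w hw1) as (g & hg & hgw).
      assert (hperp : dot (pt (act (inv g) x)) (FF q I2) = 0).
      { rewrite <- (lin_dot g), <- pt_act, act_inv_r, hgw, <- hw2, hx, hw_dot by exact hq.
        rewrite dot_scall; unfold f, foot; autorewrite with dot.
        rewrite FF_norm by exact hq.
        assert (e : dot (FF q i) (FF q j) = - gg q k).
        { destruct hijk as [[-> ->]|[-> ->]]; [apply FF_dot_nx|apply FF_dot_pv]; exact hq. }
        rewrite e; ring. }
      apply hTaxis in hperp.
      assert (hsub : is_subgroup G) by apply hG.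
      destruct hsub as (s1 & s2 & s3 & s4).
      destruct (axis_limit_points G (mul (mul g T) (inv g)) x) as (xi & eta & l1 & l2 & l3 & l4).
      + apply hG.
      + auto.
      + apply hyperbolic_sqr; rewrite Re_conj; apply hyperbolic_sqr, hThyp.
      + rewrite Nv_conj, <- (act_inv_r g x), pt_act, lin_dot; exact hperp.
      + exact (hgeo xi eta x l1 l2 l3 l4). }
  destruct hz' as [h0|(t & x & ht & hx & e)].
  + pose proof (proj1 (pt_in_H2 z)) as hn; rewrite h0 in hn; unfold dot, vzero in hn; simpl in hn; lra.
  + assert (t = 1).
    { pose proof (proj1 (pt_in_H2 z)) as n1; pose proof (proj1 (pt_in_H2 x)) as n2.
      rewrite e in n1; autorewrite with dot in n1; rewrite n2 in n1; nra. }
    subst t; assert (z = x) by (apply pt_inj; rewrite e; vring); subst x; exact hx.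
Qed.

(** A point beyond some wall is as far from [z] as that wall by [separated_far], and [wall_gap]
    bounds this distance uniformly. *)
Lemma interior_ball (z : Disc) : inK q (pt z) -> ~ on_wall q (pt z) ->
  exists e, 0 < e /\ (forall v, NN q v -> dot (pt z) v <= - e) /\
  forall w : Disc, dot (pt z) (pt w) ^ 2 < 1 + e ^ 2 / dl q -> inK q (pt w).
Proof.
intros hz hnw; destruct (wall_gap q hq hdl (pt z) hz hnw) as (e & he & hgap).
exists e; repeat split; auto; [apply pt_in_H2|apply pt_in_H2|].
intros v hv; apply Rnot_lt_le; intros h.
pose proof (separated_far (pt z) (pt w) v e (dl q) (pt_in_H2 z) (pt_in_H2 w) hdl
  (NN_norm q hq v hv) (Rlt_le _ _ he) (hgap v hv) (Rlt_le _ _ h)); lra.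
Qed.

Lemma boundary_wall z : inK q (pt z) -> (boundary_of (nielsen_region G) z <-> on_wall q (pt z)).
Proof.
intros hz; split.
- intros hb; apply NNPP; intros hnw.
  destruct (interior_ball z hz hnw) as (e & he & _ & hball).
  destruct (dot_near z (e ^ 2 / dl q)) as (r & hr & hr').
  { apply Rdiv_lt_0_compat; nra. }
  destruct (hb r hr) as [_ (w & hw1 & hw2)].
  apply hw2, region_inK, hball, hr', hw1.
- intros (v & hv & h0) r hr; split.
  + exists z; split; [|apply region_inK, hz].
    replace (z - z)%C with (RtoC 0) by ring; rewrite Cmod_0; exact hr.
  + pose proof (nrm_lt z) as hnz.
    pose proof (NN_norm q hq v hv) as hvn.
    (* Half the gradient at [z] of the function [(1 - nrm z) * dot (pt z) v], whose zero set is the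
       wall; moving along it crosses the wall. *)
    set (eta := (vx v - vt v * fst (dval z), vy v - vt v * snd (dval z))%R : C).
    set (E := fst eta ^ 2 + snd eta ^ 2).
    assert (h0' : 2 * fst (dval z) * vx v + 2 * snd (dval z) * vy v - (1 + nrm z) * vt v = 0).
    { transitivity (dot (pt z) v * (1 - nrm z)); [unfold dot, pt; simpl; field; lra|rewrite h0; ring]. }
    assert (hE : 0 < E).
    { destruct (Rlt_or_le 0 E) as [h|h]; [exact h|exfalso].
      unfold E, eta in h; simpl in h.
      assert (sq0 : forall a b, a * (a * 1) + b * (b * 1) <= 0 -> a = 0 /\ b = 0) by (intros a b hab; split; nra).
      apply sq0 in h as [e1 e2]; apply Rminus_diag_uniq in e1, e2.
      unfold dot in hvn; rewrite e1, e2 in hvn; unfold nrm in *; nra. }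
    pose proof (proj2_sig z) as hz1; simpl in hz1; fold (dval z) in hz1.
    pose proof (Rabs_pos (vt v)) as hvt. pose proof (Rle_abs (vt v)) as hvt'.
    assert (hCe : 0 < Cmod eta).
    { pose proof (Cmod_sqr eta) as e; fold E in e; pose proof (Cmod_ge_0 eta); nra. }
    (* The three bounds keep the new point within [r] of [z], inside the disc, and the factor
       [2 - vt v * t] positive. *)
    set (t := Rmin (Rmin (r / (2 * Cmod eta)) ((1 - Cmod z) / (2 * Cmod eta))) (/ (Rabs (vt v) + 1))).
    assert (ht : 0 < t).
    { repeat apply Rmin_glb_lt; [apply Rdiv_lt_0_compat; lra|apply Rdiv_lt_0_compat; lra|apply Rinv_0_lt_compat; lra]. }
    assert (ht1 : t * Cmod eta < r).
    { apply Rle_lt_trans with (r / (2 * Cmod eta) * Cmod eta).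
      - apply Rmult_le_compat_r; [lra|]; unfold t.
        apply Rle_trans with (1 := Rmin_l _ _), Rmin_l.
      - apply Rle_lt_trans with (r / 2); [right; field; lra|lra]. }
    assert (ht2 : t * Cmod eta < 1 - Cmod z).
    { apply Rle_lt_trans with ((1 - Cmod z) / (2 * Cmod eta) * Cmod eta).
      - apply Rmult_le_compat_r; [lra|]; unfold t.
        apply Rle_trans with (1 := Rmin_l _ _), Rmin_r.
      - apply Rle_lt_trans with ((1 - Cmod z) / 2); [right; field; lra|lra]. }
    assert (ht3 : vt v * t < 2).
    { apply Rle_lt_trans with ((Rabs (vt v) + 1) * / (Rabs (vt v) + 1)); [|rewrite Rinv_r; lra].
      apply Rle_trans with ((Rabs (vt v) + 1) * t); [apply Rmult_le_compat_r; lra|].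
      apply Rmult_le_compat_l; [lra|apply Rmin_r]. }
    clearbody t.
    assert (hw : Cmod (z + RtoC t * eta)%C < 1).
    { apply Rle_lt_trans with (1 := Cmod_triangle _ _); rewrite Cmod_mult, Cmod_R, Rabs_right; lra. }
    exists (mkD _ hw); split.
    * change (dval (mkD _ hw)) with (z + RtoC t * eta)%C.
      replace (z + RtoC t * eta - z)%C with (RtoC t * eta)%C by ring.
      rewrite Cmod_mult, Cmod_R, Rabs_right; lra.
    * intros hreg; rewrite region_inK in hreg; destruct hreg as [_ hreg].
      specialize (hreg v hv).
      pose proof (nrm_lt (mkD _ hw)) as hnw.
      assert (hlin : dot (pt (mkD _ hw)) v * (1 - nrm (mkD _ hw)) = t * E * (2 - vt v * t)).
      { transitivity (2 * fst (dval (mkD _ hw)) * vx v + 2 * snd (dval (mkD _ hw)) * vy v - (1 + nrm (mkD _ hw)) * vt v).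
        - clear -hnw; set (x := mkD _ hw) in *; clearbody x; unfold dot, pt; simpl; field; lra.
        - unfold nrm, E, eta in *; simpl; simpl in h0'. nra. }
      assert (0 < t * E * (2 - vt v * t)) by (repeat apply Rmult_lt_0_compat; lra).
      nra.
Qed.

(** * Gluing the two copies *)

Definition fb (b : bool) : V -> V := if b then refl (FF q I2) else fun v => v.

Lemma fb_invol b v : fb b (fb b v) = v.
Proof. destruct b; simpl; [apply (NN_refl_invol q hq hdl), NN_FF|reflexivity]. Qed.

Lemma Ext_fb b : Ext q (negb b) (fb b).
Proof. destruct b; [apply Ext_refl, NN_FF|apply (Ext_word q [] eq_refl)]. Qed.

Lemma Ext_comp' b b' b'' f f' : Ext q b f -> Ext q b' f' -> b'' = Bool.eqb b b' ->
  Ext q b'' (fun z => f (f' z)).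
Proof. intros h h' ->; apply Ext_comp; assumption. Qed.

Lemma double_map_pt s : exists z, double_map Gam R0 s = proj Gam z /\ pt z = fb (fst s) (pt (snd s)).
Proof.
destruct s as [[|] z]; [exists (R0 z)|exists z]; split; auto; apply hR0.
Qed.

(** Conjugating by the maps of the two copies turns an element of [Gam] into one relating points of
    the region; its parity of reflections records whether the copies agree, and [Ext_inK] treats
    both parities. *)
Lemma double_injective s t : nielsen_region G (snd s) -> nielsen_region G (snd t) ->
  (double_map Gam R0 s = double_map Gam R0 t <-> double_eq G s t).
Proof.
intros hs ht; rewrite region_inK in hs, ht.
destruct (double_map_pt s) as (x & -> & hx); destruct (double_map_pt t) as (y & -> & hy).
rewrite proj_Gam; unfold double_eq; rewrite proj_G, (boundary_wall _ hs), hx, hy.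
destruct s as [b z], t as [b' w]; cbn [fst snd] in *.
split.
- intros (f & hf & e).
  assert (e' : pt w = fb b' (f (fb b (pt z)))) by (rewrite <- e, fb_invol; reflexivity).
  assert (hE : Ext q (Bool.eqb (negb b') (negb b)) (fun v => fb b' (f (fb b v)))).
  { apply (Ext_comp' (negb b') (negb b)); [apply Ext_fb| |reflexivity].
    apply (Ext_comp' true (negb b) _ f); [exact hf|apply Ext_fb|destruct b; reflexivity]. }
  destruct (Ext_inK q hq hdl _ _ (pt z) hE hs) as [(h1 & u & h2 & h3)|(h1 & h2 & u & h3 & h4)].
  + cbn beta; rewrite <- e'; exact ht.
  + split; [exists u; split; [exact h2|rewrite e'; apply (h3 (pt z))]|left].
    destruct b, b'; auto; discriminate.
  + split; [exists u; split; [exact h3|rewrite e'; exact h4]|right; exact h2].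
- intros ((u & hu & e) & hor); destruct (bool_dec b b') as [<-|hb].
  + exists (fun x => fb b (hw q u (fb b x))); split.
    * apply (Ext_comp' (negb b) (negb b)); [apply Ext_fb| |destruct b; reflexivity].
      apply (Ext_comp' true (negb b) _ (hw q u)); [apply Ext_word, hu|apply Ext_fb|destruct b; reflexivity].
    * rewrite fb_invol, e; reflexivity.
  + destruct hor as [hor|(v & hv & h0)]; [contradiction|].
    (* The reflection in the wall through [z] fixes [pt z] and makes the number of reflections
       even. *)
    exists (fun x => fb b' (hw q u (refl v (fb b x)))); split.
    * apply (Ext_comp' (negb b') b); [apply Ext_fb| |destruct b, b'; first [reflexivity|congruence]].
      apply (Ext_comp' true b _ (hw q u)); [apply Ext_word, hu| |destruct b; reflexivity].
      apply (Ext_comp' false (negb b) _ (refl v)); [apply Ext_refl, hv|apply Ext_fb|destruct b; reflexivity].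
    * rewrite fb_invol, refl_fix, e by exact h0; reflexivity.
Qed.

Lemma P_inK i : inK q (pt (P i)) /\ ~ on_wall q (pt (P i)).
Proof. rewrite hP; apply inK_q; assumption. Qed.

(** An element close to the identity moves the interior point [P I2] too little to involve a wall
    reflection ([Ext_near]); it then belongs to [G], which is discrete. *)
Lemma Gam_fuchsian : is_fuchsian Gam.
Proof.
split; [exact hGam|].
destruct (P_inK I2) as [h1 h2].
destruct (interior_ball (P I2) h1 h2) as (e & he & hgap & _).
destruct (dot_near (P I2) (e ^ 2 / dl q)) as (r & hr & hr').
{ apply Rdiv_lt_0_compat; nra. }
destruct (near_identity (P I2) r hr) as (eps1 & he1 & hn).
destruct hG as [_ (eps0 & he0 & hdis)].
exists (Rmin eps0 eps1); split; [apply Rmin_glb_lt; assumption|].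
intros g hg ha hb.
pose proof (Rmin_l eps0 eps1); pose proof (Rmin_r eps0 eps1).
apply hdis; try lra.
destruct (hGamE g hg) as (f & hf & hfg).
destruct (Ext_near q hq hdl f (pt (P I2)) e hf h1 he hgap) as (w & hw1 & hw2).
- rewrite <- hfg; apply hr', hn; lra.
- destruct (hwG w hw1) as (g' & hg' & hg'w).
  apply (proj2 (proj2 (proj2 (proj1 hG))) g'); [|exact hg'].
  intros z; apply pt_inj; rewrite hfg, hw2, pt_act, hg'w; reflexivity.
Qed.

(** Reflecting in a violated wall strictly decreases the distance to the interior point [q I2]. If
    no image of [z] reached the region, infinitely many elements of [Gam] would move [z] by strictly
    decreasing bounded amounts, against [discrete_repeat]. *)
Lemma Gam_meets_region z : exists b f, Ext q b f /\ inK q (f (pt z)).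
Proof.
apply NNPP; intros hno.
assert (h1 : forall b f, Ext q b f -> exists v, NN q v /\ 0 < dot (f (pt z)) v).
{ intros b f hf; apply NNPP; intros hno'; apply hno; exists b, f; split; [exact hf|].
  split; [apply (Ext_in_H2 q hq hdl b f); [exact hf|apply pt_in_H2]|].
  intros v hv; apply Rnot_lt_le; intros h; apply hno'; eauto. }
set (F := fun y => - dot y (q I2)).
assert (h2 : forall b f, Ext q b f -> exists f', Ext q (negb b) f' /\ F (f' (pt z)) < F (f (pt z))).
{ intros b f hf; destruct (h1 b f hf) as (v & hv & hpos).
  exists (fun y => refl v (f y)); split.
  - apply (Ext_comp' false b); [apply Ext_refl, hv|exact hf|destruct b; reflexivity].
  - unfold F, refl; autorewrite with dot.
    pose proof (NN_q_neg q hq hdl v I2 hv) as hqv; rewrite dot_comm in hqv.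
    rewrite (NN_norm q hq v hv).
    assert (0 < 2 * dot (f (pt z)) v / dl q) by (apply Rdiv_lt_0_compat; lra). nra. }
(* Two reflections at a time keep the parity even, so the sequence stays in [Gam]. *)
assert (h3 : forall g, Gam g -> exists g', Gam g' /\ F (pt (act g' z)) < F (pt (act g z))).
{ intros g hg; destruct (hGamE g hg) as (f & hf & e); rewrite e.
  destruct (h2 true f hf) as (f' & hf' & l'); destruct (h2 _ f' hf') as (f'' & hf'' & l'').
  destruct (hEGam f'' hf'') as (g'' & hg'' & e''); exists g''; split; [exact hg''|].
  rewrite e''; lra. }
set (elt := {g : aut | Gam g}).
assert (h4 : exists next : elt -> elt, forall g, F (pt (act (proj1_sig (next g)) z)) < F (pt (act (proj1_sig g) z))).
{ exists (fun g : elt => let c := constructive_indefinite_description _ (h3 (proj1_sig g) (proj2_sig g)) in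
    exist _ (proj1_sig c) (proj1 (proj2_sig c))).
  intros g; simpl; destruct (constructive_indefinite_description _ _) as (g' & hg' & hl); exact hl. }
destruct h4 as [next hnext].
set (sq := fun n => Nat.iter n next (exist _ one (proj1 hGam) : elt)).
assert (hdec : forall m n, (m < n)%nat -> F (pt (act (proj1_sig (sq n)) z)) < F (pt (act (proj1_sig (sq m)) z))).
{ intros m n hmn; induction hmn as [|n hmn IH]; [apply hnext|].
  apply Rlt_trans with (2 := IH); apply hnext. }
destruct (ca_bound z (P I2)) as (K & hK & hb); rewrite hP in hb.
destruct (discrete_repeat Gam (fun n => proj1_sig (sq n)) (1 + K * F (pt (act one z))) Gam_fuchsian)
  as (m & n & hmn & hs).
- intros n; apply proj2_sig.
- intros n; specialize (hb (proj1_sig (sq n))); fold (F (pt (act (proj1_sig (sq n)) z))) in hb.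
  assert (hle : F (pt (act (proj1_sig (sq n)) z)) <= F (pt (act one z))).
  { destruct n as [|n]; [right; reflexivity|left; apply (hdec 0%nat (S n)); lia]. }
  pose proof (Cmod_ge_0 (ca (proj1_sig (sq n)))).
  assert (K * F (pt (act (proj1_sig (sq n)) z)) <= K * F (pt (act one z))) by (apply Rmult_le_compat_l; lra).
  nra.
- pose proof (hdec m n hmn) as h; rewrite (hs z) in h; lra.
Qed.

Lemma double_surjective (x : surface Gam) :
  exists s, nielsen_region G (snd s) /\ double_map Gam R0 s = x.
Proof.
destruct (proj_surj Gam x) as [z ->].
destruct (Gam_meets_region z) as (b & f & hf & hfz).
destruct (pt_surj (f (pt z))) as [y hy]; [apply hfz|].
(* An even product belongs to the group of the double and lands in the first copy; an odd one is
   completed by the reflection of the second copy. *)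
exists (negb b, y); split; [apply region_inK; simpl; rewrite hy; exact hfz|].
destruct (double_map_pt (negb b, y)) as (y' & -> & hy'); cbn [fst snd] in hy'.
symmetry; apply proj_Gam; exists (fun v => fb (negb b) (f v)); split.
- apply (Ext_comp' (negb (negb b)) b); [apply Ext_fb|exact hf|destruct b; reflexivity].
- rewrite hy', hy; reflexivity.
Qed.

Lemma Gam_acts_freely : acts_freely Gam.
Proof.
intros g z hg hz; destruct (hGamE g hg) as (f & hf & hfg).
destruct (Gam_meets_region z) as (b & k & hk & hkz).
destruct (Ext_inv q hq hdl b k hk) as (k' & hk' & i1 & i2).
assert (hE : Ext q true (fun v => k (f (k' v)))).
{ apply (Ext_comp' b b); [exact hk| |destruct b; reflexivity].
  apply (Ext_comp' true b _ f); [exact hf|exact hk'|destruct b; reflexivity]. }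
assert (e : k (f (k' (k (pt z)))) = k (pt z)) by (rewrite i1, <- hfg, hz; reflexivity).
destruct (Ext_inK q hq hdl _ _ (k (pt z)) hE hkz) as [(_ & u & h2 & h3)|(h1 & _)]; [|..].
- cbn beta; rewrite e; exact hkz.
- destruct (hwG u h2) as (g' & hg' & hgu).
  destruct (pt_surj (k (pt z))) as [y hy]; [apply hkz|].
  assert (hfix : act g' y = y).
  { apply pt_inj; rewrite pt_act, hgu, hy, <- h3; exact e. }
  pose proof (hGfree g' y hg' hfix) as hs; rewrite same_iff_lin in hs.
  intros x; apply pt_inj; rewrite act_one, hfg.
  rewrite <- (i1 (f (pt x))). rewrite <- (i1 (pt x)) at 1; rewrite h3, <- hgu, hs, lin_one; apply i1.
- discriminate.
Qed.

Lemma nielsen_double : is_nielsen_double G Gam R0.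
Proof.
split; [exact Gam_fuchsian|split; [exact Gam_acts_freely|split]].
- exact double_surjective.
- exact double_injective.
Qed.

(** * The involution and its fixed points *)

Lemma Ext_conj_half f : Ext q true f -> Ext q true (fun v => HH q I2 (f (HH q I2 v))).
Proof. apply Ext_HH, hq. Qed.

Lemma half_compatible z w : proj Gam z = proj Gam w ->
  proj Gam (act (half_turn (P I2)) z) = proj Gam (act (half_turn (P I2)) w).
Proof.
rewrite !proj_Gam; intros (f & hf & e).
exists (fun v => HH q I2 (f (HH q I2 v))); split; [apply Ext_conj_half, hf|].
rewrite !pt_half_turn, hP; unfold HH at 2; rewrite half_invol, e by apply hq; reflexivity.
Qed.

(** Both [pt y] and its half-turn lie in the region, so [f] is an even word; composed with the
    half-turn it gives an odd word fixing [pt y], to which [odd_word_fixed] applies. *)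
Lemma half_fixed_region y f : inK q (pt y) -> Ext q true f -> HH q I2 (pt y) = f (pt y) ->
  exists u i, Nat.even (length u) = true /\ pt y = hw q u (q i).
Proof.
intros hy hf e.
assert (hy' : inK q (HH q I2 (pt y))) by apply (inK_hw q hq [I2] _ hy).
destruct (Ext_inK q hq hdl _ _ (pt y) hf hy) as [(_ & u & h2 & h3)|(h1 & _)]; [|..].
- rewrite <- e; exact hy'.
- apply (odd_word_fixed q hq hdl (rev u ++ [I2])).
  + apply pt_in_H2.
  + rewrite even_app, even_rev, h2; reflexivity.
  + rewrite hw_app; simpl; rewrite e, h3, hw_rev by exact hq; reflexivity.
- discriminate.
Qed.

Definition six : list Disc := [P I2; P I1; P I3; R0 (P I2); R0 (P I1); R0 (P I3)].

Lemma six_in b i : exists z, In z six /\ pt z = fb b (q i).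
Proof.
destruct b.
- exists (R0 (P i)); split; [destruct i; simpl; tauto|simpl; rewrite hR0, hP; reflexivity].
- exists (P i); split; [destruct i; simpl; tauto|apply hP].
Qed.

Lemma six_pt z : In z six -> exists b i, pt z = fb b (q i).
Proof.
simpl; intros [<-|[<-|[<-|[<-|[<-|[<-|[]]]]]]];
  [exists false, I2|exists false, I1|exists false, I3|exists true, I2|exists true, I1|exists true, I3];
  simpl; rewrite ?hR0, hP; reflexivity.
Qed.

(** On the mirror copy the half-turn does not commute with the reflection in [FF q I2]: it replaces
    it by the reflection in the wall [HH q I2 (FF q I2)]. The two differ by an even product of
    reflections, so the argument for the first copy carries over. *)
Lemma fixed_iff_six z : proj Gam (act (half_turn (P I2)) z) = proj Gam z <->
  In (proj Gam z) (map (proj Gam) six).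
Proof.
assert (hN : NN q (HH q I2 (FF q I2))) by apply (NN_hw q [I2] _ (NN_FF q I2)).
assert (hcb : forall b v, HH q I2 (fb b v) =
   (if b then refl (HH q I2 (FF q I2)) else fun v => v) (HH q I2 v)).
{ intros [|] v; [apply half_refl, hq|reflexivity]. }
assert (hEb : forall b : bool, Ext q (negb b) (if b then refl (HH q I2 (FF q I2)) else fun v => v)).
{ intros [|]; [apply Ext_refl, hN|apply (Ext_word q [] eq_refl)]. }
split.
- intros h.
  destruct (Gam_meets_region z) as (b & f & hf & hfz).
  destruct (pt_surj (f (pt z))) as [y hy]; [apply hfz|].
  rewrite <- hy in hfz.
  destruct (pt_surj (fb (negb b) (pt y))) as [y' hy'].
  { apply (Ext_in_H2 q hq hdl _ _ _ (Ext_fb (negb b))), pt_in_H2. }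
  assert (hzy : proj Gam z = proj Gam y').
  { apply proj_Gam; exists (fun v => fb (negb b) (f v)); split; [|rewrite hy', hy; reflexivity].
    apply (Ext_comp' (negb (negb b)) b); [apply Ext_fb|exact hf|destruct b; reflexivity]. }
  assert (h' : proj Gam y' = proj Gam (act (half_turn (P I2)) y')).
  { rewrite <- (half_compatible z y' hzy), h; symmetry; exact hzy. }
  apply proj_Gam in h' as (k & hk & e).
  rewrite pt_half_turn, hP, hy' in e; fold (HH q I2 (fb (negb b) (pt y))) in e; rewrite hcb in e.
  set (c := negb b) in *.
  assert (hinv : forall v, (if c then refl (HH q I2 (FF q I2)) else fun v => v)
     ((if c then refl (HH q I2 (FF q I2)) else fun v => v) v) = v).
  { intros v; destruct c; [apply (NN_refl_invol q hq hdl), hN|reflexivity]. }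
  destruct (half_fixed_region y (fun v => (if c then refl (HH q I2 (FF q I2)) else fun v => v) (k (fb c v))) hfz)
    as (u & i & hu & hui).
  + apply (Ext_comp' (negb c) (negb c)); [apply hEb| |destruct c; reflexivity].
    apply (Ext_comp' true (negb c) _ k); [exact hk|apply Ext_fb|destruct c; reflexivity].
  + rewrite <- e, hinv; reflexivity.
  + destruct (six_in c i) as (x & hx1 & hx2).
    rewrite hzy; apply in_map_iff; exists x; split; [|exact hx1].
    apply proj_Gam; exists (fun v => fb c (hw q u (fb c v))); split.
    * apply (Ext_comp' (negb c) (negb c)); [apply Ext_fb| |destruct c; reflexivity].
      apply (Ext_comp' true (negb c) _ (hw q u)); [apply Ext_word, hu|apply Ext_fb|destruct c; reflexivity].
    * rewrite hy', hx2, fb_invol, hui; reflexivity.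
- intros h; apply in_map_iff in h as (x & ex & hx).
  destruct (six_pt x hx) as (b & i & hbi).
  rewrite (half_compatible z x (eq_sym ex)), <- ex.
  symmetry; apply proj_Gam.
  assert (hi : exists u, Nat.even (length u) = true /\ HH q I2 (q i) = hw q u (q i)).
  { assert (hfi : HH q i (q i) = q i) by (apply half_fix, hq).
    (* As [HH q i] fixes [q i], the half-turn [HH q I2] acts on it as this even word. *)
    exists [I2; i]; split; [reflexivity|simpl; rewrite hfi; reflexivity]. }
  destruct hi as (u & hu & e).
  exists (fun v => (if b then refl (HH q I2 (FF q I2)) else fun v => v) (hw q u (fb b v))); split.
  + apply (Ext_comp' (negb b) (negb b)); [apply hEb| |destruct b; reflexivity].
    apply (Ext_comp' true (negb b) _ (hw q u)); [apply Ext_word, hu|apply Ext_fb|destruct b; reflexivity].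
  + rewrite pt_half_turn, hP, hbi; fold (HH q I2 (fb b (q i))); rewrite hcb, fb_invol, e; reflexivity.
Qed.

(** Vertices lie on no wall, so [Ext_inK] leaves only even products: this separates the copies, and
    [even_word_q] separates vertices of one copy. *)
Lemma six_distinct : NoDup (map (proj Gam) six).
Proof.
assert (main : forall b i b' i' z z', pt z = fb b (q i) -> pt z' = fb b' (q i') ->
  proj Gam z = proj Gam z' -> b = b' /\ i = i').
{ intros b i b' i' z z' hz hz' h; apply proj_Gam in h as (f & hf & e).
  rewrite hz, hz' in e.
  destruct (inK_q q hq hdl i) as [k1 k2]; destruct (inK_q q hq hdl i') as [k1' k2'].
  assert (e' : q i' = fb b' (f (fb b (q i)))) by (rewrite <- e, fb_invol; reflexivity).
  assert (hE : Ext q (Bool.eqb (negb b') (negb b)) (fun v => fb b' (f (fb b v)))).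
  { apply (Ext_comp' (negb b') (negb b)); [apply Ext_fb| |reflexivity].
    apply (Ext_comp' true (negb b) _ f); [exact hf|apply Ext_fb|destruct b; reflexivity]. }
  destruct (Ext_inK q hq hdl _ _ (q i) hE k1) as [(h1 & u & h2 & h3)|(h1 & h2 & _)].
  - cbn beta; rewrite <- e'; exact k1'.
  - split; [destruct b, b'; auto; discriminate|].
    apply (even_word_q q hq hdl u); [exact h2|rewrite <- h3; symmetry; exact e'].
  - contradiction. }
assert (pP : forall i, pt (P i) = fb false (q i)) by (intros; apply hP).
assert (pR : forall i, pt (R0 (P i)) = fb true (q i)) by (intros; rewrite hR0, hP; reflexivity).
assert (neP : forall i j, proj Gam (P i) = proj Gam (P j) -> i = j) by (intros i j h; apply (main false i false j _ _ (pP i) (pP j) h)).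
assert (neR : forall i j, proj Gam (R0 (P i)) = proj Gam (R0 (P j)) -> i = j) by (intros i j h; apply (main true i true j _ _ (pR i) (pR j) h)).
assert (nePR : forall i j, proj Gam (R0 (P i)) <> proj Gam (P j)).
{ intros i j h; destruct (main true i false j _ _ (pR i) (pP j) h); discriminate. }
unfold six; simpl; repeat (apply NoDup_cons; [simpl; intuition;
  match goal with
  | h : proj Gam (R0 _) = proj Gam (P _) |- _ => exact (nePR _ _ h)
  | h : proj Gam (R0 _) = proj Gam (R0 _) |- _ => apply neR in h; discriminate
  | h : proj Gam (P _) = proj Gam (P _) |- _ => apply neP in h; discriminate
  end|]); apply NoDup_nil.
Qed.

Lemma exists_nonfixed : exists z, proj Gam (act (half_turn (P I2)) z) <> proj Gam z.
Proof.
destruct (center_exists q hq hdl) as (o & ho & hpo & hxo).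
destruct (pt_surj o ho) as [z hz]; exists z; intros h.
assert (hK : inK q (pt z)).
{ rewrite hz; apply (inK_of_ph q hq hdl); [exact ho|intros i; left; apply hpo|exact hxo]. }
apply eq_sym, proj_Gam in h as (f & hf & e).
rewrite pt_half_turn, hP in e; fold (HH q I2 (pt z)) in e.
destruct (half_fixed_region z f hK hf e) as (u & i & _ & hu).
rewrite hz in hu; exact (center_not_q q hq hdl u i o ho hpo hu).
Qed.

(** Defined on a chosen representative; [half_compatible] makes the choice immaterial. *)
Definition half_turn_map (x : surface Gam) : surface Gam :=
  proj Gam (act (half_turn (P I2)) (proj1_sig (constructive_indefinite_description _ (proj_surj Gam x)))).

Lemma half_turn_map_proj z : half_turn_map (proj Gam z) = proj Gam (act (half_turn (P I2)) z).
Proof.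
unfold half_turn_map; apply half_compatible; symmetry.
exact (proj2_sig (constructive_indefinite_description _ (proj_surj Gam (proj Gam z)))).
Qed.

Lemma half_turn_map_fixed x : half_turn_map x = x <-> In x (map (proj Gam) six).
Proof.
destruct (proj_surj Gam x) as [z ->]; rewrite half_turn_map_proj; apply fixed_iff_six.
Qed.

Lemma half_turn_map_hyperelliptic : hyperelliptic_involution half_turn_map.
Proof.
split; [split; [|split]|].
- intros z; exists 1, (moebius (half_turn (P I2))); split; [lra|]; intros w _; split.
  + apply moebius_ex_derive, (proj2_sig w).
  + exists (act (half_turn (P I2)) w); split; [reflexivity|apply half_turn_map_proj].
- intros x; destruct (proj_surj Gam x) as [z ->]; rewrite !half_turn_map_proj; f_equal.
  apply pt_inj; rewrite !pt_half_turn; apply half_invol, pt_in_H2.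
- destruct exists_nonfixed as [z hz]; exists (proj Gam z); rewrite half_turn_map_proj; exact hz.
- exists (map (proj Gam) six); split; [exact six_distinct|split; [reflexivity|]].
  intros x; symmetry; apply half_turn_map_fixed.
Qed.

End Double.

(* [FF q I2] is fixed by the commutator; unless [dl q > 0] this vector is not
   spacelike, and the commutator is then trivial or parabolic. *)
Section Commutator.

Context (A B : aut) (p pA pB : Disc).
Context (hA : hyperbolic A) (hB : hyperbolic B)
  (hax : forall z, (axis A z /\ axis B z) <-> z = p)
  (hAeq : same A (mul (half_turn p) (half_turn pA)))
  (hBeq : same B (mul (half_turn p) (half_turn pB))).

Definition vert (i : idx) : Disc := match i with I1 => pA | I2 => p | I3 => pB end.
Definition qv (i : idx) : V := pt (vert i).

Lemma qv_in_H2 i : in_H2 (qv i).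
Proof. apply pt_in_H2. Qed.

Lemma lin_A v : lin A v = HH qv I2 (HH qv I1 v).
Proof.
rewrite (proj1 (same_iff_lin _ _) hAeq), lin_mul, !lin_half_turn; reflexivity.
Qed.

Lemma lin_B v : lin B v = HH qv I2 (HH qv I3 v).
Proof.
rewrite (proj1 (same_iff_lin _ _) hBeq), lin_mul, !lin_half_turn; reflexivity.
Qed.

Lemma lin_A_inv v : lin (inv A) v = HH qv I1 (HH qv I2 v).
Proof.
rewrite <- (HH_invol qv qv_in_H2 I2 v) at 1.
rewrite <- (HH_invol qv qv_in_H2 I1 (HH qv I2 v)) at 1.
rewrite <- lin_A; apply lin_inv_l.
Qed.

Lemma lin_B_inv v : lin (inv B) v = HH qv I3 (HH qv I2 v).
Proof.
rewrite <- (HH_invol qv qv_in_H2 I2 v) at 1.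
rewrite <- (HH_invol qv qv_in_H2 I3 (HH qv I2 v)) at 1.
rewrite <- lin_B; apply lin_inv_l.
Qed.

(** The traceless part of a product of two half-turns is the Lorentzian cross product of their
    centres; so its axis passes through both. *)
Lemma dot_Nv_half_turns x y z :
  dot (pt z) (Nv (mul (half_turn x) (half_turn y))) = det (pt z) (pt x) (pt y).
Proof.
assert (e : forall u : Disc, ca (half_turn u) = (0, vt (pt u)) /\ cb (half_turn u) = (vy (pt u), - vx (pt u))).
{ intros u; pose proof (nrm_lt u) as hu; unfold half_turn; cbn [ca cb]; rewrite Cmod_sqr; fold (nrm u).
  split; apply injective_projections; simpl; field; lra. }
destruct (e x) as [e1 e2]; destruct (e y) as [e3 e4].
unfold Nv; cbn [mul ca cb]; rewrite e1, e2, e3, e4; unfold dot, det, Cmult, Cplus, Cconj; cbn [vx vy vt fst snd]; ring.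
Qed.

Lemma sgn_eq_Nv g h z : sgn_eq g h -> dot z (Nv h) = 0 -> dot z (Nv g) = 0.
Proof.
intros [[e1 e2]|[e1 e2]]; unfold dot, Nv; rewrite e1, e2; simpl; lra.
Qed.

(** If the three centres were on one geodesic, [pB] would lie on both axes, hence equal [p], and [B]
    would be trivial. *)
Lemma det_qv_neq0 : det (qv I1) (qv I2) (qv I3) <> 0.
Proof.
unfold qv; simpl; intros h0.
assert (hz : axis A pB /\ axis B pB).
{ split; apply axis_intro; try assumption.
  - apply (sgn_eq_Nv _ _ _ (same_sgn_eq _ _ hAeq)); rewrite dot_Nv_half_turns.
    transitivity (- det (pt pA) (pt p) (pt pB)); [unfold det; ring|rewrite h0; ring].
  - apply (sgn_eq_Nv _ _ _ (same_sgn_eq _ _ hBeq)); rewrite dot_Nv_half_turns; unfold det; ring. }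
apply hax in hz.
assert (hs : same B one).
{ intros z; rewrite hBeq, hz, act_mul, act_one; apply pt_inj; rewrite !pt_half_turn.
  apply half_invol, pt_in_H2. }
apply same_sgn_eq in hs; apply hyperbolic_sqr in hB.
destruct hs as [[e _]|[e _]]; rewrite e in hB; simpl in hB; lra.
Qed.

Definition Cm : aut := commutator (inv B) (inv A).

Definition TT (v : V) : V := HH qv I3 (HH qv I2 (HH qv I1 v)).

Lemma lin_Cm v : lin Cm v = TT (TT v).
Proof.
assert (hii : forall g v, lin (inv (inv g)) v = lin g v).
{ intros g u; f_equal; apply aut_eq; simpl; cring. }
unfold Cm, commutator; rewrite !lin_mul, !hii, lin_A, lin_B, lin_A_inv, lin_B_inv.
rewrite (HH_invol qv qv_in_H2); reflexivity.
Qed.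

Lemma TT_FF : TT (FF qv I2) = FF qv I2.
Proof.
pose proof (HH_nx qv qv_in_H2 I1) as e1; pose proof (HH_nx qv qv_in_H2 I2) as e2; pose proof (HH_nx qv qv_in_H2 I3) as e3.
simpl in *; unfold TT; rewrite e1, e2, e3; reflexivity.
Qed.

Lemma Cm_nontrivial : ~ same Cm one.
Proof.
intros hs; rewrite same_iff_lin in hs.
assert (hTT : forall v, TT (TT v) = v) by (intros v; rewrite <- lin_Cm, hs; apply lin_one).
pose proof (hTT (qv I1)) as e; unfold TT in e.
assert (hf : forall i, HH qv i (qv i) = qv i) by (intros i; apply half_fix, qv_in_H2).
rewrite (hf I1) in e.
assert (e' : HH qv I3 (HH qv I2 (qv I1)) = HH qv I1 (HH qv I2 (HH qv I3 (qv I1)))).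
{ rewrite <- e at 2; rewrite !(HH_invol qv qv_in_H2); reflexivity. }
assert (e2 : dot (HH qv I2 (qv I1)) (qv I3) = dot (HH qv I2 (HH qv I3 (qv I1))) (HH qv I1 (qv I3))).
{ rewrite <- (HH_dot qv qv_in_H2 I3 (HH qv I2 (qv I1))), hf, e'.
  rewrite <- (HH_dot qv qv_in_H2 I1), (HH_invol qv qv_in_H2); reflexivity. }
assert (d0 : det (qv I1) (qv I2) (qv I3) ^ 2 = 0).
{ rewrite det_gram by apply qv_in_H2.
  unfold HH, half in e2; autorewrite with dot in e2.
  rewrite (dot_comm (qv I2) (qv I1)), (dot_comm (qv I3) (qv I1)), (dot_comm (qv I3) (qv I2)) in e2.
  rewrite !(proj1 (qv_in_H2 _)) in e2.
  pose proof (in_H2_dot _ _ (qv_in_H2 I1) (qv_in_H2 I3)) as hv.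
  set (x := dot (qv I1) (qv I2)) in *; set (y := dot (qv I2) (qv I3)) in *; set (z := dot (qv I1) (qv I3)) in *.
  clearbody x y z.
  (* The relation [e2] reduces to [z] times the expression of [det_gram], and [z <= -1]. *)
  assert (E : z * (1 - 2 * x * y * z - x ^ 2 - y ^ 2 - z ^ 2) = 0) by nra.
  apply Rmult_integral in E as [E|E]; lra. }
apply det_qv_neq0; nra.
Qed.

Lemma Cm_hyperbolic (G : aut -> Prop) : G Cm -> acts_freely G -> (forall g, G g -> ~ parabolic g) ->
  0 < dl qv /\ hyperbolic Cm /\ forall z, dot (pt z) (FF qv I2) = 0 -> dot (pt z) (Nv Cm) = 0.
Proof.
intros hC hfree hpar.
assert (hN : lin Cm (FF qv I2) = FF qv I2) by (rewrite lin_Cm, !TT_FF; reflexivity).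
assert (hq1 : dot (FF qv I2) (qv I1) < 0).
{ rewrite (FF_dot_q qv qv_in_H2); pose proof (cc_ge1 qv qv_in_H2 I1); simpl; lra. }
pose proof (FF_norm qv qv_in_H2 I2) as hn.
set (N0 := FF qv I2) in *.
(* With [cb Cm = 0] the origin would be a fixed point. *)
assert (hcb : cb Cm <> 0%C).
{ intros h0; apply Cm_nontrivial, (hfree Cm D0 hC).
  apply Disc_eq; simpl dval; unfold moebius; rewrite h0; unfold Cdiv; ring. }
destruct (fixed_vector_Nv Cm N0 (or_intror hcb) hN) as [k hk].
assert (hk0 : k <> 0).
{ intros h0; rewrite hk, h0, dot_scall in hq1; lra. }
assert (hdlk : dl qv = k ^ 2 * (fst (ca Cm) ^ 2 - 1)).
{ rewrite <- hn, <- Nv_norm; rewrite hk at 1 2; autorewrite with dot; ring. }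
assert (hk2 : 0 < k ^ 2) by nra.
assert (hpos : 0 < dl qv).
{ destruct (Rtotal_order (dl qv) 0) as [h|[h|h]]; [exfalso|exfalso|exact h].
  - assert (hr : 0 < sqrt (- dl qv)) by (apply sqrt_lt_R0; lra).
    pose proof (sqrt_sqrt (- dl qv)) as hs; set (m := sqrt (- dl qv)) in *.
    (* The sign [s] selects the future pointing unit multiple of [N0], which would be a fixed point
       in the disc. *)
    assert (hm : forall s, (s = 1 \/ s = -1) -> 0 < vt (vscal (s / m) N0) -> False).
    { intros s hs1 ht.
      destruct (pt_surj (vscal (s / m) N0)) as [z hz].
      { split; [|exact ht]; autorewrite with dot; rewrite hn.
        replace (dl qv) with (- (m * m)) by lra.
        transitivity (- (s * s)); [field; lra|destruct hs1 as [->| ->]; ring]. }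
      apply Cm_nontrivial, (hfree Cm z hC), pt_inj.
      rewrite pt_act, hz, lin_scal, hN; reflexivity. }
    assert (ht0 : vt N0 <> 0).
    { intros ht; rewrite <- hn in h; unfold dot in h; rewrite ht in h; nra. }
    assert (hmi : 0 < / m) by (apply Rinv_0_lt_compat; exact hr).
    destruct (Rlt_or_le 0 (vt N0)) as [hp|hp].
    + apply (hm 1); [left; reflexivity|]; cbn [vscal vt]; unfold Rdiv; rewrite Rmult_1_l.
      apply Rmult_lt_0_compat; assumption.
    + apply (hm (-1)); [right; reflexivity|]; cbn [vscal vt].
      replace (-1 / m * vt N0) with (/ m * - vt N0) by (field; lra).
      apply Rmult_lt_0_compat; lra.
  - apply (hpar Cm hC); split; [|apply Cm_nontrivial].
    assert (hc : fst (ca Cm) ^ 2 = 1) by nra.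
    unfold abs_trace, Re; rewrite Rabs_mult, (Rabs_right 2) by lra.
    assert (Rabs (fst (ca Cm)) = 1); [|lra].
    rewrite <- Rabs_R1; apply Rsqr_eq_abs_0; rewrite !Rsqr_pow2; lra. }
split; [exact hpos|split].
- apply hyperbolic_sqr; nra.
- intros z hz; rewrite hk, dot_scalr in hz.
  apply Rmult_integral in hz as [hz|hz]; [contradiction|exact hz].
Qed.

(** * [G] as the group of even words *)

Lemma pair_in (G : aut -> Prop) : is_subgroup G -> G A -> G B ->
  forall i j, exists g, G g /\ forall v, lin g v = HH qv i (HH qv j v).
Proof.
intros (h1 & h2 & h3 & _) gA gB i j.
assert (hid : forall i, exists g, G g /\ forall v, lin g v = HH qv i (HH qv i v)).
{ intros k; exists one; split; [exact h1|]; intros v; rewrite lin_one, (HH_invol qv qv_in_H2); reflexivity. }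
destruct i, j; try apply hid.
- exists (inv A); split; [auto|apply lin_A_inv].
- exists (mul (inv A) B); split; [auto|]; intros v.
  rewrite lin_mul, lin_A_inv, lin_B, (HH_invol qv qv_in_H2); reflexivity.
- exists A; split; [auto|apply lin_A].
- exists B; split; [auto|apply lin_B].
- exists (mul (inv B) A); split; [auto|]; intros v.
  rewrite lin_mul, lin_B_inv, lin_A, (HH_invol qv qv_in_H2); reflexivity.
- exists (inv B); split; [auto|apply lin_B_inv].
Qed.

Lemma even_list_ind {T : Type} (Q : list T -> Prop) : Q [] ->
  (forall x y l, Nat.even (length l) = true -> Q l -> Q (x :: y :: l)) ->
  forall l, Nat.even (length l) = true -> Q l.
Proof.
intros h0 h2 l.
assert (main : forall n l, (length l <= n)%nat -> Nat.even (length l) = true -> Q l); [|apply (main (length l)); lia].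
clear l; induction n as [|n IH]; intros l hn he.
- destruct l; [exact h0|simpl in hn; lia].
- destruct l as [|x [|y l]]; [exact h0|discriminate|].
  simpl in hn, he; apply h2; [exact he|apply IH; [lia|exact he]].
Qed.

Lemma word_in (G : aut -> Prop) : is_subgroup G -> G A -> G B ->
  forall w, Nat.even (length w) = true -> exists g, G g /\ forall v, lin g v = hw qv w v.
Proof.
intros hG gA gB; apply even_list_ind.
- exists one; split; [apply hG|apply lin_one].
- intros i j w _ (g & hg & e).
  destruct (pair_in G hG gA gB i j) as (g' & hg' & e').
  exists (mul g' g); split; [apply hG; assumption|].
  intros v; rewrite lin_mul, e', e; reflexivity.
Qed.

Lemma generated_even_word g : generated [A; B] g ->
  exists w, Nat.even (length w) = true /\ forall v, lin g v = hw qv w v.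
Proof.
induction 1 as [g hg| |g h _ (w1 & a1 & b1) _ (w2 & a2 & b2)|g _ (w & a & b)|g h hs _ (w & a & b)].
- destruct hg as [<-|[<-|[]]]; [exists [I2; I1]|exists [I2; I3]]; split; try reflexivity; [apply lin_A|apply lin_B].
- exists []; split; [reflexivity|apply lin_one].
- exists (w1 ++ w2); split; [rewrite even_app, a1, a2; reflexivity|].
  intros v; rewrite lin_mul, b2, b1, hw_app; reflexivity.
- exists (rev w); split; [rewrite even_rev; exact a|].
  intros v; rewrite <- (hw_rev' qv qv_in_H2 w v) at 1; rewrite <- b; apply lin_inv_l.
- exists w; split; [exact a|]; intros v; rewrite <- b; symmetry; apply same_iff_lin, hs.
Qed.

End Commutator.

(** * The group generated by [A], [B] and their mirror images *)

Section DoubleGroup.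

Context (A B A' B' : aut) (p pA pB : Disc).
Context (hAeq : same A (mul (half_turn p) (half_turn pA)))
  (hBeq : same B (mul (half_turn p) (half_turn pB))).
Context (R0 : Disc -> Disc).
Notation q := (qv p pA pB).
Context (hdl : 0 < dl q).
Context (hR0 : forall z, pt (R0 z) = refl (FF q I2) (pt z)).
Context (hA' : forall z, act A' z = R0 (act A (R0 z))) (hB' : forall z, act B' z = R0 (act B (R0 z))).

Let hq : forall i, in_H2 (q i) := qv_in_H2 p pA pB.

Lemma R0_invol z : R0 (R0 z) = z.
Proof. apply pt_inj; rewrite !hR0; apply (NN_refl_invol q hq hdl), NN_FF. Qed.

Lemma generated_Ext g : generated [A; B; A'; B'] g ->
  exists f, Ext q true f /\ forall z, pt (act g z) = f (pt z).
Proof.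
assert (base : forall g g', (exists w, Nat.even (length w) = true /\ forall v, lin g v = hw q w v) ->
  (forall z, act g' z = R0 (act g (R0 z))) -> exists f, Ext q true f /\ forall z, pt (act g' z) = f (pt z)).
{ intros g0 g0' (w & hw1 & hw2) h.
  exists (fun v => refl (FF q I2) (hw q w (refl (FF q I2) v))); split.
  - apply (Ext_comp' q hq false false true); [apply Ext_refl, NN_FF| |reflexivity].
    apply (Ext_comp' q hq true false false (hw q w)); [apply Ext_word, hw1|apply Ext_refl, NN_FF|reflexivity].
  - intros z; rewrite h, hR0, pt_act, hw2, hR0; reflexivity. }
pose proof (generated_even_word A B p pA pB hAeq hBeq) as hword.
induction 1 as [g hg| |g h _ (f1 & a1 & b1) _ (f2 & a2 & b2)|g _ (f & a & b)|g h hs _ (f & a & b)].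
- destruct hg as [<-|[<-|[<-|[<-|[]]]]].
  + destruct (hword A) as (w & h1 & h2); [apply gen_in; simpl; auto|].
    exists (hw q w); split; [apply Ext_word, h1|intros z; rewrite pt_act; apply h2].
  + destruct (hword B) as (w & h1 & h2); [apply gen_in; simpl; auto|].
    exists (hw q w); split; [apply Ext_word, h1|intros z; rewrite pt_act; apply h2].
  + apply (base A A'); [apply hword, gen_in; simpl; auto|exact hA'].
  + apply (base B B'); [apply hword, gen_in; simpl; auto|exact hB'].
- exists (hw q []); split; [apply Ext_word; reflexivity|intros z; rewrite act_one; reflexivity].
- exists (fun v => f1 (f2 v)); split; [apply (Ext_comp' q hq true true true); auto|].
  intros z; rewrite act_mul, b1, b2; reflexivity.
- destruct (Ext_inv q hq hdl true f a) as (f' & c1 & c2 & c3); exists f'; split; [exact c1|].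
  intros z; rewrite <- (c2 (pt (act (inv g) z))), <- b, act_inv_r; reflexivity.
- exists f; split; [exact a|]; intros z; rewrite <- hs; apply b.
Qed.

Lemma generated_subgroup l : is_subgroup (generated l).
Proof.
split; [apply gen_one|split; [apply gen_mul|split; [apply gen_inv|apply gen_same]]].
Qed.

Lemma generated_conj g : generated [A; B] g ->
  exists g', generated [A; B; A'; B'] g' /\ forall z, act g' z = R0 (act g (R0 z)).
Proof.
induction 1 as [g hg| |g h _ (g1 & a1 & b1) _ (g2 & a2 & b2)|g _ (g1 & a & b)|g h hs _ (g1 & a & b)].
- destruct hg as [<-|[<-|[]]]; [exists A'|exists B']; split; auto; apply gen_in; simpl; auto.
- exists one; split; [apply gen_one|]; intros z; rewrite !act_one, R0_invol; reflexivity.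
- exists (mul g1 g2); split; [apply gen_mul; assumption|].
  intros z; rewrite !act_mul, b2, b1, R0_invol; reflexivity.
- exists (inv g1); split; [apply gen_inv, a|]; intros z.
  rewrite <- (act_inv_l g1 (R0 (act (inv g) (R0 z)))), b, R0_invol, act_inv_r, R0_invol; reflexivity.
- exists g1; split; [exact a|]; intros z; rewrite <- hs; apply b.
Qed.

Lemma generated_mono l l' g : incl l l' -> generated l g -> generated l' g.
Proof.
intros hl; induction 1; [apply gen_in; auto|apply gen_one|apply gen_mul|apply gen_inv|eapply gen_same]; eauto.
Qed.

(** With [v1], [v2] the images of [FF q I2] under [g1], [g2] in [G], the product is
    [g1 (R0 (inv g1 g2) R0) (inv g2)], and the middle factor is the mirror image of an element of
    [G]. *)
Lemma refl_pair v1 v2 : NN q v1 -> NN q v2 ->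
  exists g, generated [A; B; A'; B'] g /\ forall z, pt (act g z) = refl v1 (refl v2 (pt z)).
Proof.
intros hv1 hv2.
assert (hgen : forall w, Nat.even (length w) = true -> exists g, generated [A; B] g /\ forall v, lin g v = hw q w v).
{ apply (word_in A B p pA pB hAeq hBeq); [apply generated_subgroup|apply gen_in; simpl; auto..]. }
assert (hmono : forall g, generated [A; B] g -> generated [A; B; A'; B'] g).
{ intros g; apply generated_mono; intros x [<-|[<-|[]]]; simpl; auto. }
destruct (NN_in_orbit q hq v1 hv1) as (w1 & e1 & ->); destruct (NN_in_orbit q hq v2 hv2) as (w2 & e2 & ->).
destruct (hgen w1 e1) as (g1 & k1 & l1); destruct (hgen w2 e2) as (g2 & k2 & l2).
destruct (generated_conj (mul (inv g1) g2)) as (g' & k' & l').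
{ apply gen_mul; [apply gen_inv|]; assumption. }
exists (mul g1 (mul g' (inv g2))); split.
- apply gen_mul; [auto|apply gen_mul; [exact k'|apply gen_inv; auto]].
- intros z; rewrite !act_mul, l', !act_mul, pt_act, hR0, pt_act, pt_act, hR0, pt_act.
  rewrite l1, (hw_refl q hq), <- !l1, lin_inv_r, l2, (hw_refl q hq), <- !l2, lin_inv_r; reflexivity.
Qed.

Lemma Ext_generated f : Ext q true f ->
  exists g, generated [A; B; A'; B'] g /\ forall z, pt (act g z) = f (pt z).
Proof.
intros (l & w & h1 & h2 & h3 & h4).
assert (hrw : forall l, Nat.even (length l) = true -> Forall (NN q) l ->
  exists g, generated [A; B; A'; B'] g /\ forall z, pt (act g z) = rw l (pt z)).
{ apply (even_list_ind (fun l => Forall (NN q) l -> exists g, generated [A; B; A'; B'] g /\ forall z, pt (act g z) = rw l (pt z))).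
  - exists one; split; [apply gen_one|intros z; rewrite act_one; reflexivity].
  - intros v1 v2 l' _ IH hl; inversion hl as [|? ? n1 hl']; subst; inversion hl' as [|? ? n2 hl'']; subst.
    destruct (IH hl'') as (g & k & e); destruct (refl_pair v1 v2 n1 n2) as (g' & k' & e').
    exists (mul g' g); split; [apply gen_mul; assumption|].
    intros z; rewrite act_mul, e', e; reflexivity. }
destruct (hrw l h2 h1) as (g & k & e).
destruct (word_in A B p pA pB hAeq hBeq (generated [A; B; A'; B'])) with (w := w) as (g' & k' & e').
- apply generated_subgroup.
- apply gen_in; simpl; auto.
- apply gen_in; simpl; auto.
- exact h3.
- exists (mul g g'); split; [apply gen_mul; assumption|].
  intros z; rewrite act_mul, e, pt_act, e', h4; reflexivity.
Qed.

End DoubleGroup.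

Theorem mainTheorem9
  (G : aut -> Prop)
  (hG : is_fuchsian G)
  (hfree : is_free_of_rank_two G)
  (hpar : forall g, G g -> ~ parabolic g)
  (A B : aut) (p pA pB : Disc)
  (hAB : intersecting_pair A B p pA pB)
  (hstop : stopping G A B p pA pB)
  (R0 : Disc -> Disc)
  (hR0 : is_reflection_in (axis (commutator (inv B) (inv A))) R0)
  (p' pA' pB' : Disc)
  (hp' : p' = R0 p) (hpA' : pA' = R0 pA) (hpB' : pB' = R0 pB)
  (A' B' : aut)
  (hA' : forall z, act A' z = R0 (act A (R0 z)))
  (hB' : forall z, act B' z = R0 (act B (R0 z)))
  (Gam : aut -> Prop)
  (hGam : generates [A; B; A'; B'] Gam) :
  is_nielsen_double G Gam R0 /\
  exists J : surface Gam -> surface Gam,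
    (forall z, J (proj Gam z) = proj Gam (act (half_turn p) z)) /\
    hyperelliptic_involution J /\
    (forall x, J x = x <-> In x (map (proj Gam) [p; pA; pB; p'; pA'; pB'])) /\
    weierstrass_points (fun x => In x (map (proj Gam) [p; pA; pB; p'; pA'; pB'])).
Proof.
destruct hAB as (hA & hB & hax & hAeq & hBeq).
destruct hstop as (hgen & _).
set (q := qv p pA pB).
assert (hq : forall i, in_H2 (q i)) by apply qv_in_H2.
pose proof (free_fuchsian_acts_freely G hG hfree) as hGfree.
assert (gA : G A) by (apply hgen, gen_in; simpl; auto).
assert (gB : G B) by (apply hgen, gen_in; simpl; auto).
destruct (proj1 hG) as (_ & hmul & hinv & _).
assert (gC : G (Cm A B)) by (unfold Cm, commutator; auto).
(* This provides [0 < dl q], on which the geometric sections rest, and the commutator as the element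
   [T] whose axis is a wall. *)
destruct (Cm_hyperbolic A B p pA pB hA hB hax hAeq hBeq G gC hGfree hpar) as (hdl & hChyp & hCaxis).
assert (hR0' : forall z, pt (R0 z) = refl (FF q I2) (pt z)).
{ apply (reflection_refl _ _ _ hR0).
  - rewrite FF_norm by exact hq; exact hdl.
  - intros z hz; apply (axis_intro (Cm A B)); [exact hChyp|apply hCaxis, hz]. }
assert (hGw : forall g, G g -> exists w, Nat.even (length w) = true /\ forall v, lin g v = hw q w v).
{ intros g hg; apply (generated_even_word A B p pA pB hAeq hBeq), hgen, hg. }
assert (hwG : forall w, Nat.even (length w) = true -> exists g, G g /\ forall v, lin g v = hw q w v).
{ apply (word_in A B p pA pB hAeq hBeq); [apply hG|exact gA|exact gB]. }
assert (hGsub : is_subgroup Gam).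
{ destruct (generated_subgroup [A; B; A'; B']) as (s1 & s2 & s3 & s4).
  split; [apply hGam, s1|split; [intros g h hg hh; apply hGam, s2; apply hGam; assumption|split]].
  - intros g hg; apply hGam, s3, hGam, hg.
  - intros g h hs hg; apply hGam, (s4 g); [exact hs|apply hGam, hg]. }
assert (hGamE : forall g, Gam g -> exists f, Ext q true f /\ forall z, pt (act g z) = f (pt z)).
{ intros g hg; apply (generated_Ext A B A' B' p pA pB hAeq hBeq R0 hdl hR0' hA' hB'), hGam, hg. }
assert (hEGam : forall f, Ext q true f -> exists g, Gam g /\ forall z, pt (act g z) = f (pt z)).
{ intros f hf; destruct (Ext_generated A B A' B' p pA pB hAeq hBeq R0 hdl hR0' hA' hB' f hf) as (g & hg & e).
  exists g; split; [apply hGam, hg|exact e]. }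
assert (hP : forall i, pt (vert p pA pB i) = q i) by reflexivity.
split.
{ eapply nielsen_double; eassumption. }
assert (hsix : [p; pA; pB; p'; pA'; pB'] = six R0 (vert p pA pB)) by (subst; reflexivity).
rewrite hsix.
assert (hJ : hyperelliptic_involution (half_turn_map Gam (vert p pA pB))).
{ eapply half_turn_map_hyperelliptic; eassumption. }
assert (hfix : forall x, half_turn_map Gam (vert p pA pB) x = x <->
  In x (map (proj Gam) (six R0 (vert p pA pB)))).
{ eapply half_turn_map_fixed; eassumption. }
exists (half_turn_map Gam (vert p pA pB)); split; [|split; [exact hJ|split; [exact hfix|]]].
- eapply half_turn_map_proj; eassumption.
- exists (half_turn_map Gam (vert p pA pB)); split; [exact hJ|].
  intros x; symmetry; apply hfix.
Qed.
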